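(* Let $A$ be a local algebra with maximal ideal $I_A$, and let $P$ be a differential manifold modelled on an affine space $(M,V)$. Then $AP$ is a differential manifold modelled on the affine space $(AM, I_A\otimes V)$.
   Context: A local algebra is an associative, commutative real algebra $A$ with identity, finite-dimensional over $\mathbb R$, having a unique maximal ideal $I_A$, with $A/I_A\simeq\mathbb R$. Let $0_A:A\to\mathbb R$ be the induced identity-preserving algebra homomorphism with kernel $I_A$. Tensor products are over $\mathbb R$. Manifolds are paracompact smooth manifolds modelled on finite-dimensional real affine spaces; $(M,V)$ denotes an affine space $M$ together with the vector space $V$. For a manifold $P$, $AP$ is the set of all identity-preserving real algebra homomorphisms $u:C^\infty(P)\to A$. For each $u\in AP$ there is exactly one $p\in P$ such that $0_A\circ u$ is evaluation at $p$; put $\alpha^T_P(u)=p$, which defines a map $\alpha^T_P:AP\to P$. For an affine space $(M,V)$, $AM$ is the set $AP$ in the case $P=M$. With a basis $(e_1,\dots,e_m)$ of $V$ and dual basis $(e^1,\dots,e^m)$, the map $AM\to M\times(I_A\otimes V)$, $u\mapsto\big(x,\sum_i u(x^i)\otimes e_i\big)$, where $x=\alpha^T_M(u)$ and $x^i:M\to\mathbb R$, $x^i(y)=e^i(y-x)$, is a bijection independent of the chosen basis. The affine space structure on $AM$ is the one induced by this bijection; the affine space so obtained is denoted $(AM, I_A\otimes V)$.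
   Formalization: The affine space AM carries the structure induced by the bijection with M×(I_A⊗V), so its vector space is V×(I_A⊗V), not I_A⊗V; and the cardinality of P is assumed non-measurable (no non-principal countably complete ultrafilter), which is needed for every u in AP to lie over a point of P. *)

(* Defs.v *)
From HB Require Import structures.
From mathcomp Require Import all_boot all_order all_algebra falgebra.
From mathcomp Require Import all_classical all_reals all_analysis.
Import Order.TTheory GRing.Theory Num.Theory.
Import numFieldNormedType.Exports.

Set Implicit Arguments.
Unset Strict Implicit.
Unset Printing Implicit Defensive.

Local Open Scope classical_set_scope.
Local Open Scope ring_scope.

Section smooth_coordinates.
Context {R : realType} {n : nat}.
Implicit Types (W : set 'rV[R]_n) (f g : 'rV[R]_n -> R).

(* Only meaningful for W open: f, and all its iterated partial derivatives of
   order at most k, exist and are continuous at every point of W. *)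
Fixpoint Ck (k : nat) W f : Prop :=
  (forall x, W x -> {for x, continuous f}) /\
  if k is k'.+1 then
    (forall i x, W x -> derivable f x (delta_mx 0 i)) /\
    (forall i, Ck k' W ('D_(delta_mx 0 i) f))
  else True.

Definition Cinfty W f := forall k, Ck k W f.

Lemma Ck_cont k W f : Ck k W f -> forall x, W x -> {for x, continuous f}.
Proof. by case: k => [|k] []. Qed.

Lemma Ck_down k W f : Ck k.+1 W f -> Ck k W f.
Proof.
elim: k f => [|k IH] f [cf [df Df]]; split => //; split => // i.
exact: IH (Df i).
Qed.

Lemma Ck_ext k W f g : open W -> (forall x, W x -> f x = g x) ->
  Ck k W f -> Ck k W g.
Proof.
move=> oW; elim: k f g => [|k IH] f g fg [cf H].
all: have nfg x : W x -> \forall y \near x, f y = g y by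
  move=> Wx; apply: filterS (open_nbhs_nbhs (conj oW Wx)) => y; exact: fg.
all: have cg x : W x -> {for x, continuous g} by
  move=> Wx; rewrite /prop_for /continuous_at -fg //;
  apply: (cvg_trans _ (cf x Wx));
  exact: (@near_eq_cvg _ _ (nbhs x) _ f g (nfg x Wx)).
  by split.
case: H => df Df; split=> //; split.
- by move=> i x Wx; apply: near_eq_derivable (df i x Wx); exact: nfg.
- move=> i; apply: (IH _ _ _ (Df i)) => x Wx.
  by apply: near_eq_derive; exact: nfg.
Qed.

Lemma Ck_cst k W (c : R) : open W -> Ck k W (cst c).
Proof.
move=> oW; have cc x : W x -> {for x, continuous (cst c : 'rV[R]_n -> R)}.
  by move=> _; exact: cst_continuous.
elim: k c cc => [|k IH] c cc; split=> //; split=> [i x _|i].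
  exact: derivable_cst.
apply: (Ck_ext oW _ (IH 0 _)) => [x _|x _]; last exact: cst_continuous.
by rewrite derive_cst.
Qed.

Lemma Ck_add k W f g : open W -> Ck k W f -> Ck k W g -> Ck k W (f + g).
Proof.
move=> oW; elim: k f g => [|k IH] f g [cf Hf] [cg Hg]; split=> //.
- by move=> x Wx; exact: (continuousD (cf x Wx) (cg x Wx)).
- by move=> x Wx; exact: (continuousD (cf x Wx) (cg x Wx)).
case: Hf Hg => df Df [dg Dg]; split.
  by move=> i x Wx; apply: derivableD; [exact: df|exact: dg].
move=> i; apply: (Ck_ext oW _ (IH _ _ (Df i) (Dg i))) => x Wx.
by rewrite deriveD//; [exact: df|exact: dg].
Qed.

Lemma Ck_mul k W f g : open W -> Ck k W f -> Ck k W g -> Ck k W (f * g).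
Proof.
move=> oW; elim: k f g => [|k IH] f g Hf Hg.
  case: Hf Hg => cf _ [cg _]; split=> // x Wx.
  by exact: (continuousM (cf x Wx) (cg x Wx)).
have [f' g'] := (Ck_down Hf, Ck_down Hg).
case: Hf Hg => cf [df Df] [cg [dg Dg]]; split; last split.
- by move=> x Wx; exact: (continuousM (cf x Wx) (cg x Wx)).
- by move=> i x Wx; apply: derivableM; [exact: df|exact: dg].
move=> i.
apply: (Ck_ext oW _ (Ck_add oW (IH _ _ f' (Dg i)) (IH _ _ g' (Df i)))) => x Wx.
by rewrite deriveM//; [exact: df|exact: dg].
Qed.

Lemma Cinfty_coord W (j : 'I_n) : open W -> Cinfty W (fun r => r 0 j).
Proof.
move=> oW; case=> [|k]; split=> //.
- by move=> x _; exact: coord_continuous.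
- by move=> x _; exact: coord_continuous.
have dj i (x : 'rV[R]_n) :
    is_derive x (delta_mx 0 i) (fun r : 'rV[R]_n => r 0 j) ((i == j)%:R : R).
  have E : (fun h : R => h^-1 *: ((((fun r : 'rV[R]_n => r 0 j) \o shift x)
      (h *: delta_mx 0 i)) - x 0 j)) @ 0^' --> ((i == j)%:R : R).
    apply: (@cvg_trans _ ((cst ((i == j)%:R : R)) @ 0^')); last exact: cvg_cst.
    apply: near_eq_cvg; near=> h.
    have h0 : h != 0 by near: h; exact: nbhs_dnbhs_neq.
    rewrite /= !mxE addrK eqxx /= [j == i]eq_sym.
    by rewrite /GRing.scale /= mulrA mulVf // mul1r.
  by split; [apply/cvg_ex; exists (i == j)%:R | exact: cvg_lim E].
split=> [i x _|i]; first exact: ex_derive.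
apply: (Ck_ext oW _ (Ck_cst k ((i == j)%:R) oW)) => x _.
by rewrite derive_val.
Unshelve. all: by end_near.
Qed.

End smooth_coordinates.

Record affine {R : realType} (V : vectType R) (M : Type) := Affine {
  aff_add : M -> V -> M;
  aff_sub : M -> M -> V; (* aff_sub y x is the vector y - x *)
  aff_inhabited : inhabited M;
  aff_add0 : forall x, aff_add x 0 = x;
  aff_addA : forall x v w, aff_add (aff_add x v) w = aff_add x (v + w);
  aff_subK : forall x y, aff_add x (aff_sub y x) = y;
  aff_addK : forall x v, aff_sub (aff_add x v) x = v
}.

Section affine_calculus.
Context {R : realType} {V : vectType R} {M : Type} (E : affine V M).

(* The affine frame with origin a and basis vbasis {:V}; topology and smoothness
   below are required in the frames of all origins, but as any two frames differ
   by a translation of 'rV_(\dim {:V}) one origin would do. *)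
Definition aff_frame (a : M) (r : 'rV[R]_(\dim {:V})) : M :=
  aff_add E a (passmx.vecof (vbasis {:V}) r).

Definition aff_open (U : set M) := forall a, open (aff_frame a @^-1` U).

(* Only meaningful for U open. *)
Definition smooth_on (U : set M) (f : M -> R) :=
  forall a, Cinfty (aff_frame a @^-1` U) (f \o aff_frame a).

Definition smooth_map_on {W : vectType R} {N : Type} (F : affine W N)
    (U : set M) (g : M -> N) :=
  forall (b : N) (l : {scalar W}), smooth_on U (fun x => l (aff_sub F (g x) b)).

Lemma smooth_on_scalar U a (l : {scalar V}) : aff_open U ->
  smooth_on U (fun x => l (aff_sub E x a)).
Proof.
move=> oU b k; set W := _ @^-1` U.
have oW : open W := oU b.
have subD y v : aff_sub E (aff_add E y v) a = aff_sub E y a + v.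
  by rewrite -{1}(aff_subK E a y) aff_addA aff_addK.
have -> : (fun x => l (aff_sub E x a)) \o aff_frame b =
    cst (l (aff_sub E b a)) +
    \sum_(i < \dim {:V}) (cst (l (vbasis {:V})`_i) * fun r => r 0 i).
  apply/funext => r /=; rewrite /aff_frame subD linearD /= /passmx.vecof.
  rewrite linear_sum /GRing.add /=; congr (_ + _); rewrite fct_sumE.
  by apply: eq_bigr => i _; rewrite linearZ /= mulrC.
apply: (Ck_add oW (Ck_cst k _ oW)).
elim/big_ind : _ => [|f g|i _]; first exact: (Ck_cst k 0 oW).
  exact: Ck_add.
by apply: (Ck_mul oW (Ck_cst k _ oW)); exact: Cinfty_coord.
Qed.

End affine_calculus.

(* A chart is a bijection of cdom onto an open subset of M; cmap is given as a
   total function but its values outside cdom play no role. *)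
Record chart {R : realType} {V : vectType R} {M : Type} (E : affine V M)
    (P : Type) := Chart {
  cdom : set P;
  cmap : P -> M;
  chart_inj : forall p q, cdom p -> cdom q -> cmap p = cmap q -> p = q;
  chart_open : aff_open E (cmap @` cdom)
}.

(* The set P together with the topology defined by a family of charts. *)
Definition mspace {R : realType} {V : vectType R} {M : Type} {E : affine V M}
  {P : Type} (C : set (chart E P)) : Type := P.

Section atlas_topology.
Context {R : realType} {V : vectType R} {M : Type} {E : affine V M} {P : Type}.
Variable C : set (chart E P).

Definition atlas_open (O : set P) :=
  forall c, C c -> aff_open E (cmap c @` (O `&` cdom c)).

Let atlas_openT : atlas_open setT.
Proof. by move=> c _; rewrite setTI; exact: chart_open. Qed.

Let atlas_openI : setI_closed atlas_open.
Proof.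
move=> A B oA oB c Cc a.
have -> : cmap c @` (A `&` B `&` cdom c) =
    (cmap c @` (A `&` cdom c)) `&` (cmap c @` (B `&` cdom c)).
  apply/seteqP; split=> [x [p [[Ap Bp] cp] <-]|x [[p [Ap cp] <-] [q [Bq cq]]]].
    by split; exists p.
  by move/(chart_inj cq cp) => qp; subst q; exists p.
by rewrite preimage_setI; apply: openI; [exact: oA|exact: oB].
Qed.

Let atlas_open_bigU (I : Type) (f : I -> set P) :
  (forall i, atlas_open (f i)) -> atlas_open (\bigcup_i f i).
Proof.
move=> of_ c Cc a.
have -> : cmap c @` (\bigcup_i f i `&` cdom c) =
    \bigcup_i (cmap c @` (f i `&` cdom c)).
  apply/seteqP; split=> [x [p [[i _ fp] cp] <-]|x [i _ [p [fp cp] <-]]].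
    by exists i => //; exists p.
  by exists p => //; split => //; exists i.
by rewrite preimage_bigcup; apply: bigcup_open => i _; exact: of_.
Qed.

HB.instance Definition _ := gen_eqMixin (mspace C).
HB.instance Definition _ := gen_choiceMixin (mspace C).
HB.instance Definition _ := isOpenTopological.Build (mspace C)
  atlas_openT atlas_openI atlas_open_bigU.

End atlas_topology.

Definition locally_finite {T : topologicalType} (G : set (set T)) :=
  forall x : T, exists2 N, nbhs x N & finite_set (G `&` [set O | O `&` N !=set0]).

Definition paracompact (T : topologicalType) :=
  hausdorff_space T /\
  forall F : set (set T), F `<=` open -> \bigcup_(O in F) O = setT ->
    exists G : set (set T), [/\ G `<=` open, \bigcup_(O in G) O = setT,
      forall O, G O -> exists2 O', F O' & O `<=` O' & locally_finite G].

Section manifolds.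
Context {R : realType} {V : vectType R} {M : Type} {E : affine V M} {P : Type}.

(* The transition map cmap d \o (cmap c)^-1 is the restriction of g. *)
Definition chart_compatible (c d : chart E P) :=
  let W := cmap c @` (cdom c `&` cdom d) in
  aff_open E W /\
  exists2 g : M -> M, smooth_map_on E E W g &
    forall p, cdom c p -> cdom d p -> cmap d p = g (cmap c p).

Definition smooth_atlas (C : set (chart E P)) :=
  (forall p, exists2 c, C c & cdom c p) /\
  (forall c d, C c -> C d -> chart_compatible c d).

(* A manifold modelled on E, presented by an atlas that need not be maximal. *)
Definition manifold (C : set (chart E P)) :=
  smooth_atlas C /\ paracompact (mspace C).

Definition smooth (C : set (chart E P)) (f : P -> R) :=
  forall c, C c -> exists2 g : M -> R, smooth_on E (cmap c @` cdom c) g &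
    forall p, cdom c p -> f p = g (cmap c p).

Definition smooth_pred (C : set (chart E P)) : {pred P -> R} :=
  mem [set f | smooth C f].

Record smoothfun (C : set (chart E P)) := SmoothFun {
  smval :> P -> R;
  smvalP : smval \in smooth_pred C
}.

End manifolds.

Section smooth_algebra.
Context {R : realType} {V : vectType R} {M : Type} {E : affine V M} {P : Type}.
Variable C : set (chart E P).

Let oW (c : chart E P) a : open (aff_frame E a @^-1` (cmap c @` cdom c)).
Proof. exact: chart_open. Qed.

Lemma smooth_cst (k : R) : smooth C (cst k).
Proof.
move=> c Cc; exists (cst k) => // a n; exact: (Ck_cst n k (@oW c a)).
Qed.

Lemma smooth_add f g : smooth C f -> smooth C g -> smooth C (f + g).
Proof.
move=> sf sg c Cc; have [[f' sf' ef] [g' sg' eg]] := (sf c Cc, sg c Cc).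
exists (f' + g'); last by move=> p cp; rewrite -[RHS]/(f' _ + g' _) -ef // -eg.
by move=> a n; exact: (Ck_add (@oW c a) (sf' a n) (sg' a n)).
Qed.

Lemma smooth_mul f g : smooth C f -> smooth C g -> smooth C (f * g).
Proof.
move=> sf sg c Cc; have [[f' sf' ef] [g' sg' eg]] := (sf c Cc, sg c Cc).
exists (f' * g'); last by move=> p cp; rewrite -[RHS]/(f' _ * g' _) -ef // -eg.
by move=> a n; exact: (Ck_mul (@oW c a) (sf' a n) (sg' a n)).
Qed.

Lemma smooth_scale k f : smooth C f -> smooth C (k *: f).
Proof. by move=> sf; exact: (smooth_mul (smooth_cst k) sf). Qed.

Fact smooth_subring_closed : subring_closed (smooth_pred C).
Proof.
split=> [|f g|f g]; rewrite !inE; first exact: smooth_cst.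
  move=> sf sg; rewrite -scaleN1r; apply: smooth_add => //.
  exact: smooth_scale.
exact: smooth_mul.
Qed.

Fact smooth_scaler_closed : scaler_closed (smooth_pred C).
Proof. by move=> k f; rewrite !inE; exact: smooth_scale. Qed.

HB.instance Definition _ :=
  GRing.isSubringClosed.Build (P -> R) (smooth_pred C) smooth_subring_closed.
HB.instance Definition _ :=
  GRing.isScaleClosed.Build R (P -> R) (smooth_pred C) smooth_scaler_closed.

HB.instance Definition _ := [isSub for (@smval R V M E P C)].
HB.instance Definition _ := [Choice of smoothfun C by <:].
HB.instance Definition _ := GRing.SubChoice_isSubComPzRing.Build
  (P -> R) (smooth_pred C) (smoothfun C) smooth_subring_closed.
HB.instance Definition _ := [SubZmodule_isSubLmodule of smoothfun C by <:].

End smooth_algebra.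

Section local_algebras.
Context {R : realType} (A : falgType R).

Definition is_ideal (J : {vspace A}) :=
  forall a x, x \in J -> (a * x \in J) && (x * a \in J).

Definition maximal_ideal (J : {vspace A}) :=
  [/\ is_ideal J, J <> fullv &
      forall K, is_ideal K -> (J <= K)%VS -> K <> fullv -> K = J].

(* An isomorphism from A / I to R is given as the algebra homomorphism
   zA : A -> R with kernel I that it induces. *)
Definition local_algebra (I : {vspace A}) (zA : {lrmorphism A -> R^o}) :=
  [/\ commutative ( *%R : A -> A -> A),
      maximal_ideal I,
      forall J, maximal_ideal J -> J = I &
      forall a, (a \in I) = (zA a == 0)].

End local_algebras.

Section tensor_products.
Context {R : realType}.

(* For V finite-dimensional, W (x) V is realised as Hom(V^*, W), a (x) v being
   the map l |-> l(v) a; tensor_universal is its universal property. *)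
Definition tensor (W V : vectType R) : vectType R := 'Hom('Hom(V, R^o), W).

Definition tens {W V : vectType R} (a : W) (v : V) : tensor W V :=
  linfun (fun l : 'Hom(V, R^o) => (l v : R) *: a).

Lemma tensE (W V : vectType R) (a : W) (v : V) (l : 'Hom(V, R^o)) :
  tens a v l = (l v : R) *: a.
Proof.
rewrite /tens; pose f := fun l : 'Hom(V, R^o) => (l v : R) *: a.
have f_lin : linear f.
  by move=> k l1 l2; rewrite /f !lfunE /= lfunE /= scalerDl scalerA.
pose lin := GRing.isLinear.Build R 'Hom(V, R^o) W _ f f_lin.
pose F : {linear 'Hom(V, R^o) -> W} := HB.pack f lin.
exact: (lfunE F l).
Qed.

Lemma tens_linearl (W V : vectType R) (v : V) :
  linear (fun a : W => tens a v).
Proof.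
move=> k a a'; apply/lfunP => l; rewrite add_lfunE scale_lfunE !tensE.
by rewrite scalerDr !scalerA mulrC.
Qed.

Lemma tens_linearr (W V : vectType R) (a : W) : linear (tens a : V -> _).
Proof.
move=> k v v'; apply/lfunP => l; rewrite add_lfunE scale_lfunE !tensE.
by rewrite linearP scalerDl scalerA.
Qed.

Lemma tens_decomp (W V : vectType R) (t : tensor W V) :
  t = \sum_(i < \dim {:V})
        tens (t (linfun (coord (vbasis {:V}) i : V -> R^o))) (vbasis {:V})`_i.
Proof.
apply/lfunP => l; rewrite sum_lfunE.
under eq_bigr => i _ do rewrite tensE -linearZ.
rewrite -linear_sum; congr (t _); apply/lfunP => v; rewrite sum_lfunE.
rewrite {1}(coord_vbasis (memvf v)) linear_sum; apply: eq_bigr => i _.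
by rewrite lfunE /= lfunE /= linearZ /= /GRing.scale /= mulrC.
Qed.

Lemma tensor_universal (W V : vectType R) (U : lmodType R) (b : W -> V -> U) :
  (forall v, linear (b^~ v)) -> (forall a, linear (b a)) ->
  exists2 h : {linear tensor W V -> U}, (forall a v, h (tens a v) = b a v) &
    forall h' : {linear tensor W V -> U},
      (forall a v, h' (tens a v) = b a v) -> h' =1 h.
Proof.
move=> bl br; pose e i := linfun (coord (vbasis {:V}) i : V -> R^o).
pose f (t : tensor W V) := \sum_i b (t (e i)) (vbasis {:V})`_i.
have f_lin : linear f.
  move=> k t t'; rewrite /f scaler_sumr -big_split /=; apply: eq_bigr => i _.
  by rewrite lfunE /= lfunE /= bl.
pose lin := GRing.isLinear.Build R (tensor W V) U _ f f_lin.
pose F : {linear tensor W V -> U} := HB.pack f lin.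
have bZ a k v w : b a (k *: v + w) = k *: b a v + b a w by exact: br.
have b0 a : b a 0 = 0.
  by have := br a (-1) 0 0; rewrite scaler0 addr0 scaleN1r addNr.
have bsum a (v : V) : b a v =
    \sum_i coord (vbasis {:V}) i v *: b a (vbasis {:V})`_i.
  rewrite {1}(coord_vbasis (memvf v)).
  elim/big_rec2 : _ => [|i x y _ <-]; [exact: b0|exact: bZ].
have bZl k a v : b (k *: a) v = k *: b a v.
  have b0l : b 0 v = 0.
    by have := bl v (-1) 0 0; rewrite scaler0 addr0 scaleN1r addNr.
  by have := bl v k a 0; rewrite b0l !addr0.
exists F => [a v|h' hh' t].
  rewrite /F /= /f bsum; apply: eq_bigr => i _.
  by rewrite tensE lfunE /= bZl.
rewrite {1}(tens_decomp t) linear_sum /F /= /f; apply: eq_bigr => i _.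
exact: hh'.
Qed.

End tensor_products.

(* Identity-preserving algebra homomorphisms C^oo(P) -> A. *)
Record weil {R : realType} (A : falgType R) {V : vectType R} {M : Type}
    {E : affine V M} {P : Type} (C : set (chart E P)) := Weil {
  weil_fun :> {linear smoothfun C -> A};
  weil_morph : monoid_morphism weil_fun
}.

Section model_space.
Context {R : realType} {V : vectType R} {M : Type} (E : affine V M).

Fact id_chart_open : aff_open E (id @` setT).
Proof. by move=> a; rewrite image_id preimage_setT; exact: openT. Qed.

Definition id_chart : chart E M :=
  Chart (cdom := setT) (cmap := id) (fun _ _ _ _ e => e) id_chart_open.

Definition model_atlas : set (chart E M) := [set id_chart].

Fact model_coord_smooth (l : {scalar V}) (x : M) :
  (fun y => l (aff_sub E y x)) \in smooth_pred model_atlas.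
Proof.
rewrite inE => c ->; exists (fun y => l (aff_sub E y x)) => //.
by apply: smooth_on_scalar; exact: id_chart_open.
Qed.

Definition model_coord (l : {scalar V}) (x : M) : smoothfun model_atlas :=
  SmoothFun (model_coord_smooth l x).

End model_space.

Arguments model_atlas {R V M} E _.
Arguments model_coord {R V M} E l x.

Section weil_spaces.
Context {R : realType} {A : falgType R} (I : {vspace A})
  (zA : {lrmorphism A -> R^o}).
Context {V : vectType R} {M : Type} {E : affine V M}.

(* weil_base u p states that alpha^T_P(u) = p. *)
Definition weil_base {P : Type} {C : set (chart E P)} (u : weil A C) (p : P) :=
  forall f : smoothfun C, zA (u f) = f p.

Local Notation AM := (weil A (model_atlas E)).
Local Notation IAV := (tensor (subvs_of I) V).

(* The tensor sum_i u(x^i) (x) e_i with x^i(y) = e^i(y - x); for x = alpha^T(u)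
   the elements u(x^i) lie in I, so that vsproj I is then the identity. *)
Definition weil_tensor (e : (\dim {:V}).-tuple V) (u : AM) (x : M) : IAV :=
  \sum_i tens (vsproj I (u (model_coord E (coord e i) x))) e`_i.

(* AE is the affine structure on AM induced from the product affine structure
   on M x (I (x) V) by the bijection theta. *)
Definition weil_affine (AE : affine (V * IAV)%type AM) :=
  exists theta : AM -> M * IAV,
    [/\ bijective theta,
        forall u, weil_base u (theta u).1,
        forall e : (\dim {:V}).-tuple V, basis_of {:V} e ->
          forall u, (theta u).2 = weil_tensor e u (theta u).1 &
        forall u w, theta (aff_add AE u w) =
          (aff_add E (theta u).1 w.1, (theta u).2 + w.2)].

Section prolongation.
Context (AE : affine (V * IAV)%type AM) {P : Type}.
Variable C : set (chart E P).

(* d is the chart Ac : AU -> AM, u |-> (g |-> u (g \o c)), where U is the domain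
   of c and AU is identified with the set of u in AP such that alpha^T(u) is in
   U: u is evaluated at g \o c, which is defined on U only, through any smooth
   function f on P having the same germ at alpha^T(u). *)
Definition prolongs (c : chart E P) (d : chart AE (weil A C)) :=
  cdom d = [set u | exists2 p, cdom c p & weil_base u p] /\
  forall u p (g : smoothfun (model_atlas E)) (f : smoothfun C),
    cdom c p -> weil_base u p ->
    (\forall q \near (p : mspace C), f q = g (cmap c q)) ->
    cmap d u g = u f.

Definition weil_atlas : set (chart AE (weil A C)) :=
  [set d | exists2 c, C c & prolongs c d].

End prolongation.

End weil_spaces.

Arguments weil_atlas {R A I} zA {V M E} AE {P} C _.

(* The cardinality of P is not (Ulam) measurable. This holds for all sets of
   cardinality at most that of the continuum, hence for every manifold with at
   most continuum many connected components. It is exactly what makes every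
   homomorphism C^oo(P) -> R an evaluation: on a discrete P, such homomorphisms
   are the same as countably complete ultrafilters. *)
Definition nonmeasurable (P : Type) :=
  forall F : set_system P, UltraFilter F ->
    (forall S : nat -> set P, (forall n, F (S n)) -> F (\bigcap_n S n)) ->
    exists p, F [set p].

(* Main.v *)
(* Near a point p of the domain of a chart c, Hadamard's lemma makes every
   homomorphism u : C^oo(P) -> A over p a Taylor evaluation: u f is the finite sum of
   the terms a_i1 ... a_ik d_i1 ... d_ik f / k! at p, where the a_i in I are the
   images under u of the coordinates centred at p, and the sum is finite since I
   is nilpotent. Conversely the product rule makes every such evaluation a
   homomorphism. Hence AU is U x I^n, which gives the affine structure of AM, the
   charts of AP, and transition maps that are polynomial in the a_i with
   coefficients smooth in p.
   That u lies over some point of P is Milnor's exercise: the classes of P under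
   chains of relatively compact open sets are sigma-compact, u selects one of
   them since otherwise it would define a nonprincipal countably complete
   ultrafilter on P, and that class carries an exhaustion function.
   Finally AP is paracompact because its projection onto P is locally proper on
   the sets where a norm of the fibre coordinate is bounded. *)

From HB Require Import structures.
Require Import Defs.
From mathcomp Require Import all_boot all_order all_algebra falgebra.
From mathcomp Require Import all_classical all_reals all_analysis.
From mathcomp Require Import ring lra.
Import Order.TTheory GRing.Theory Num.Theory.
Import numFieldNormedType.Exports.

Set Implicit Arguments.
Unset Strict Implicit.
Unset Printing Implicit Defensive.

Local Open Scope classical_set_scope.
Local Open Scope ring_scope.

(** * Calculus of C^k functions on row vectors *)

(** Elements of [weil A C] act only on functions defined on all of P, whereas charts, coordinates
    and Hadamard's lemma are local. The Hausdorff property bridges the gap: compact sets are closed,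
    so a smooth function supported in a compact part of a chart extends by zero, and every germ
    extends to P. Conversely u sees only germs at its base point, because a bump equal to 1 there is
    sent to a unit. The truncation order N satisfies I^N = 0, which removes the Taylor remainder,
    and N > 1, which keeps the linear term from which the a_i are recovered. That a homomorphism to
    R is an evaluation is not clear beforehand, but on any finite list of functions it agrees with
    some evaluation: a sum of squares of elements of its kernel lies in the kernel, hence has a
    zero. The arguments that produce base points choose a suitable finite list. As P may have
    arbitrarily many components, an exhaustion function need not exist on all of P; it is built on a
    single chain class, and the cardinality hypothesis serves to select that class. *)

Section differentiability.
Context {R : realType}.

(** Both difference quotients are the same function of h, so one-variable calculus transfers to
    directional derivatives. *)
Lemma is_derive_line (V W : normedModType R) (f : V -> W) (z v : V) (t : R) df :
  is_derive t 1 (fun s : R => f (s *: v + z)) df <-> is_derive (t *: v + z) v f df.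
Proof.
have E : (fun h : R => h^-1 *: (((fun s : R => f (s *: v + z)) \o shift t) (h *: 1)
      - f (t *: v + z))) = (fun h => h^-1 *: ((f \o shift (t *: v + z)) (h *: v)
      - f (t *: v + z))).
  by apply/funext => h /=; rewrite scalerDl addrA /GRing.scale /= mulr1.
split=> -[/cvg_ex[/= l fl] <-]; split.
- by apply/cvg_ex; exists l; rewrite -E.
- by rewrite /derive E.
- by apply/cvg_ex; exists l; rewrite E.
- by rewrite /derive E.
Qed.

(** The location of t is recorded only as [|t| <= |s|], so that both signs of s are covered by one
    statement. *)
Lemma directional_mvt (V : normedModType R) (f : V -> R) (z v : V) (s : R) :
  (forall t : R, `|t| <= `|s| -> derivable f (t *: v + z) v) ->
  exists2 t : R, `|t| <= `|s| & f (s *: v + z) - f z = s * 'D_v f (t *: v + z).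
Proof.
move=> df; pose g (t : R) := f (t *: v + z).
have dg (t : R) : `|t| <= `|s| -> is_derive t 1 g ('D_v f (t *: v + z)).
  by move=> /df/derivableP/is_derive_line.
have cg (a b : R) : (forall t, t \in `[a, b] -> `|t| <= `|s|) ->
    {within `[a, b], continuous g}.
  by move=> ab; apply: derivable_within_continuous => t /ab/dg/@ex_derive.
have [s0|s0] := leP 0 s.
  have ab (t : R) : t \in `[0, s] -> `|t| <= `|s|.
    by rewrite in_itv /= => /andP[t0 ts]; rewrite !ger0_norm.
  have [||c cs] := @MVT_segment R g (fun t => 'D_v f (t *: v + z)) _ _ s0.
  - by move=> t ts; apply/dg/ab; move: ts; exact: subset_itv_oo_cc.
  - exact: cg.
  rewrite /g scale0r add0r subr0 mulrC => E.
  by exists c => //; exact: ab.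
have ab (t : R) : t \in `[s, 0] -> `|t| <= `|s|.
  by rewrite in_itv /= => /andP[t0 ts]; rewrite !ler0_norm // ?lerN2 // ltW.
have [||c cs] := @MVT_segment R g (fun t => 'D_v f (t *: v + z)) _ _ (ltW s0).
- by move=> t ts; apply/dg/ab; move: ts; exact: subset_itv_oo_cc.
- exact: cg.
rewrite /g scale0r add0r sub0r mulrN mulrC => E.
exists c; first exact: ab.
by rewrite -opprB E opprK.
Qed.

Lemma diff_from_remainder (V W : normedModType R) (f : V -> W)
    (L : {linear V -> W}) (x : V) :
  continuous L ->
  (forall e, 0 < e -> \forall h \near 0, `|f (h + x) - f x - L h| <= e * `|h|) ->
  differentiable f x /\ 'd f x = L :> (V -> W).
Proof.
move=> cL rem.
have E : f \o shift x = cst (f x) + L +o_ 0 id.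
  apply: eqaddoE; apply/eqaddoP => e e0; apply: filterS (rem e e0) => h.
  by rewrite /= opprD addrA.
split; last exact: diff_unique.
apply/diff_locallyP; have dL := diff_unique cL E.
split; first by rewrite dL.
by rewrite dL.
Qed.

Lemma rV_coord_norm n (h : 'rV[R]_n) j : `|h 0 j| <= `|h|.
Proof.
rewrite [leRHS]/Num.Def.normr/= mx_normrE.
by apply: le_trans (le_bigmax _ _ (0, j)).
Qed.

Lemma rV_norm_le n (h : 'rV[R]_n) e : 0 <= e ->
  (forall j, `|h 0 j| <= e) -> `|h| <= e.
Proof.
move=> e0 he; rewrite [leLHS]/Num.Def.normr/= mx_normrE.
by apply: bigmax_le => // -[i j] _ /=; rewrite ord1.
Qed.

(* Telescoping over the coordinates, each step being one application of the
   mean value theorem along a coordinate direction. *)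
Lemma C1_differentiable n (f : 'rV[R]_n -> R) (x : 'rV[R]_n) :
  (forall i, \forall z \near x, derivable f z (delta_mx 0 i)) ->
  (forall i, {for x, continuous ('D_(delta_mx 0 i) f)}) ->
  differentiable f x /\
  forall h, 'd f x h = \sum_i h 0 i * 'D_(delta_mx 0 i) f x.
Proof.
move=> df cf; pose L (h : 'rV[R]_n) := \sum_i h 0 i * 'D_(delta_mx 0 i) f x.
have L_lin : linear L.
  move=> k u v; rewrite /L scaler_sumr -big_split /=; apply: eq_bigr => i _.
  by rewrite !mxE mulrDl /GRing.scale /= mulrA.
pose lin := GRing.isLinear.Build R 'rV[R]_n R _ L L_lin.
pose L' : {linear 'rV[R]_n -> R} := HB.pack L lin.
have cL0 : continuous L.
  move=> y; rewrite (_ : L = \sum_i ((fun h : 'rV[R]_n => h 0 i) * cst ('D_(delta_mx 0 i) f x)));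
    last first.
    by apply/funext => h; rewrite fct_sumE.
  elim/big_ind : _ => [|g g' cg cg'|i _]; first exact: cst_continuous.
    exact: (continuousD cg cg').
  apply: (@continuousM _ _ (fun h : 'rV[R]_n => h 0 i)).
    exact: coord_continuous.
  exact: cst_continuous.
have cL : continuous L' := cL0.
suff rem (e : R) : 0 < e ->
    \forall h \near (0 : 'rV[R]_n), `|f (h + x) - f x - L' h| <= e * `|h|.
  have [d dE] := diff_from_remainder cL rem; split => // h.
  by rewrite dE.
(* The n coordinate steps each contribute at most e' |h|; dividing by n+1 instead of n also covers n
   = 0. *)
move=> e0; pose e' := e / n.+1%:R.
have e'0 : 0 < e' by rewrite divr_gt0.
have near_x : \forall z \near x, forall i, derivable f z (delta_mx 0 i) /\
    `|'D_(delta_mx 0 i) f z - 'D_(delta_mx 0 i) f x| <= e'.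
  apply: (@filter_forall _ _ _ (nbhs x)) => i.
  move/cvgrPdist_le : (cf i) => /(_ _ e'0); apply: filterS2 (df i) => z dz.
  by rewrite distrC.
have [d /= d0 xd] := (nbhs_ballP _ _).1 near_x.
near=> h.
have hd : `|h| < d by near: h; exact: (@nbhs0_lt R 'rV[R]_n d).
(* A path from 0 to h: [p k] keeps the first k coordinates of h. For the sup norm all of its
   segments stay in the ball of radius |h|. *)
pose p (k : nat) : 'rV[R]_n := \row_(i < n) (if (i < k)%N then h 0 i else 0).
have step (k : 'I_n) : `|f (p k.+1 + x) - f (p k + x)
      - h 0 k * 'D_(delta_mx 0 k) f x| <= e' * `|h|.
  have pS : p k.+1 = h 0 k *: delta_mx 0 k + p k.
    apply/rowP => i; rewrite !mxE /= ltnS leq_eqVlt.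
    have [->|ik] := eqVneq i k.
     by rewrite !eqxx ltnn /= mulr1 addr0.
    by rewrite mulr0 add0r -val_eqE /= in ik *; rewrite (negbTE ik).
  have inball (t : R) : `|t| <= `|h 0 k| -> ball x d (t *: delta_mx 0 k + (p k + x)).
    move=> th; rewrite -ball_normE /= !opprD addrC addrA addrNK.
    rewrite distrC opprK; apply: le_lt_trans hd; apply: rV_norm_le => // i.
    rewrite !mxE /=; have [->|ik] := eqVneq i k.
      by rewrite ltnn ?eqxx /= mulr1 add0r; apply: le_trans th _; exact: rV_coord_norm.
    rewrite mulr0 addr0; case: ifP => _; first exact: rV_coord_norm.
    by rewrite normr0.
  have [|t th E] := @directional_mvt _ f (p k + x) (delta_mx 0 k) (h 0 k).
    by move=> t /inball/xd/(_ k)[].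
  rewrite pS -(addrA _ (p k)) E -mulrBr normrM mulrC.
  apply: ler_pM => //; last exact: rV_coord_norm.
  by have [_] := xd _ (inball t th) k.
have p0 : p 0 = 0 by apply/rowP => i; rewrite !mxE.
have pn : p n = h by apply/rowP => i; rewrite !mxE ltn_ord.
have -> : f (h + x) - f x - L' h = \sum_(k < n) (f (p k.+1 + x) - f (p k + x)
      - h 0 k * 'D_(delta_mx 0 k) f x).
  rewrite sumrB; congr (_ - _).
  rewrite -(big_mkord xpredT (fun k => f (p k.+1 + x) - f (p k + x))) /=.
  by rewrite (telescope_sumr (fun k => f (p k + x))) // pn p0 add0r.
apply: le_trans (ler_norm_sum _ _ _) _.
apply: (@le_trans _ _ (\sum_(k < n) e' * `|h|)).
  by apply: ler_sum => k _; exact: step.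
rewrite sumr_const card_ord -mulrnAl; apply: ler_wpM2r => //.
rewrite /e' -mulr_natr -mulrA ler_piMr ?(ltW e0) // mulrC ler_pdivrMr //.
by rewrite mul1r ler_nat.
Unshelve. all: by end_near.
Qed.

End differentiability.

(** * Locality, quotients and composition of C^k functions *)

Section smooth_calculus.
Context {R : realType}.

(** G is only assumed derivable in the direction v. Restricted to the line through x it becomes a
    function of one real variable, for which derivable and differentiable coincide, and the usual
    chain rule applies. *)
Lemma is_derive_comp_rV (V : normedModType R) m (G : V -> 'rV[R]_m)
    (F : 'rV[R]_m -> R) (x v : V) :
  derivable G x v -> differentiable F (G x) ->
  is_derive x v (F \o G) ('d F (G x) ('D_v G x)).
Proof.
move=> dG dF.
have gG : is_derive (0 : R) 1 (fun s : R => G (s *: v + x)) ('D_v G x).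
  apply/is_derive_line; rewrite scale0r add0r; exact/derivableP.
have dg : differentiable (fun s : R => G (s *: v + x)) (0 : R).
  by apply/derivable1_diffP; exact: ex_derive.
have dF0 : differentiable F ((fun s : R => G (s *: v + x)) 0).
  by rewrite scale0r add0r.
suff : is_derive (0 : R) 1 (fun s : R => (F \o G) (s *: v + x))
    ('d F (G x) ('D_v G x)).
  by move/is_derive_line; rewrite scale0r add0r.
split.
  by apply/derivable1_diffP; exact: (differentiable_comp dg dF0).
rewrite deriveE; last exact: (differentiable_comp dg dF0).
rewrite (_ : (fun s : R => _) = F \o (fun s : R => G (s *: v + x))) //.
rewrite diff_comp //= scale0r add0r; congr ('d F _ _).
by rewrite -deriveE // derive_val.
Qed.

Implicit Types (n m k : nat).

Lemma Ck_subset n k (W W' : set 'rV[R]_n) f : W' `<=` W -> Ck k W f -> Ck k W' f.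
Proof.
move=> W'W; elim: k f => [|k IH] f [cf Hf].
  by split=> // x /W'W; exact: cf.
split; first by move=> x /W'W; exact: cf.
case: Hf => df Df; split=> [i x /W'W|i]; [exact: df|exact/IH/Df].
Qed.

(** The derivatives in [Ck] are those of the total function, so [Ck k W f] is a conjunction of
    conditions at the single points of W, and no openness is involved. *)
Lemma Ck_pointwise n k (W : set 'rV[R]_n) f :
  (forall x, W x -> Ck k [set x] f) -> Ck k W f.
Proof.
elim: k f => [|k IH] f Hf.
  by split=> // x Wx; have [cx _] := Hf x Wx; exact: cx.
split; first by move=> x Wx; have [cx _] := Hf x Wx; exact: cx.
split=> [i x Wx|i]; first by have [_ [df _]] := Hf x Wx; exact: df.
by apply: IH => x Wx; have [_ [_ Df]] := Hf x Wx; exact: Df.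
Qed.

Lemma Ck_local n k (W : set 'rV[R]_n) f :
  (forall x, W x -> exists W' g,
    [/\ open W', W' x, Ck k W' g & forall y, W' y -> g y = f y]) -> Ck k W f.
Proof.
move=> H; apply: Ck_pointwise => x /H[W' [g [oW' W'x Hg gf]]].
apply: (@Ck_subset _ _ W'); first by move=> _ ->.
exact: Ck_ext Hg.
Qed.

Lemma Ck_opp n k (W : set 'rV[R]_n) f : open W -> Ck k W f -> Ck k W (- f).
Proof.
move=> oW Hf.
by rewrite -mulN1r; apply: Ck_mul => //; exact: (@Ck_cst _ _ _ _ (-1)).
Qed.

Lemma Ck_sum n k (W : set 'rV[R]_n) (I : Type) (s : seq I) (Q : pred I)
    (F : I -> 'rV[R]_n -> R) : open W ->
  (forall i, Q i -> Ck k W (F i)) -> Ck k W (fun x => \sum_(i <- s | Q i) F i x).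
Proof.
move=> oW HF; rewrite (_ : (fun x => _) = \sum_(i <- s | Q i) F i); last first.
  by apply/funext => x; rewrite fct_sumE.
elim/big_ind : _ => //; first exact: (@Ck_cst _ _ _ _ 0).
by move=> f g; exact: Ck_add.
Qed.

Lemma Ck_inv n k (W : set 'rV[R]_n) f : open W ->
  (forall x, W x -> f x != 0) -> Ck k W f -> Ck k W (fun x => (f x)^-1).
Proof.
move=> oW f0; elim: k => [|k IH] [cf Hf].
  by split=> // x Wx; apply: continuousV; [exact: f0|exact: cf].
case: (Hf) => df Df; split; last split.
- by move=> x Wx; apply: continuousV; [exact: f0|exact: cf].
- by move=> i x Wx; apply: derivableV; [exact: f0|exact: df].
move=> i; have {}IH : Ck k W (fun x => (f x)^-1) by apply: IH; exact: (@Ck_down _ _ k).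
apply: (Ck_ext oW _ (Ck_opp oW (Ck_mul oW (Ck_mul oW IH IH) (Df i)))) => x Wx.
rewrite deriveV //; [|exact: f0|exact: df].
by rewrite /GRing.opp /= /GRing.mul /= /GRing.scale /= -expr2 -exprVn -mulNr.
Qed.

Lemma Ck1_differentiable n (W : set 'rV[R]_n) f x : open W -> W x -> Ck 1 W f ->
  differentiable f x /\
  forall h, 'd f x h = \sum_i h 0 i * 'D_(delta_mx 0 i) f x.
Proof.
move=> oW Wx [cf [df Df]]; apply: C1_differentiable => i.
  by apply: filterS (open_nbhs_nbhs (conj oW Wx)) => z; exact: df.
by have [cD _] := Df i; exact: cD.
Qed.

Lemma Ck1_derivable n (W : set 'rV[R]_n) f x v : open W -> W x -> Ck 1 W f ->
  derivable f x v /\ 'D_v f x = \sum_i v 0 i * 'D_(delta_mx 0 i) f x.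
Proof.
move=> oW Wx Cf; have [df dE] := Ck1_differentiable oW Wx Cf.
by split; [exact: diff_derivable|rewrite deriveE].
Qed.

Lemma Ck_le n j k (W : set 'rV[R]_n) f : (j <= k)%N -> Ck k W f -> Ck j W f.
Proof.
move=> /subnK <-; elim: (_ - _)%N => [//|d IH]; rewrite addSn => /Ck_down.
exact: IH.
Qed.

Lemma rV_continuous n (T : topologicalType) (G : T -> 'rV[R]_n) (x : T) :
  (forall j, {for x, continuous (fun r => G r 0 j)}) -> {for x, continuous G}.
Proof.
move=> cG; apply/cvgrPdist_le => e e0.
have H : \forall r \near x, forall j, `|G x 0 j - G r 0 j| <= e.
  apply: (@filter_forall _ _ _ (nbhs x)) => j.
  by move/cvgrPdist_le : (cG j) => /(_ _ e0).
apply: filterS H => r Hr; apply: rV_norm_le => [|j]; first exact: ltW.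
by rewrite !mxE.
Qed.

(** The induction is over all F: by the chain rule the partials of the composite are sums of
    products of partials of G with partials of F composed with the same G. *)
Lemma Ck_comp n m k (W : set 'rV[R]_n) (W' : set 'rV[R]_m)
    (G : 'rV[R]_n -> 'rV[R]_m) (F : 'rV[R]_m -> R) :
  open W -> open W' -> (forall x, W x -> W' (G x)) ->
  (forall j, Ck k W (fun r => G r 0 j)) -> Ck k W' F -> Ck k W (F \o G).
Proof.
move=> oW oW' WW'.
have cG k' (H : forall j, Ck k' W (fun r => G r 0 j)) x :
    W x -> {for x, continuous G}.
  by move=> Wx; apply: rV_continuous => j; exact: (Ck_cont (H j)).
elim: k F => [|k IH] F HG HF.
  split=> // x Wx; apply: continuous_comp; first exact: (cG 0%N).
  by apply: (Ck_cont HF); exact: WW'.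
have HG' j : Ck k W (fun r => G r 0 j) by exact: Ck_down.
have dG i x : W x -> derivable G x (delta_mx 0 i).
  move=> Wx; apply/derivable_mxP => a j; rewrite ord1.
  by have [_ [d _]] := HG j; exact: d.
have HF1 : Ck 1 W' F by exact: Ck_le HF.
have dFG i x : W x -> is_derive x (delta_mx 0 i) (F \o G)
    (\sum_j 'D_(delta_mx 0 i) (fun r => G r 0 j) x * 'D_(delta_mx 0 j) F (G x)).
  move=> Wx; have [dF dE] := Ck1_differentiable oW' (WW' _ Wx) HF1.
  have := is_derive_comp_rV (dG i x Wx) dF; rewrite dE derive_mx; last exact: dG.
  by under eq_bigr do rewrite mxE.
split; last split.
- move=> x Wx; apply: continuous_comp; first exact: (cG k.+1).
  by apply: (Ck_cont HF); exact: WW'.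
- by move=> i x /(dFG i)/@ex_derive.
move=> i; have [_ [_ DF]] := HF.
have DG j : Ck k W ('D_(delta_mx 0 i) (fun r => G r 0 j)).
  by have [_ [_ D]] := HG j; exact: D.
apply: (Ck_ext oW _ (Ck_sum (index_enum 'I_m) (Q := xpredT) oW
  (fun j _ => Ck_mul oW (DG j) (IH _ HG' (DF j))))) => x Wx.
by rewrite (@derive_val _ _ _ _ _ _ _ (dFG i x Wx)).
Qed.

End smooth_calculus.

(** * Bump functions *)

Section bump.
Context {R : realType}.
Implicit Types (m k : nat) (t : R).

(* This family is closed under differentiation up to linear combinations, see
   is_derive_flat_exp, so that each of its members is smooth. *)
Definition flat_exp m t : R := if 0 < t then t^-1 ^+ m * expR (- t^-1) else 0.

Lemma flat_exp_gt0 m t : (0 < flat_exp m t) = (0 < t).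
Proof.
rewrite /flat_exp; case: ifP => [t0|]; last by rewrite ltxx.
by rewrite mulr_gt0 ?expR_gt0 // exprn_gt0 // invr_gt0.
Qed.

Lemma flat_exp_ge0 m t : 0 <= flat_exp m t.
Proof.
have [t0|t0] := ltP 0 t; first by rewrite ltW // flat_exp_gt0.
by rewrite /flat_exp ltNge t0.
Qed.

Lemma flat_exp_le0 m t : t <= 0 -> flat_exp m t = 0.
Proof. by rewrite /flat_exp ltNge => ->. Qed.

(** Comes from exp(1/t) >= t^-(m+1) / (m+1)!. It makes the difference quotients at 0 tend to 0. *)
Lemma flat_exp_bound m t : 0 < t -> flat_exp m t <= m.+1`!%:R * t.
Proof.
move=> t0; rewrite /flat_exp t0 expRN ler_pdivrMr ?expR_gt0 //.
have it0 : 0 <= t^-1 by rewrite invr_ge0 ltW.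
have := expR_ge1Dxn m it0; set c := _`!%:R => H.
have c0 : 0 < c by rewrite /c ltr0n fact_gt0.
have : t^-1 ^+ m.+1 / c <= expR t^-1 by apply: le_trans H; rewrite lerDr.
rewrite ler_pdivrMr // exprS ler_pdivrMl // => /le_trans; apply.
by rewrite le_eqVlt; apply/orP; left; apply/eqP; ring.
Qed.

Lemma is_derive_flat_exp m t : is_derive t 1 (flat_exp m)
  (- m%:R * flat_exp m.+1 t + flat_exp m.+2 t).
Proof.
have [t0|t0|->] := ltgtP t 0.
- rewrite !flat_exp_le0 ?(ltW t0) // mulr0 addr0.
  apply: (@near_eq_is_derive _ _ _ (cst 0)).
  by near=> s; rewrite flat_exp_le0 //; near: s; exact: lt_le_nbhsl.
- have tn0 : t != 0 by rewrite gt_eqF.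
  rewrite /(flat_exp m.+1) /(flat_exp m.+2) t0.
  have dV : is_derive t 1 (fun s : R => s^-1) (- t^-2).
    have := @is_deriveV R id t 1 1 tn0 (is_derive_id _ _).
    by rewrite /GRing.scale /= mulr1.
  have dX : is_derive t 1 ((fun s : R => s^-1) ^+ m) (- m%:R * t^-1 ^+ m.+1).
    case: m => [|m].
      by rewrite expr0 mulr0n oppr0 mul0r; exact: is_derive_cst.
    have := @is_deriveX _ _ (fun s : R => s^-1) m.+1 t 1 _ dV.
    by congr (is_derive _ _ _ _); rewrite /GRing.scale /= !exprS; field.
  have dE : is_derive t 1 (expR \o (fun s : R => - s^-1)) (expR (- t^-1) * t^-2).
    by apply: is_derive_eq; rewrite opprK.
  have powE (s : R) : ((fun s : R => s^-1) ^+ m) s = s^-1 ^+ m.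
    by elim: (m) => [|j IHj]; rewrite ?expr0 // !exprS -IHj.
  have dP : is_derive t 1 ((fun s : R => s^-1) ^+ m * (expR \o (fun s : R => - s^-1)))
      (- m%:R * (t^-1 ^+ m.+1 * expR (- t^-1)) + t^-1 ^+ m.+2 * expR (- t^-1)).
    have := is_deriveM dX dE; congr (is_derive _ _ _ _).
    rewrite /= /GRing.scale /=.
    by rewrite powE !exprS; field.
  apply: near_eq_is_derive dP; near=> s; rewrite /flat_exp ifT; last first.
    by near: s; exact: lt_nbhsr.
  by rewrite -powE.
- rewrite !flat_exp_le0 // mulr0 addr0.
  have E : (fun h : R => h^-1 *: ((flat_exp m \o shift 0) (h *: 1) - flat_exp m 0))
      @ 0^' --> (0 : R).
    apply/cvgrPdist_le => e e0; near=> h.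
    rewrite sub0r normrN (flat_exp_le0 _ (lexx _)) subr0 /= addr0.
    rewrite [h *: 1]mulr1 /GRing.scale /=.
    have [h0|h0] := leP h 0; first by rewrite flat_exp_le0 // mulr0 normr0 ltW.
    (* The difference quotient at 0 is the next member of the family, which the linear bound sends
       to 0. *)
    have -> : h^-1 * flat_exp m h = flat_exp m.+1 h.
      by rewrite /flat_exp h0 mulrA -exprS.
    rewrite ger0_norm ?flat_exp_ge0 //; apply: le_trans (flat_exp_bound _ h0) _.
    rewrite mulrC -ler_pdivlMr ?ltr0n ?fact_gt0 //.
    apply: le_trans (ler_norm _) _; near: h.
    apply: dnbhs0_le; by rewrite divr_gt0 // ltr0n fact_gt0.
  split; [by apply/cvg_ex; exists 0|exact: cvg_lim E].
Unshelve. all: by end_near.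
Qed.

Lemma is_derive_compR (V : normedModType R) (g : R -> R) (s : V -> R)
    (x v : V) (a b : R) :
  is_derive (s x) 1 g a -> is_derive x v s b -> is_derive x v (g \o s) (a * b).
Proof.
move=> dg ds.
have ds0 : is_derive (0 : R) 1 (fun t : R => s (t *: v + x)) b.
  by apply/is_derive_line; rewrite scale0r add0r.
suff : is_derive (0 : R) 1 (fun t : R => (g \o s) (t *: v + x)) (a * b).
  by move/is_derive_line; rewrite scale0r add0r.
have dg0 : is_derive ((fun t : R => s (t *: v + x)) 0) 1 g a.
  by rewrite scale0r add0r.
exact: is_derive1_comp.
Qed.

Lemma flat_exp_continuous m : continuous (flat_exp m).
Proof.
move=> t; apply: differentiable_continuous; apply/derivable1_diffP.
exact: (@ex_derive _ _ _ _ _ _ _ (is_derive_flat_exp m t)).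
Qed.

Lemma Ck_flat_exp n m k (W : set 'rV[R]_n) s : open W ->
  Ck k W s -> Ck k W (flat_exp m \o s).
Proof.
move=> oW; elim: k m => [|k IH] m Hs.
  split=> // x Wx; apply: continuous_comp; first exact: (Ck_cont Hs).
  exact: flat_exp_continuous.
have Hs' := Ck_down Hs; have [cs [ds Ds]] := Hs.
have dfs i x : W x -> is_derive x (delta_mx 0 i) (flat_exp m \o s)
    ((- m%:R * flat_exp m.+1 (s x) + flat_exp m.+2 (s x)) * 'D_(delta_mx 0 i) s x).
  move=> Wx; apply: is_derive_compR; last exact/derivableP/ds.
  exact: is_derive_flat_exp.
split; last split.
- move=> x Wx; apply: continuous_comp; first exact: cs.
  exact: flat_exp_continuous.
- by move=> i x /(dfs i)/@ex_derive.
move=> i; apply: (Ck_ext oW _ (Ck_mul oW (Ck_add oW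
  (Ck_mul oW (Ck_cst k (- m%:R) oW) (IH m.+1 Hs')) (IH m.+2 Hs')) (Ds i))) => x Wx.
by rewrite (@derive_val _ _ _ _ _ _ _ (dfs i x Wx)).
Qed.

Lemma rV_bump n (x0 : 'rV[R]_n) (e : R) : 0 < e -> exists b : 'rV[R]_n -> R,
  [/\ Cinfty setT b, forall r, 0 <= b r <= 1, \forall r \near x0, b r = 1 &
      forall r, e <= `|r - x0| -> b r = 0].
Proof.
move=> e0; pose s (r : 'rV[R]_n) := \sum_i (r 0 i - x0 0 i) * (r 0 i - x0 0 i).
have s_ge (r : 'rV[R]_n) i : (r 0 i - x0 0 i) ^+ 2 <= s r.
  rewrite /s (bigD1 i) //= -expr2 lerDl; apply: sumr_ge0 => j _.
  by rewrite -expr2 sqr_ge0.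
have Cs : Cinfty setT s.
  move=> k; apply: Ck_sum; [exact: openT|move=> i _].
  have Ci : Ck k setT (fun r : 'rV[R]_n => r 0 i - x0 0 i).
    apply: (Ck_add openT (Cinfty_coord i openT k) (Ck_cst k (- x0 0 i) openT)).
  exact: (Ck_mul openT Ci Ci).
(* s is the squared Euclidean distance, the norm is the sup norm: |r - x0| >= e gives s >= e^2 > d,
   where a vanishes. Near x0 one has s < d/2, where c vanishes and a / (a + c) is 1. *)
pose d := e ^+ 2 / 2; have d0 : 0 < d by rewrite divr_gt0 // exprn_gt0.
pose a (r : 'rV[R]_n) := flat_exp 0 (d - s r); pose c (r : 'rV[R]_n) := flat_exp 0 (s r - d / 2).
have Ca : Cinfty setT a.
  move=> k; apply: (Ck_flat_exp 0 openT).
  exact: (Ck_add openT (Ck_cst k d openT) (Ck_opp openT (Cs k))).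
have Cc : Cinfty setT c.
  move=> k; apply: (Ck_flat_exp 0 openT).
  exact: (Ck_add openT (Cs k) (Ck_cst k (- (d / 2)) openT)).
(* a is positive where s < d and c where s > d/2; these two regions cover everything. *)
have ac (r : 'rV[R]_n) : 0 < a r + c r.
  have [sd|ds] := ltP (s r) d.
    by rewrite ltr_pwDl ?flat_exp_ge0 // flat_exp_gt0 subr_gt0.
  rewrite ltr_wpDl ?flat_exp_ge0 // flat_exp_gt0 subr_gt0 (lt_le_trans _ ds) //.
  by rewrite ltr_pdivrMr // ltr_pMr // ltr1n.
exists (fun r => a r * (a r + c r)^-1); split.
- move=> k; apply: (Ck_mul openT (Ca k)); apply: Ck_inv; first exact: openT.
    by move=> r _; rewrite gt_eqF.
  exact: (Ck_add openT (Ca k) (Cc k)).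
- move=> r; rewrite mulr_ge0 ?flat_exp_ge0 ?invr_ge0 ?(ltW (ac r)) //=.
  by rewrite ler_pdivrMr // mul1r lerDl flat_exp_ge0.
- have s0 : s x0 = 0 by rewrite /s big1 // => i _; rewrite subrr mul0r.
  have cs : {for x0, continuous s} by apply: (Ck_cont (Cs 0%N)).
  have : \forall r \near x0, s r < d / 2.
    by apply: (@cvgr_lt _ _ (nbhs x0) _ s _ cs); rewrite s0 divr_gt0.
  apply: filterS => r sr; rewrite /c (@flat_exp_le0 _ (_ - _)) ?subr_le0 ?ltW //.
  rewrite addr0 divff // gt_eqF // flat_exp_gt0 subr_gt0 (lt_trans sr) //.
  by rewrite ltr_pdivrMr // ltr_pMr // ltr1n.
- move=> r er; suff ds : d <= s r by rewrite /a flat_exp_le0 ?mul0r // subr_le0.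
  rewrite leNgt; apply/negP => sd; have : `|r - x0| <= Num.sqrt d.
    apply: rV_norm_le => [|j]; first exact: sqrtr_ge0.
    rewrite !mxE -sqrtr_sqr ler_wsqrtr //; apply: le_trans (ltW sd); exact: s_ge.
  move=> /(le_trans er); rewrite -ler_sqr ?nnegrE ?sqrtr_ge0 ?(ltW e0) //.
  rewrite sqr_sqrtr ?(ltW d0) // ler_pdivlMr // => H.
  have := exprn_gt0 2 e0; nra.
Qed.

End bump.

(** * Hadamard's lemma *)

Section hadamard.
Context {R : realType}.
Implicit Types (f g : R -> R) (e : R).

Definition int01 f : R := \int[lebesgue_measure]_(t in `[0, 1]%classic) f t.

Let int01_integrable f : continuous f ->
  lebesgue_measure.-integrable `[0, 1]%classic (EFin \o f).
Proof.
move=> cf; apply: continuous_compact_integrable; first exact: segment_compact.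
exact: continuous_subspaceT.
Qed.

Let contB f g : continuous f -> continuous g -> continuous (fun t => f t - g t).
Proof. by move=> cf cg t; exact: (continuousB (cf t) (cg t)). Qed.

Let contZ (k : R) f : continuous f -> continuous (fun t => k * f t).
Proof. by move=> cf t; exact: (continuousM (@cst_continuous _ _ k _) (cf t)). Qed.

Lemma int01B f g : continuous f -> continuous g ->
  int01 (fun t => f t - g t) = int01 f - int01 g.
Proof. by move=> cf cg; rewrite /int01 RintegralB //; exact: int01_integrable. Qed.

Lemma int01D f g : continuous f -> continuous g ->
  int01 (fun t => f t + g t) = int01 f + int01 g.
Proof. by move=> cf cg; rewrite /int01 RintegralD //; exact: int01_integrable. Qed.

Lemma int01Z (k : R) f : continuous f -> int01 (fun t => k * f t) = k * int01 f.
Proof. by move=> cf; rewrite /int01 RintegralZl //; exact: int01_integrable. Qed.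

Lemma int01_sum (I : Type) (s : seq I) (F : I -> R -> R) :
  (forall i, continuous (F i)) ->
  int01 (fun t => \sum_(i <- s) F i t) = \sum_(i <- s) int01 (F i).
Proof.
move=> cF; elim: s => [|i s IH].
  under [in LHS]eq_fun do rewrite big_nil.
  by rewrite big_nil /int01 Rintegral_cst // mul0r.
under [in LHS]eq_fun do rewrite big_cons.
rewrite int01D // ?big_cons ?IH //.
move=> t; rewrite (_ : (fun t => _) = \sum_(i <- s) F i); last first.
  by apply/funext => u; rewrite fct_sumE.
elim: (s) => [|j s' IHs]; first by rewrite big_nil; exact: cst_continuous.
by rewrite big_cons; apply: (continuousD (cF j t) IHs).
Qed.

Lemma int01_norm_le f e : continuous f ->
  (forall t : R, 0 <= t <= 1 -> `|f t| <= e) -> `|int01 f| <= e.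
Proof.
move=> cf fe.
have cnf : continuous (fun t => `|f t|).
  by move=> t; apply: cvg_norm; exact: cf.
apply: (le_trans (le_normr_Rintegral _ (int01_integrable cf))) => //.
apply: (@le_trans _ _ (\int[lebesgue_measure]_(t in `[0, 1]%classic) e)).
  apply: le_Rintegral => //; first exact: int01_integrable.
  by apply: int01_integrable; exact: cst_continuous.
rewrite Rintegral_cst //= lebesgue_measure_itv /= lte_fin ltr01 oppr0 adde0 /=.
by rewrite mulr1.
Qed.

Lemma int01_derive f g : continuous g -> (forall t : R, is_derive t 1 f (g t)) ->
  int01 g = f 1 - f 0.
Proof.
move=> cg dfg.
have cf : continuous f.
  move=> t; apply: differentiable_continuous; apply/derivable1_diffP.
  exact: (@ex_derive _ _ _ _ _ _ _ (dfg t)).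
rewrite /int01 /Rintegral (continuous_FTC2 (F := f)) //.
- exact: continuous_subspaceT.
- split=> //.
  + by apply: cvg_at_right_filter; exact: cf.
  + by apply: cvg_at_left_filter; exact: cf.
- by move=> t _; rewrite derive1E derive_val.
Qed.

Variable n : nat.
Implicit Types (F : 'rV[R]_n -> R) (r : 'rV[R]_n).

Lemma scale_ray_continuous F r m : continuous F ->
  continuous (fun t : R => t ^+ m * F (t *: r)).
Proof.
move=> cF t; apply: (@continuousM _ _ (fun t : R => t ^+ m)).
  exact: exprn_continuous.
apply: (@continuous_comp _ _ _ (fun t : R => t *: r) F); last exact: cF.
exact: scalel_continuous.
Qed.

(** Tube lemma along the compact segment of parameters [0, 1]. *)
Lemma ray_uniform F r e : continuous F -> 0 < e ->
  \forall r' \near r, forall t : R, 0 <= t <= 1 -> `|F (t *: r') - F (t *: r)| < e.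
Proof.
move=> cF e0.
have /compact_near_coveringP K := @segment_compact R 0 1.
suff H (t : R) : `[0, 1]%classic t -> \forall t' \near t & r' \near nbhs r,
    `|F (t' *: r') - F (t' *: r)| < e.
  apply: filterS (K _ (nbhs r) (fun r' (t : R) => `|F (t *: r') - F (t *: r)| < e) _ H).
  by move=> r' Hr' t t01; apply: Hr'; rewrite /= in_itv.
move=> _.
have c1 : {for (t, r), continuous (fun z : R * 'rV[R]_n => F (z.1 *: z.2) - F (z.1 *: r))}.
  apply: (@continuousB _ _ _ (fun z : R * 'rV[R]_n => F (z.1 *: z.2))
      (fun z : R * 'rV[R]_n => F (z.1 *: r))).
    apply: (@continuous_comp _ _ _ (fun z : R * 'rV[R]_n => z.1 *: z.2) F); last exact: cF.
      exact: scale_continuous.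
    apply: (@continuous_comp _ _ _ (fun z : R * 'rV[R]_n => z.1 *: r) F); last exact: cF.
    apply: (@continuous_comp _ _ _ (@fst R 'rV[R]_n) (fun t : R => t *: r)).
      exact: cvg_fst.
    exact: scalel_continuous.
move/cvgrPdist_lt : c1 => /(_ e e0); apply: filterS => -[t' r'] /=.
by rewrite subrr sub0r normrN.
Qed.

(** The weight t^m makes the family closed under differentiation: each derivative in r brings out
    one more factor t. *)
Definition ray_mean m F r := int01 (fun t => t ^+ m * F (t *: r)).

Lemma ray_mean_continuous m F : continuous F -> continuous (ray_mean m F).
Proof.
move=> cF r; apply/(@cvgrPdist_le _ _ _ (nbhs r)) => e e0.
move: (ray_uniform r cF e0); apply: filterS => r' Hr'.
rewrite -int01B; [|exact: scale_ray_continuous..].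
apply: int01_norm_le.
  by apply: contB; exact: scale_ray_continuous.
move=> t t01; rewrite -mulrBr normrM distrC.
have /andP[t0 t1] := t01; apply: le_trans (ltW (Hr' t t01)).
by rewrite ler_piMl // normrX exprn_ile1 // ger0_norm.
Qed.

(** Differentiation under the integral: for each t the mean value theorem turns the quotient into a
    value of ['D_v F] near t r, and [ray_uniform] makes the error uniform in t. *)
Lemma is_derive_ray_mean m F r v : continuous F ->
  (forall x, derivable F x v) -> continuous ('D_v F) ->
  is_derive r v (ray_mean m F) (ray_mean m.+1 ('D_v F) r).
Proof.
move=> cF dF cdF.
suff E : (fun h : R => h^-1 *: ((ray_mean m F \o shift r) (h *: v) - ray_mean m F r))
    @ 0^' --> ray_mean m.+1 ('D_v F) r.
  by split; [apply/cvg_ex; exists (ray_mean m.+1 ('D_v F) r)|exact: cvg_lim E].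
apply/cvgrPdist_le => e e0.
have U := ray_uniform r cdF e0.
have cl : {for (0 : R), continuous (fun h : R => h *: v + r)}.
  apply: (@continuousD _ _ _ (fun h : R => h *: v) (cst r)).
    exact: scalel_continuous.
  exact: cst_continuous.
have {}U : \forall h \near (0 : R), forall t : R, 0 <= t <= 1 ->
    `|'D_v F (t *: (h *: v + r)) - 'D_v F (t *: r)| < e.
  move: cl; rewrite /prop_for /continuous_at scale0r add0r => /(_ _ U).
  exact.
have [d /= d0 dU] := (nbhs_ballP _ _).1 U.
near=> h.
have h0 : h != 0 by near: h; exact: nbhs_dnbhs_neq.
have hd : `|h| < d by near: h; exact: dnbhs0_lt.
rewrite /= /ray_mean -int01B; [|exact: scale_ray_continuous..].
pose q (t : R) := h^-1 * (t ^+ m * F (t *: (h *: v + r)) - t ^+ m * F (t *: r)).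
have cq0 : continuous (fun t : R => t ^+ m * F (t *: (h *: v + r)) - t ^+ m * F (t *: r)).
  by apply: contB; exact: scale_ray_continuous.
have cq : continuous q by exact: contZ.
have cD : continuous (fun t : R => t ^+ m.+1 * 'D_v F (t *: r)).
  exact: (@scale_ray_continuous _ r m.+1 cdF).
rewrite [_ *: _](_ : _ = int01 q); last by rewrite /q int01Z.
rewrite -int01B //; apply: int01_norm_le; first exact: contB.
rewrite /q {cq0 cq cD q}.
move=> t /andP[t0 t1].
(* At t = 0 both integrands vanish; elsewhere t may be divided out. *)
have [->|tn0] := eqVneq t 0.
  by rewrite !scale0r subrr mulr0 exprS !mul0r subrr normr0 ltW.
have [s sth] := @directional_mvt _ _ F (t *: r) v (t * h) (fun _ _ => dF _).
rewrite -scalerA -scalerDr -mulrBr => ->.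
(* The intermediate point is put on the ray of (s/t) v + r. Since |s| <= |t h|, this vector is at
   least as close to r as the uniformity estimate requires. *)
rewrite (_ : s *: v + t *: r = t *: ((s / t) *: v + r)); last first.
  by rewrite scalerDr scalerA mulrCA divff // mulr1.
set D := 'D_v F _; set D' := 'D_v F _.
rewrite (_ : _ - _ = t ^+ m.+1 * (D - D')); last first.
  by rewrite exprS; field.
rewrite normrM distrC; apply: (@le_trans _ _ `|D' - D|).
  by rewrite ler_piMl // normrX exprn_ile1 // ger0_norm.
apply/ltW/dU; last by rewrite t0.
rewrite /ball /= sub0r normrN normrM normfV ltr_pdivrMr ?normr_gt0 //.
apply: (le_lt_trans sth); rewrite normrM mulrC ltr_pM2r ?normr_gt0 //.
Unshelve. all: by end_near.
Qed.

Lemma Cinfty_derive F i : Cinfty setT F -> Cinfty setT ('D_(delta_mx 0 i) F).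
Proof. by move=> CF k; have [_ [_ D]] := CF k.+1; exact: D. Qed.

Lemma Cinfty_continuous F : Cinfty setT F -> continuous F.
Proof. by move=> CF x; exact: (Ck_cont (CF 0%N)). Qed.

Lemma Cinfty_ray_mean m F : Cinfty setT F -> Cinfty setT (ray_mean m F).
Proof.
move=> CF k; elim: k m F CF => [|k IH] m F CF.
  by split=> // x _; apply: ray_mean_continuous; exact: Cinfty_continuous.
have cF := Cinfty_continuous CF.
have dJ i x : is_derive x (delta_mx 0 i) (ray_mean m F)
    (ray_mean m.+1 ('D_(delta_mx 0 i) F) x).
  apply: is_derive_ray_mean => //; last exact/Cinfty_continuous/Cinfty_derive.
  by move=> y; have [_ [d _]] := CF 1%N; exact: d.
split; first by move=> x _; exact: ray_mean_continuous.
split=> [i x _|i]; first exact: (@ex_derive _ _ _ _ _ _ _ (dJ i x)).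
apply: (Ck_ext openT _ (IH m.+1 _ (Cinfty_derive i CF))) => x _.
by rewrite (@derive_val _ _ _ _ _ _ _ (dJ i x)).
Qed.

(** F r - F 0 is the integral over [0, 1] of the derivative of t |-> F (t r), and G_i is the mean of
    the i-th partial along the ray. *)
Lemma hadamard0 F : Cinfty setT F -> exists2 G : 'I_n -> 'rV[R]_n -> R,
  (forall i, Cinfty setT (G i)) &
  forall r, F r = F 0 + \sum_i r 0 i * G i r.
Proof.
move=> CF; exists (fun i => ray_mean 0 ('D_(delta_mx 0 i) F)).
  by move=> i; exact/Cinfty_ray_mean/Cinfty_derive.
move=> r.
have cD i : continuous ('D_(delta_mx 0 i) F) by exact/Cinfty_continuous/Cinfty_derive.
have d (t : R) : is_derive t 1 (fun t : R => F (t *: r))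
    (\sum_i r 0 i * (t ^+ 0 * 'D_(delta_mx 0 i) F (t *: r))).
  under eq_bigr do rewrite expr0 mul1r.
  have [dF <-] := Ck1_derivable (x := t *: r) r openT I (CF 1%N).
  have -> : (fun t : R => F (t *: r)) = (fun t : R => F (t *: r + 0)).
    by apply/funext => s; rewrite addr0.
  by apply/is_derive_line; rewrite addr0; exact: derivableP.
have cs i : continuous (fun t : R => r 0 i * (t ^+ 0 * 'D_(delta_mx 0 i) F (t *: r))).
  by apply: contZ; exact: (@scale_ray_continuous _ r 0 (cD i)).
have -> : \sum_i r 0 i * ray_mean 0 ('D_(delta_mx 0 i) F) r =
    int01 (fun t => \sum_i r 0 i * (t ^+ 0 * 'D_(delta_mx 0 i) F (t *: r))).
  rewrite int01_sum //; apply: eq_bigr => i _.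
  by rewrite int01Z //; exact: (@scale_ray_continuous _ r 0 (cD i)).
rewrite (int01_derive _ d) ?scale1r ?scale0r ?subrKC //.
move=> t; rewrite (_ : (fun t => _) =
    \sum_i (fun t : R => r 0 i * (t ^+ 0 * 'D_(delta_mx 0 i) F (t *: r)))); last first.
  by apply/funext => u; rewrite fct_sumE.
elim/big_ind : _ => [|f g cf cg|i _]; first exact: cst_continuous.
  exact: (continuousD cf cg).
exact: cs.
Qed.

Lemma hadamard F (r0 : 'rV[R]_n) : Cinfty setT F ->
  exists2 G : 'I_n -> 'rV[R]_n -> R, (forall i, Cinfty setT (G i)) &
  forall r, F r = F r0 + \sum_i (r 0 i - r0 0 i) * G i r.
Proof.
have Csh (H : 'rV[R]_n -> R) (a : 'rV[R]_n) :
    Cinfty setT H -> Cinfty setT (fun r => H (r + a)).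
  move=> CH k; apply: (Ck_comp openT openT _ _ (CH k)) => // j.
  rewrite (_ : (fun r => _) = (fun r : 'rV[R]_n => r 0 j) + cst (a 0 j)); last first.
    by apply/funext => r; rewrite mxE.
  exact: (Ck_add openT (Cinfty_coord j openT k) (Ck_cst k _ openT)).
move=> CF; have [G CG EG] := hadamard0 (Csh F r0 CF).
exists (fun i r => G i (r - r0)); first by move=> i; exact: Csh.
move=> r; have := EG (r - r0); rewrite subrK add0r => ->.
by congr (_ + _); apply: eq_bigr => i _; rewrite !mxE.
Qed.

End hadamard.

(** * Local algebras *)

Section local_algebra_theory.
Context {R : realType} {A : falgType R} {I : {vspace A}} {zA : {lrmorphism A -> R^o}}.
Hypothesis hA : local_algebra I zA.

Lemma local_mulrC : commutative ( *%R : A -> A -> A).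
Proof. by case: hA. Qed.

Lemma local_zA_eq0 a : (a \in I) = (zA a == 0).
Proof. by case: hA. Qed.

Lemma idealP (J : {vspace A}) : is_ideal J <-> (fullv * J <= J)%VS.
Proof.
split=> [iJ|/prodvP fJ a x xJ].
  by apply/prodvP => a x _ xJ; have /andP[] := iJ a x xJ.
by rewrite (local_mulrC x) fJ ?memvf.
Qed.

Lemma ideal_mul (J : {vspace A}) a x : is_ideal J -> x \in J -> a * x \in J.
Proof. by move=> iJ /(iJ a)/andP[]. Qed.

(** Induction on the codimension takes the place of Zorn's lemma: J is maximal, hence equal to I, or
    lies in a strictly larger proper ideal. *)
Lemma proper_ideal_sub (J : {vspace A}) : is_ideal J -> J <> fullv -> (J <= I)%VS.
Proof.
have [_ _ Iu _] := hA.
have [m] := ubnP (\dim {:A} - \dim J); elim: m J => // m IH J mJ iJ nJ.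
have [[K [iK JK nK KJ]]|noK] := pselect (exists K : {vspace A},
    [/\ is_ideal K, (J <= K)%VS, K <> fullv & K <> J]).
  apply: (subv_trans JK); apply: IH => //.
  rewrite -ltnS; apply: leq_trans mJ; rewrite ltnS; apply: ltn_sub2l.
    by rewrite ltn_neqAle dimvS ?subvf // andbT (dimv_leqif_eq (subvf J)); apply/eqP.
  rewrite ltn_neqAle dimvS // andbT (dimv_leqif_eq JK); apply/eqP => E.
  exact/KJ/esym.
rewrite (Iu J) //; split=> // K iK JK nK.
by apply: contrapT => KJ; apply: noK; exists K.
Qed.

(** Otherwise the ideal A a would be proper, hence contained in I, although it contains a. *)
Lemma local_unit a : zA a != 0 -> exists b, b * a = 1.
Proof.
move=> a0; pose J := limg (amulr a).
have [JE|nJ] := pselect (J = fullv).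
  have : 1 \in J by rewrite JE memvf.
  by case/memv_imgP => b _ ->; exists b; rewrite lfunE.
suff : a \in I by rewrite local_zA_eq0 (negbTE a0).
have iJ : is_ideal J.
  move=> x y /memv_imgP[z _ ->]; rewrite lfunE /= (local_mulrC _ x) andbb.
  by apply/memv_imgP; exists (x * z); rewrite ?memvf // lfunE /= mulrA.
apply: (subvP (proper_ideal_sub iJ nJ)); apply/memv_imgP.
by exists 1; rewrite ?memvf // lfunE /= mul1r.
Qed.

Lemma nakayama (J : {vspace A}) : is_ideal J -> (I * J)%VS = J -> J = 0%VS.
Proof.
move=> iJ IJ; apply: contrapT => nJ.
pose Q (d : nat) := `[< exists K : {vspace A},
  [/\ is_ideal K, (K <= J)%VS, K <> J & \dim K = d] >].
have exQ : exists d, Q d.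
  exists 0%N; apply/asboolP; exists 0%VS; split; rewrite ?sub0v ?dimv0 //.
    by apply/idealP; rewrite prodv0.
  by move=> E; apply: nJ.
have Qb d : Q d -> (d <= \dim {:A})%N.
  by move=> /asboolP[K [_ _ _ <-]]; exact/dimvS/subvf.
have [d /asboolP[K [iK KJ nK dK]] dmax] := ex_maxnP exQ Qb.
have /subvPn[x xJ xK] : ~~ (J <= K)%VS.
  by apply/negP => JK; apply: nK; apply/eqP; rewrite eqEsubv KJ.
(* K has the largest dimension among the ideals strictly inside J, so adjoining x from J outside K
   must give all of J. *)
pose K' := (K + fullv * <[x]>)%VS.
have KxJ : (fullv * <[x]> <= J)%VS.
  by apply: subv_trans ((idealP J).1 iJ); apply: prodvSr; rewrite -memvE.
have iK' : is_ideal K'.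
  apply/idealP; rewrite prodvDr; apply: addvS; first exact/idealP.
  by rewrite prodvA; apply: prodvSl; exact: subvf.
have xK' : x \in K'.
  apply: (subvP (addvSr _ _)); rewrite -{1}[x]mul1r; apply: memv_mul; last exact: memv_line.
  exact: memvf.
have K'J : K' = J.
  apply: contrapT => nK'.
  have : (\dim K' <= d)%N.
    apply: dmax; apply/asboolP; exists K'; split=> //.
    by rewrite subv_add KJ.
  rewrite -dK leqNgt => /negP; apply.
  rewrite ltn_neqAle dimvS ?addvSl // andbT (dimv_leqif_eq (addvSl _ _)).
  by apply: contra xK => /eqP ->.
(* J = I J = I (K + A x) lies in K + I x. Thus x = k + i x with i in I, and as 1 - i is a unit, x
   falls into K. *)
have : x \in (K + I * <[x]>)%VS.
  move: xJ; rewrite -{1}IJ -[X in (_ * X)%VS]K'J prodvDr prodvA.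
  apply/subvP/addvS; first exact: subv_trans (prodvSl _ (subvf _)) ((idealP K).1 iK).
  apply: prodvSl; apply/prodvP => i a iI _; rewrite local_mulrC.
  by rewrite local_zA_eq0 rmorphM mulf_eq0 -(local_zA_eq0 i) iI orbT.
case/memv_addP => k kK [z]; rewrite -limg_amulr => /memv_imgP[i iI ->] xE.
have [b bE] : exists b, b * (1 - i) = 1.
  have zi : zA i = 0 by apply/eqP; rewrite -local_zA_eq0.
  by apply: local_unit; rewrite rmorphB /= zi subr0 rmorph1 oner_eq0.
move/negP : xK; apply.
have -> : x = b * k; last exact: ideal_mul.
rewrite -[LHS]mul1r -bE -mulrA; congr (b * _).
by rewrite mulrBl mul1r {1}xE lfunE /= addrK.
Qed.

(** By Nakayama the powers of I drop in dimension until they vanish. The exponents start at 1, since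
    [I ^+ 0] is the line of 1 and in general no ideal. *)
Lemma local_nilpotent : exists N, (I ^+ N)%VS = 0%VS.
Proof.
have iI k : is_ideal (I ^+ k.+1)%VS.
  apply/idealP; elim: k => [|k IH].
    rewrite expv1; apply/prodvP => a x _.
    by rewrite !local_zA_eq0 rmorphM mulf_eq0 => ->; rewrite orbT.
  by rewrite expvSr prodvA; exact: prodvSl.
apply: contrapT => nN.
have dk k : (\dim (I ^+ k.+1)%VS + k <= \dim {:A})%N.
  elim: k => [|k IH]; first by rewrite addn0; exact/dimvS/subvf.
  apply: leq_trans IH; rewrite addnS -addSn leq_add2r.
  have sub : (I ^+ k.+2 <= I ^+ k.+1)%VS.
    rewrite expvSl; apply: subv_trans (prodvSl _ (subvf _)) _; exact/idealP.
  rewrite ltn_neqAle dimvS // andbT (dimv_leqif_eq sub); apply/eqP => E.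
  by apply: nN; exists k.+1; apply: nakayama => //; rewrite -expvSl.
by have := dk (\dim {:A}).+1; rewrite addnS ltnNge leq_addl.
Qed.

End local_algebra_theory.

(** * Taylor evaluations *)

Section taylor.
Context {R : realType} {A : falgType R} {n : nat}.
Variable a : 'I_n -> A.
Implicit Types (F G : 'rV[R]_n -> R) (W : set 'rV[R]_n) (k : nat) (r : 'rV[R]_n).

(* The k-th term of the Taylor expansion of F at r in the direction a. *)
Fixpoint tayS k F (r : 'rV[R]_n) : A :=
  if k is k'.+1 then k%:R^-1 *: \sum_i a i * tayS k' ('D_(delta_mx 0 i) F) r
  else (F r)%:A.

Definition tay N F (r : 'rV[R]_n) : A := \sum_(k < N) tayS k F r.

Lemma tayS_eq k W F G r : open W -> W r -> (forall x, W x -> F x = G x) ->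
  tayS k F r = tayS k G r.
Proof.
move=> oW Wr; elim: k F G => [|k IH] F G FG; first by rewrite /= FG.
congr (_ *: _); apply: eq_bigr => i _; congr (_ * _); apply: IH => x Wx.
apply: near_eq_derive; apply: filterS (open_nbhs_nbhs (conj oW Wx)) => y.
exact: FG.
Qed.

Lemma tayS_add k W F G r : open W -> W r -> Ck k W F -> Ck k W G ->
  tayS k (F + G) r = tayS k F r + tayS k G r.
Proof.
move=> oW Wr; elim: k F G => [|k IH] F G; first by rewrite /= scalerDl.
move=> [_ [dF DF]] [_ [dG DG]]; rewrite /= -scalerDr -big_split /=.
congr (_ *: _); apply: eq_bigr => i _; rewrite -mulrDr; congr (_ * _).
rewrite -(IH _ _ (DF i) (DG i)); apply: (tayS_eq k oW Wr) => x Wx.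
by rewrite deriveD //; [exact: dF|exact: dG].
Qed.

Lemma tayS_scale k W F c r : open W -> W r -> Ck k W F ->
  tayS k (c *: F) r = c *: tayS k F r.
Proof.
move=> oW Wr; elim: k F => [|k IH] F; first by rewrite /= scalerA.
move=> [_ [dF DF]]; rewrite /= [RHS]scalerA [c * _]mulrC -[RHS]scalerA.
congr (_ *: _); rewrite scaler_sumr; apply: eq_bigr => i _; rewrite scalerAr; congr (_ * _).
rewrite -(IH _ (DF i)); apply: (tayS_eq k oW Wr) => x Wx.
by rewrite deriveZ //; exact: dF.
Qed.

Lemma tayS_succ k F r : tayS k.+1 F r =
  k.+1%:R^-1 *: \sum_i a i * tayS k ('D_(delta_mx 0 i) F) r.
Proof. by []. Qed.

Lemma tayS_cst k c r : tayS k.+1 (cst c) r = 0.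
Proof.
elim: k c => [|k IH] c; rewrite tayS_succ big1 ?scaler0 // => i _ /=.
  by rewrite derive_cst scale0r mulr0.
rewrite (_ : 'D_(delta_mx 0 i) (cst c) = cst 0); last first.
  by apply/funext => x; rewrite derive_cst.
by rewrite -tayS_succ IH mulr0.
Qed.

Lemma derive_coord_sub i j c (x : 'rV[R]_n) :
  'D_(delta_mx 0 i) (fun y : 'rV[R]_n => y 0 j - c) x = (j == i)%:R.
Proof.
have d : derivable (fun y : 'rV[R]_n => y 0 j) x (delta_mx 0 i).
  by apply: (iffLR (derivable_mxP id x (delta_mx 0 i)) _ 0 j); exact: derivable_id.
rewrite (_ : (fun y => _) = (fun y : 'rV[R]_n => y 0 j) - cst c) //.
have dc : derivable (cst c : _ -> R) x (delta_mx 0 i : 'rV[R]_n) := @derivable_cst _ _ _ c x _.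
rewrite deriveB //.
rewrite derive_cst subr0.
have /matrixP/(_ 0 j) := @derive_mx _ _ _ _ id x (delta_mx 0 i)
  (@derivable_id _ _ x (delta_mx 0 i : 'rV[R]_n)).
by rewrite derive_id !mxE /= => <-.
Qed.

Lemma tayS_coord k j c r : tayS k (fun x => x 0 j - c) r =
  match k with 0%N => (r 0 j - c)%:A | 1%N => a j | _ => 0 end.
Proof.
case: k => [//|k].
have D i : 'D_(delta_mx 0 i) (fun x : 'rV[R]_n => x 0 j - c) = cst (j == i)%:R.
  by apply/funext => x; exact: derive_coord_sub.
rewrite tayS_succ; under eq_bigr do rewrite D.
case: k => [|k]; last by rewrite big1 ?scaler0 // => i _; rewrite tayS_cst mulr0.
rewrite /= invr1 scale1r (bigD1 j) //= eqxx scale1r mulr1 big1 ?addr0 // => i ij.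
by rewrite eq_sym (negbTE ij) scale0r mulr0.
Qed.

Lemma tayS_mem (I : {vspace A}) k F r : (forall i, a i \in I) ->
  tayS k F r \in (I ^+ k)%VS.
Proof.
move=> aI; elim: k F => [|k IH] F /=; first by rewrite memvZ // memv_line.
rewrite memvZ //; apply: memv_suml => i _; rewrite expvSl.
by apply: memv_mul.
Qed.

Hypothesis mulC : commutative ( *%R : A -> A -> A).

(* Both sides are multiplied by k+1 = j + (k+1-j), and the two summands are
   traced back to the two terms of the product rule. *)
Lemma tayS_mul k W F G r : open W -> W r -> Ck k W F -> Ck k W G ->
  tayS k (F * G) r = \sum_(j < k.+1) tayS j F r * tayS (k - j) G r.
Proof.
move=> oW Wr; elim: k F G => [|k IH] F G CF CG.
  by rewrite big_ord1 /= -scalerAl mul1r scalerA.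
have SE j H : (j.+1)%:R *: tayS j.+1 H r =
    \sum_i a i * tayS j ('D_(delta_mx 0 i) H) r.
  by rewrite /= scalerA divff ?scale1r // pnatr_eq0.
have k0 : (k.+1)%:R != 0 :> R by rewrite pnatr_eq0.
apply: (scalerI k0); rewrite SE.
have [CF' CG'] := (Ck_down CF, Ck_down CG).
have [[_ [dF DF]] [_ [dG DG]]] := (CF, CG).
transitivity (\sum_(j < k.+1) (j.+1%:R *: tayS j.+1 F r) * tayS (k - j) G r +
    \sum_(j < k.+1) tayS j F r * ((k - j).+1%:R *: tayS (k - j).+1 G r)).
  transitivity (\sum_i (\sum_(j < k.+1)
      (a i * tayS j ('D_(delta_mx 0 i) F) r * tayS (k - j) G r) +
    \sum_(j < k.+1) (tayS j F r * (a i * tayS (k - j) ('D_(delta_mx 0 i) G) r)))).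
    apply: eq_bigr => i _.
    have -> : tayS k ('D_(delta_mx 0 i) (F * G)) r =
        tayS k ('D_(delta_mx 0 i) F * G + F * 'D_(delta_mx 0 i) G) r.
      apply: (tayS_eq k oW Wr) => x Wx.
      rewrite deriveM; [|exact: dF|exact: dG].
      rewrite -[RHS]/('D_(delta_mx 0 i) F x * G x + F x * 'D_(delta_mx 0 i) G x).
      by rewrite addrC /GRing.scale /= [G x * _]mulrC.
    rewrite (tayS_add oW Wr (Ck_mul oW (DF i) CG') (Ck_mul oW CF' (DG i))).
    rewrite (IH _ _ (DF i) CG') (IH _ _ CF' (DG i)) mulrDr !mulr_sumr.
    congr (_ + _); apply: eq_bigr => j _.
      by rewrite mulrA.
    by rewrite !mulrA (mulC (a i)).
  rewrite big_split /= exchange_big /= [X in _ + X]exchange_big /=.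
  congr (_ + _); apply: eq_bigr => j _.
    by rewrite SE mulr_suml.
  by rewrite SE mulr_sumr.
rewrite scaler_sumr.
have -> : \sum_(j < k.+2) k.+1%:R *: (tayS j F r * tayS (k.+1 - j) G r) =
  \sum_(j < k.+2) j%:R *: (tayS j F r * tayS (k.+1 - j) G r) +
  \sum_(j < k.+2) (k.+1 - j)%:R *: (tayS j F r * tayS (k.+1 - j) G r).
  rewrite -big_split /=; apply: eq_bigr => j _.
  by rewrite -scalerDl -natrD subnKC // -ltnS.
have e1 (f : nat -> A) : \sum_(j < k.+2) j%:R *: f j = \sum_(j < k.+1) j.+1%:R *: f j.+1.
  by rewrite big_ord_recl scale0r add0r.
have e2 (f : nat -> A) : \sum_(j < k.+2) (k.+1 - j)%:R *: f j =
    \sum_(j < k.+1) (k.+1 - j)%:R *: f j.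
  by rewrite big_ord_recr /= subnn scale0r addr0.
pose f j := tayS j F r * tayS (k.+1 - j) G r.
rewrite (e1 f) (e2 f) /f; congr (_ + _); apply: eq_bigr => j _.
  by rewrite subSS scalerAl.
by rewrite (subSn (ltnSE (ltn_ord j))) scalerAr.
Qed.

(** Regroups a product of two truncated expansions by total degree: the square of indices has the
    triangle plus terms of degree at least N, which are zero. *)
Lemma triangular_sum (f : nat -> nat -> A) N :
  (forall j l, (N <= j + l)%N -> f j l = 0) ->
  (\sum_(m < N) \sum_(j < m.+1) f j (m - j)%N) = \sum_(j < N) \sum_(l < N) f j l.
Proof.
move=> f0.
transitivity (\sum_(0 <= m < N) \sum_(0 <= j < N | (j <= m)%N) f j (m - j)%N).
  rewrite big_mkord; apply: eq_bigr => m _.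
  rewrite -(big_mkord xpredT (fun j => f j (m - j)%N)).
  by rewrite (@big_nat_widen _ _ _ _ _ N) // ltn_ord.
rewrite (exchange_big_dep_nat xpredT) //= big_mkord; apply: eq_bigr => j _.
rewrite -(big_mkord xpredT (fun l => f j l)) [RHS](@big_cat_nat _ _ _ (N - j)) //=;
  last exact: leq_subr.
rewrite [X in _ = _ + X]big_nat_cond [X in _ = _ + X]big1 ?addr0; last first.
  by move=> l /andP[/andP[jl _] _]; apply: f0; rewrite -leq_subLR.
rewrite [LHS](@big_cat_nat _ _ _ j) //=; last exact/ltnW.
rewrite [X in X + _ = _]big_nat_cond [X in X + _ = _]big1 ?add0r; last first.
  by move=> l /andP[/andP[_ lj]]; rewrite leqNgt lj.
rewrite -{1}[X in index_iota X]add0n big_addn big_nat_cond [RHS]big_nat_cond.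
by apply: eq_big => l; [rewrite leq_addl|rewrite addnK].
Qed.

(** Truncation is compatible with products because terms of degrees j and l multiply into I^(j+l),
    which is 0 once j + l >= N. *)
Lemma tay_mul N W F G r (I : {vspace A}) : (forall i, a i \in I) ->
  (I ^+ N)%VS = 0%VS -> open W -> W r -> Cinfty W F -> Cinfty W G ->
  tay N (F * G) r = tay N F r * tay N G r.
Proof.
move=> aI IN oW Wr CF CG.
rewrite /tay; under eq_bigr do rewrite (tayS_mul oW Wr (CF _) (CG _)).
rewrite (@triangular_sum (fun j l => tayS j F r * tayS l G r)); last first.
  move=> j l jl; apply/eqP; rewrite -memv0.
  have IjlE : (I ^+ (j + l))%VS = 0%VS.
    by rewrite -(subnKC jl) expvD IN prod0v.
  by rewrite -IjlE expvD; apply: memv_mul; exact: tayS_mem.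
rewrite mulr_suml; apply: eq_bigr => j _; rewrite mulr_sumr.
by apply: eq_bigr => l _.
Qed.

Lemma tay_eq N W F G r : open W -> W r -> (forall x, W x -> F x = G x) ->
  tay N F r = tay N G r.
Proof. by move=> oW Wr FG; apply: eq_bigr => k _; exact: tayS_eq FG. Qed.

Lemma tay_add N W F G r : open W -> W r -> Cinfty W F -> Cinfty W G ->
  tay N (F + G) r = tay N F r + tay N G r.
Proof.
move=> oW Wr CF CG; rewrite /tay -big_split; apply: eq_bigr => k _.
exact: (tayS_add oW Wr (CF k) (CG k)).
Qed.

Lemma tay_scale N W F c r : open W -> W r -> Cinfty W F ->
  tay N (c *: F) r = c *: tay N F r.
Proof.
move=> oW Wr CF; rewrite /tay scaler_sumr; apply: eq_bigr => k _.
exact: (tayS_scale c oW Wr (CF k)).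
Qed.

Lemma tay_cst N c r : (0 < N)%N -> tay N (cst c) r = c%:A.
Proof.
case: N => // N _; rewrite /tay big_ord_recl /= big1 ?addr0 // => k _.
exact: tayS_cst.
Qed.

Lemma tay_coord N j (r : 'rV[R]_n) : (1 < N)%N -> tay N (fun x => x 0 j - r 0 j) r = a j.
Proof.
case: N => [//|[//|N]] _; rewrite /tay; under eq_bigr do rewrite tayS_coord.
by rewrite !big_ord_recl /= subrr scale0r add0r big1 ?addr0 // => k _.
Qed.

Lemma tay_base (zA : {lrmorphism A -> R^o}) N F r : (0 < N)%N ->
  (forall i, zA (a i) = 0) -> zA (tay N F r) = F r.
Proof.
case: N => // N _ a0; rewrite /tay big_ord_recl raddfD raddf_sum /= big1 ?addr0.
  by rewrite linearZ rmorph1 /= /GRing.scale /= mulr1.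
move=> k _; rewrite linearZ raddf_sum big1; first exact: mulr0.
by move=> i _; rewrite -[LHS]/(zA _) rmorphM /= a0 mul0r.
Qed.

End taylor.

(** * Affine frames and charts *)

Section affine_frames.
Context {R : realType} {V : vectType R} {M : Type} (E : affine V M).
Local Notation n := (\dim {:V}).
Implicit Types (a b x y : M).

Definition aff_coord a y : 'rV[R]_n := passmx.rVof (vbasis {:V}) (aff_sub E y a).

Let vB := vbasisP (fullv : {vspace V}).

Lemma aff_coordK a : cancel (aff_coord a) (aff_frame E a).
Proof. by move=> y; rewrite /aff_frame /aff_coord passmx.rVofK // aff_subK. Qed.

Lemma aff_frameK a : cancel (aff_frame E a) (aff_coord a).
Proof. by move=> r; rewrite /aff_frame /aff_coord aff_addK passmx.vecofK. Qed.

Lemma aff_sub_add x a v : aff_sub E (aff_add E x v) a = aff_sub E x a + v.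
Proof. by rewrite -{1}(aff_subK E a x) aff_addA aff_addK. Qed.

Lemma aff_subxx x : aff_sub E x x = 0.
Proof. by rewrite -[LHS](addrK (aff_sub E x x)) -aff_sub_add aff_subK subrr. Qed.

Lemma aff_sub_trans x a b : aff_sub E x b = aff_sub E x a + aff_sub E a b.
Proof. by rewrite -{1}(aff_subK E a x) aff_sub_add addrC. Qed.

(** A change of origin is a translation of row vectors; hence the conditions imposed for all origins
    can be checked at one. *)
Lemma aff_frame_origin a b r : aff_frame E a r = aff_frame E b (r + aff_coord b a).
Proof.
rewrite -[LHS](aff_coordK b); congr (aff_frame E b _).
apply/rowP => j; rewrite [RHS]mxE /aff_frame /aff_coord aff_sub_add.
by rewrite -!passmx.coord_rVof linearD /= passmx.coord_vecof // addrC.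
Qed.

Lemma shift_continuous (c : 'rV[R]_n) : continuous (fun r : 'rV[R]_n => r + c).
Proof. by move=> r; apply: (continuousD (@cvg_id _ _) (@cst_continuous _ _ c r)). Qed.

Lemma aff_openP a (U : set M) : aff_open E U <-> open (aff_frame E a @^-1` U).
Proof.
split=> [|oU b]; first exact.
rewrite (_ : _ @^-1` U = (fun r => r + aff_coord a b) @^-1` (aff_frame E a @^-1` U)).
  by apply: open_comp => // r _; exact: shift_continuous.
by apply/funext => r /=; rewrite (aff_frame_origin b a).
Qed.

Lemma Cinfty_shift (W : set 'rV[R]_n) (F : 'rV[R]_n -> R) c : open W ->
  Cinfty W F -> Cinfty ((fun r => r + c) @^-1` W) (fun r => F (r + c)).
Proof.
move=> oW CF k.
have oW' : open ((fun r => r + c) @^-1` W).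
  by apply: open_comp => // r _; exact: shift_continuous.
apply: (Ck_comp oW' oW _ _ (CF k)) => // j.
rewrite (_ : (fun r => _) = (fun r : 'rV[R]_n => r 0 j) + cst (c 0 j)).
  exact: (Ck_add oW' (Cinfty_coord j oW' k) (Ck_cst k _ oW')).
by apply/funext => r; rewrite mxE.
Qed.

Lemma smooth_onP a (U : set M) (f : M -> R) : aff_open E U ->
  smooth_on E U f <-> Cinfty (aff_frame E a @^-1` U) (f \o aff_frame E a).
Proof.
move=> oU; split=> [|Cf b]; first exact.
rewrite (_ : aff_frame E b = aff_frame E a \o (fun r => r + aff_coord a b)).
  exact: (Cinfty_shift (aff_coord a b) ((aff_openP a U).1 oU) Cf).
by apply/funext => r; exact: aff_frame_origin.
Qed.

Lemma Cinfty_frame_scalar (l : {scalar V}) a b (W : set 'rV[R]_n) :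
  Cinfty W (fun r => l (aff_sub E (aff_frame E a r) b)).
Proof.
move=> k; apply: (@Ck_subset _ _ _ setT) => //.
have oT : aff_open E setT by move=> c; rewrite preimage_setT; exact: openT.
by have := smooth_on_scalar b l oT a k; rewrite preimage_setT.
Qed.

Lemma aff_coordE a y j : aff_coord a y 0 j = coord (vbasis {:V}) j (aff_sub E y a).
Proof. by rewrite /aff_coord passmx.coord_rVof. Qed.

End affine_frames.

(** * Manifolds in coordinates: topology, smoothness and gluing *)

Section charts.
Context {R : realType} {V : vectType R} {M : Type} {E : affine V M} {P : Type}.
Variables (C : set (chart E P)) (a0 : M).
Hypothesis hC : smooth_atlas C.
Local Notation n := (\dim {:V}).
Local Notation PC := (mspace C).
Implicit Types (c d : chart E P) (O : set PC) (f g : P -> R) (p q : P)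
  (r : 'rV[R]_n).

Definition chart_coord c p : 'rV[R]_n := aff_coord E a0 (cmap c p).

Local Notation phi := chart_coord.

Lemma phi_inj c p q : cdom c p -> cdom c q -> phi c p = phi c q -> p = q.
Proof.
move=> cp cq /(can_inj (aff_coordK E a0)); exact: chart_inj.
Qed.

Lemma phi_image c (O : set P) : phi c @` O = aff_frame E a0 @^-1` (cmap c @` O).
Proof.
apply/seteqP; split=> [_ [p Op <-]|r [p Op pr]]; exists p => //.
  by rewrite /phi aff_coordK.
by rewrite /phi pr aff_frameK.
Qed.

Lemma open_mspace (O : set P) : open (O : set PC) = atlas_open C O.
Proof. by []. Qed.

Lemma phi_open c O : C c -> open O -> open (phi c @` (O `&` cdom c)).
Proof. by move=> Cc oO; rewrite phi_image; exact: oO. Qed.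

Lemma phi_dom_open c : open (phi c @` cdom c).
Proof. by rewrite phi_image; exact: chart_open. Qed.

Lemma transition c d : C c -> C d ->
  let W := phi c @` (cdom c `&` cdom d) in
  open W /\ exists2 t : 'rV[R]_n -> 'rV[R]_n,
    (forall j, Cinfty W (fun r => t r 0 j)) &
    forall p, cdom c p -> cdom d p -> phi d p = t (phi c p).
Proof.
move=> Cc Cd W; have [ oW [g sg gE]] := hC.2 c d Cc Cd.
split; first by rewrite /W phi_image; exact/aff_openP.
exists (fun r => aff_coord E a0 (g (aff_frame E a0 r))).
  move=> j k; rewrite /W phi_image.
  have := sg a0 (coord (vbasis {:V}) j) a0 k.
  by apply: Ck_ext => [|r _ /=]; [exact/aff_openP|rewrite aff_coordE].
by move=> p cp dp; rewrite /phi aff_coordK -gE.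
Qed.

(** Openness has to be tested in every chart d of the atlas; there the set is the preimage of B
    under the transition map from d to c. *)
Lemma phi_preimage_open c O (B : set 'rV[R]_n) : C c -> open B ->
  O = [set p | cdom c p /\ B (phi c p)] -> open O.
Proof.
move=> Cc oB ->; rewrite open_mspace => d Cd; apply/(aff_openP _ a0).
rewrite -phi_image; have [ oW [t Ct tE]] := transition Cd Cc.
rewrite (_ : _ @` _ = phi d @` (cdom d `&` cdom c) `&` (t @^-1` B)).
  (* t is continuous only at the points of the overlap, so openness is checked point by point. *)
  rewrite openE => r [Wr Br].
  have ct : {for r, continuous t}.
    by apply: rV_continuous => j; exact: (Ck_cont (Ct j 0%N)).
  rewrite /interior; apply: filterI; first exact: open_nbhs_nbhs.
  by apply: ct; exact: open_nbhs_nbhs.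
apply/seteqP; split=> [_ [p [[cp Bp] dp] <-]|_ [[p [dp cp] <-] Bp]].
  by split; [exists p|rewrite /= -tE].
by exists p => //; split=> //; split=> //; rewrite tE.
Qed.

Lemma cdom_open c : C c -> open (cdom c : set PC).
Proof.
move=> Cc; apply: (@phi_preimage_open c _ setT) => //; first exact: openT.
by apply/seteqP; split=> p // [].
Qed.

Lemma nbhs_phi c p (B : set 'rV[R]_n) : C c -> cdom c p -> nbhs (phi c p) B ->
  \forall q \near (p : PC), cdom c q /\ B (phi c q).
Proof.
move=> Cc cp; rewrite nbhsE => -[B' [ oB' B'p] B'B].
apply: (@filterS _ (nbhs (p : PC)) _ [set q | cdom c q /\ B' (phi c q)]).
  by move=> q [cq /B'B].
by apply: open_nbhs_nbhs; split => //; exact: (phi_preimage_open Cc oB').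
Qed.

Lemma phi_nbhs c p (O : set PC) : C c -> cdom c p -> nbhs (p : PC) O ->
  nbhs (phi c p) (phi c @` (O `&` cdom c)).
Proof.
move=> Cc cp; rewrite nbhsE => -[ O' [ oO' O'p] O'O].
apply: (@filterS _ _ _ (phi c @` (O' `&` cdom c))).
  by move=> _ [q [ O'q cq] <-]; exists q => //; split=> //; exact: O'O.
by apply: open_nbhs_nbhs; split; [exact: phi_open|exists p].
Qed.

Lemma phi_compact c (B : set 'rV[R]_n) : C c -> B `<=` phi c @` cdom c ->
  compact B -> compact ([set q | cdom c q /\ B (phi c q)] : set PC).
Proof.
move=> Cc BD cB F FF FK.
have [r [Br clr]] : B `&` cluster (phi c @ F) !=set0.
  have FB : (phi c @ F) B by apply: (@filterS _ F _ _ _ _ FK) => q -[].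
  exact: (cB (phi c @ F) _ FB).
have [q cq qr] := BD _ Br; exists q; split; first by split; rewrite ?qr.
move=> X O FX Oq.
have Ophi : nbhs r (phi c @` (O `&` cdom c)) by rewrite -qr; exact: phi_nbhs.
have Xphi : (phi c @ F) (phi c @` (X `&` [set q | cdom c q /\ B (phi c q)])).
  by apply: (@filterS _ F _ _ _ _ (filterI FX FK)) => x Hx; exists x.
have [_ [[x [Xx [cx Bx]] <-] [y [ Oy cy] yx]]] := clr _ _ Xphi Ophi.
by exists x; split=> //; rewrite -(phi_inj cy cx yx).
Qed.

(** The calculus above concerns total functions on row vectors, so f read in the chart c receives
    the arbitrary value 0 off the image of the chart. *)
Definition loc c f r : R :=
  match pselect (exists p, cdom c p /\ phi c p = r) with
  | left h => f (projT1 (cid h))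
  | right _ => 0
  end.

Lemma locE c f p : cdom c p -> loc c f (phi c p) = f p.
Proof.
move=> cp; rewrite /loc; case: pselect => [h|[]]; last by exists p.
by case: cid => q [cq qp] /=; congr f; exact: phi_inj qp.
Qed.

Lemma loc_mem c f r (O : set P) (Q : 'rV[R]_n -> R -> Prop) : O `<=` cdom c ->
  (forall p, O p -> Q (phi c p) (f p)) -> (phi c @` O) r -> Q r (loc c f r).
Proof. by move=> Oc H [p Op <-]; rewrite locE; [exact: H|exact: Oc]. Qed.

Lemma smoothP f : smooth C f <-> forall c, C c -> Cinfty (phi c @` cdom c) (loc c f).
Proof.
split=> [sf c Cc k|Hf c Cc].
  have [g sg gE] := sf c Cc; have := sg a0 k; rewrite -phi_image.
  apply: Ck_ext => [|r]; first exact: phi_dom_open.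
  apply: (@loc_mem c f r _ (fun r x => (g \o aff_frame E a0) r = x)) => // p cp.
  by rewrite /= aff_coordK gE.
exists (fun x => loc c f (aff_coord E a0 x)); last by move=> p cp; rewrite -[LHS](locE _ cp).
refine (iffRL (@smooth_onP _ _ _ E a0 _ _ (@chart_open _ _ _ _ _ c)) _) => k.
rewrite -phi_image; have := Hf c Cc k; apply: Ck_ext; first exact: phi_dom_open.
by move=> r _ /=; rewrite aff_frameK.
Qed.

Definition smooth_near (O : set P) f :=
  forall c, C c -> Cinfty (phi c @` (O `&` cdom c)) (loc c f).

Lemma smooth_near_smooth O f : smooth C f -> smooth_near O f.
Proof.
move=> /smoothP sf c Cc k; apply: Ck_subset (sf c Cc k) => _ [p [_ cp] <-].
by exists p.
Qed.

(** Smoothness in one chart suffices: in any other chart the function is F after a transition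
    map. *)
Lemma smooth_near_chart c O (F : 'rV[R]_n -> R) f : C c -> open O -> O `<=` cdom c ->
  Cinfty (phi c @` O) F -> (forall p, O p -> f p = F (phi c p)) -> smooth_near O f.
Proof.
move=> Cc oO Oc CF fF d Cd k; have [ oW [t Ct tE]] := transition Cd Cc.
set W' := _ @` _; have oW' : open W' by exact: phi_open.
have oO' : open (phi c @` O) by rewrite -(setIidl Oc); exact: phi_open.
have W'W : W' `<=` phi d @` (cdom d `&` cdom c).
  by move=> _ [p [/Oc cp dp] <-]; exists p.
have : Ck k W' (F \o t).
  apply: (Ck_comp oW' oO' _ _ (CF k)).
    by move=> _ [p [ Op dp] <-]; exists p => //; rewrite tE //; exact: Oc.
  by move=> j; apply: Ck_subset (Ct j k).
apply: Ck_ext => // r.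
apply: (@loc_mem d f r (O `&` cdom d) (fun r x => (F \o t) r = x)).
  by move=> p [].
by move=> p [ Op dp] /=; rewrite -tE ?fF //; exact: Oc.
Qed.

Lemma smooth_glue f :
  (forall p, exists O g, [/\ open O, O p, smooth_near O g &
    forall q, O q -> f q = g q]) -> smooth C f.
Proof.
move=> H; apply/smoothP => c Cc k; apply: Ck_local => _ [p cp <-].
have [ O [g [ oO Op sg fg]]] := H p.
exists (phi c @` (O `&` cdom c)), (loc c g); split.
- exact: phi_open.
- by exists p.
- exact: sg.
- by move=> _ [q [ Oq cq] <-]; rewrite !locE // fg.
Qed.

Definition chart_fun c (F : 'rV[R]_n -> R) q : R :=
  if `[< cdom c q >] then F (phi c q) else 0.

Lemma chart_funE c F q : cdom c q -> chart_fun c F q = F (phi c q).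
Proof. by move=> cq; rewrite /chart_fun asboolT. Qed.

Lemma chart_fun_out c F q : ~ cdom c q -> chart_fun c F q = 0.
Proof. by move=> cq; rewrite /chart_fun asboolF. Qed.

End charts.

(** * Smooth functions on a manifold *)

Section bumps.
Context {R : realType} {V : vectType R} {M : Type} {E : affine V M} {P : Type}.
Variables (C : set (chart E P)) (a0 : M).
Hypotheses (hC : smooth_atlas C) (hT : hausdorff_space (mspace C)).
Local Notation n := (\dim {:V}).
Local Notation PC := (mspace C).
Local Notation phi := (chart_coord a0).
Local Notation loc := (loc a0).
Implicit Types (c d : chart E P) (O : set PC) (f g : P -> R) (p q : P)
  (r : 'rV[R]_n).

Lemma smooth_continuous f : smooth C f -> continuous (f : PC -> R).
Proof.
move=> sf p B Bfp; have [c Cc cp] := hC.1 p.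
have cl : {for phi c p, continuous (loc c f)}.
  by apply: (Ck_cont ((iffLR (smoothP C a0 f) sf) c Cc 0%N)); exists p.
have lB : nbhs (phi c p) (loc c f @^-1` B) by apply: cl; rewrite locE.
have := nbhs_phi hC Cc cp lB; apply: filterS => q [cq].
by rewrite /= locE.
Qed.

Lemma closed_ball_rV (m : nat) (x : 'rV[R]_m) (e : R) :
  closed [set r | `|r - x| <= e] /\ compact [set r : 'rV[R]_m | `|r - x| <= e].
Proof.
have cl : closed [set r : 'rV[R]_m | `|r - x| <= e].
  rewrite -openC openE => r /= /negP; rewrite -ltNge => er.
  apply/nbhs_ballP; exists (`|r - x| - e); first by rewrite /= subr_gt0.
  move=> s; rewrite -ball_normE /= ltrBrDl => rs; apply/negP; rewrite -ltNge.
  rewrite -(ltrD2r `|r - s|); apply: (lt_le_trans rs).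
  by rewrite [leRHS]addrC; exact: ler_distD.
split=> //; apply: bounded_closed_compact => //.
exists (`|x| + e); split; first exact: num_real.
move=> t te r /= re; apply: le_trans (ltW te).
by rewrite -[r](subrK x) addrC (le_trans (ler_normD _ _)) // lerD.
Qed.

Lemma chart_ball c p O : C c -> cdom c p -> nbhs (p : PC) O ->
  exists2 e : R, 0 < e &
    [set r | `|r - phi c p| <= e] `<=` phi c @` (O `&` cdom c).
Proof.
move=> Cc cp /(phi_nbhs a0 Cc cp)/nbhs_ballP[e /= e0 eO].
(* Halving makes the closed ball fit into the open one. *)
exists (e / 2); first by rewrite divr_gt0.
move=> r /= re; apply: eO; rewrite -ball_normE /= distrC.
by rewrite (le_lt_trans re) // ltr_pdivrMr // ltr_pMr // ltr1n.
Qed.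

Lemma chart_ball_sub c p O (e : R) : C c ->
  [set r | `|r - phi c p| <= e] `<=` phi c @` (O `&` cdom c) ->
  compact ([set q | cdom c q /\ `|phi c q - phi c p| <= e] : set PC) /\
  [set q | cdom c q /\ `|phi c q - phi c p| <= e] `<=` O.
Proof.
move=> Cc BO; split.
  apply: (@phi_compact _ _ _ _ _ C a0 c [set r | `|r - phi c p| <= e]) => //.
    by move=> r /BO[q [_ cq] <-]; exists q.
  exact: (closed_ball_rV _ _).2.
by move=> q [cq] /BO[q' [Oq' cq'] /(phi_inj cq' cq) <-].
Qed.

(** P is covered by the two open sets [cdom c] and the complement of K; the latter is open because
    compact sets of a Hausdorff space are closed, and the function is 0 on it. *)
Lemma chart_fun_smooth c (K : set PC) (F : 'rV[R]_n -> R) : C c -> compact K ->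
  K `<=` cdom c -> Cinfty (phi c @` cdom c) F ->
  (forall q, cdom c q -> ~ K q -> F (phi c q) = 0) ->
  smooth C (chart_fun a0 c F).
Proof.
move=> Cc cK Kc CF F0; apply: (smooth_glue (a0 := a0)) => p.
have [Kp|nKp] := pselect (K p).
  exists (cdom c), (chart_fun a0 c F); split=> //.
  - exact: (cdom_open a0 hC Cc).
  - exact: Kc.
  - apply: (smooth_near_chart hC Cc) CF _ => //; first exact: (cdom_open a0 hC Cc).
    by move=> q cq; rewrite chart_funE.
exists (~` K), (cst 0); split=> //.
- by apply: closed_openC; exact: compact_closed.
- by apply: smooth_near_smooth; exact: smooth_cst.
- move=> q nKq /=; have [cq|ncq] := pselect (cdom c q).
    by rewrite chart_funE // F0.
  by rewrite chart_fun_out.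
Qed.

Lemma chart_bump c p O : C c -> cdom c p -> nbhs (p : PC) O ->
  exists b (K : set PC), [/\ smooth C b, forall q, 0 <= b q <= 1,
    compact K, K `<=` O `&` cdom c & (\forall q \near (p : PC), b q = 1) /\
    (forall q, ~ K q -> b q = 0)].
Proof.
move=> Cc cp pO; have [e e0 eO] := chart_ball Cc cp pO.
have [cK KO] := chart_ball_sub Cc eO.
set K := [set q | _] in cK KO.
have [b [Cb b01 b1 b0]] := rV_bump (phi c p) e0.
have b0' q : cdom c q -> ~ K q -> b (phi c q) = 0.
  move=> cq nKq; apply: b0; rewrite leNgt; apply/negP => /ltW qe.
  by apply: nKq; split.
exists (chart_fun a0 c b), K; split=> //.
- apply: (chart_fun_smooth Cc cK) b0' => [q []//|k].
  exact: (@Ck_subset _ _ _ setT).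
- move=> q; rewrite /chart_fun; case: asboolP => // _.
  by rewrite lexx ler01.
- by move=> q Kq; split; [exact: KO|case: Kq].
split; last first.
  move=> q nKq; rewrite /chart_fun; case: asboolP => // cq.
  exact: b0'.
have := nbhs_phi hC Cc cp b1; apply: filterS => q [cq].
by rewrite chart_funE.
Qed.

Lemma smooth_bump p O : nbhs (p : PC) O ->
  exists b (K : set PC), [/\ smooth C b, forall q, 0 <= b q <= 1,
    compact K, K `<=` O & (\forall q \near (p : PC), b q = 1) /\
    (forall q, ~ K q -> b q = 0)].
Proof.
move=> pO; have [c Cc cp] := hC.1 p.
have [b [K [sb b01 cK KO bP]]] := chart_bump Cc cp pO.
by exists b, K; split=> //; move=> q /KO[].
Qed.

(** Turns a function known only in a chart into an argument for elements of [weil A C], at the price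
    of keeping only its germ. *)
Lemma germ_extension c p (F : 'rV[R]_n -> R) : C c -> cdom c p ->
  Cinfty (phi c @` cdom c) F ->
  exists2 f, smooth C f & \forall q \near (p : PC), f q = F (phi c q).
Proof.
move=> Cc cp CF; have cn : nbhs (p : PC) (cdom c).
  by apply: open_nbhs_nbhs; split => //; exact: (cdom_open a0 hC Cc).
have [b [K [sb b01 cK Kc [b1 b0]]]] := chart_bump Cc cp cn.
exists (chart_fun a0 c (F * loc c b)).
  apply: (chart_fun_smooth Cc cK).
  - by move=> q /Kc[].
  - by move=> k; apply: Ck_mul (CF k) _; [exact: phi_dom_open|exact: (iffLR (smoothP C a0 b) sb)].
  - by move=> q cq nKq; rewrite -[LHS]/(F _ * loc c b _) locE // b0 // mulr0.
apply: (@filterS _ _ _ _ _ _ (@filterI _ (nbhs (p : PC)) _ _ _ cn b1)) => q [cq bq].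
by rewrite chart_funE // -[LHS]/(F _ * loc c b _) locE // bq mulr1.
Qed.

(** Hadamard's lemma wants a function smooth on the whole space of row vectors: f is first
    multiplied by a bump around p, and the resulting coefficients are then globalised by their
    germs. *)
Lemma hadamard_manifold c p f : C c -> cdom c p -> smooth C f ->
  exists2 g : 'I_n -> P -> R, (forall i, smooth C (g i)) &
    \forall q \near (p : PC),
      f q = f p + \sum_i (phi c q 0 i - phi c p 0 i) * g i q.
Proof.
move=> Cc cp sf; have cn : nbhs (p : PC) (cdom c).
  by apply: open_nbhs_nbhs; split => //; exact: (cdom_open a0 hC Cc).
have [e e0 eO] := chart_ball Cc cp cn.
have [b [Cb _ b1 b0]] := rV_bump (phi c p) e0.
have Clf := (iffLR (smoothP C a0 f) sf) c Cc.
have CH : Cinfty setT (b * loc c f).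
  move=> k; apply: Ck_local => r _.
  (* Off the chart image the product is locally 0, as the closed ball that supports the bump lies
     inside the image. *)
  have [cr|ncr] := pselect ((phi c @` cdom c) r).
    exists (phi c @` cdom c), (b * loc c f); split=> //; first exact: phi_dom_open.
    apply: (Ck_mul _ _ (Clf k)); first exact: phi_dom_open.
    exact: (@Ck_subset _ _ _ setT).
  exists (~` [set r | `|r - phi c p| <= e]), (cst 0); split.
  - by apply: closed_openC; exact: (closed_ball_rV _ _).1.
  - by move=> /eO[q [_ cq] qr]; apply: ncr; exists q.
  - by apply: Ck_cst; apply: closed_openC; exact: (closed_ball_rV _ _).1.
  - move=> s /= /negP; rewrite -ltNge => /ltW/b0 bs.
    by rewrite -[RHS]/(b s * loc c f s) bs mul0r.
have [G CG HG] := hadamard (phi c p) CH.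
have ext i : exists g, smooth C g /\ \forall q \near (p : PC), g q = G i (phi c q).
  have CGi : Cinfty (phi c @` cdom c) (G i).
    by move=> k; apply: (@Ck_subset _ _ _ setT) => //; exact: CG.
  by have [g sg gG] := germ_extension Cc cp CGi; exists g.
have {ext}/choice[g gP] := ext.
exists g; first by move=> i; have [] := gP i.
have gG : \forall q \near (p : PC), forall i, g i q = G i (phi c q).
  by apply: (@filter_forall _ _ _ (nbhs (p : PC))) => i; have [] := gP i.
have bn := nbhs_phi hC Cc cp b1.
apply: (@filterS _ (nbhs (p : PC)) _ _ _ _ (filterI gG bn)) => q [gq [cq bq]].
have bp : b (phi c p) = 1 by exact: nbhs_singleton b1.
have := HG (phi c q); rewrite -[LHS]/(b _ * loc c f _) -[(b * _) _]/(b _ * loc c f _).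
rewrite !locE // bq bp !mul1r => ->; congr (_ + _); apply: eq_bigr => i _.
by rewrite gq.
Qed.

End bumps.

(** * Homomorphisms into a local algebra *)

Section smooth_functions.
Context {R : realType} {V : vectType R} {M : Type} {E : affine V M} {P : Type}.
Variables (C : set (chart E P)).
Implicit Types (f g : P -> R).

Definition mksmooth f (sf : smooth C f) : smoothfun C := SmoothFun (mem_set sf).

Lemma smooth_smval (f : smoothfun C) : smooth C f.
Proof. exact: set_mem (smvalP f). Qed.

Lemma smoothfun_eq (f g : smoothfun C) : (forall p, f p = g p) -> f = g.
Proof. by move=> fg; apply: val_inj; apply/funext. Qed.

Lemma smooth_inv f : smooth C f -> (forall p, f p != 0) ->
  smooth C (fun p => (f p)^-1).
Proof.
move=> sf f0 c Cc; have [g sg fg] := sf c Cc.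
exists (fun x => (g x)^-1); last by move=> p cp; rewrite fg.
move=> a k; apply: (Ck_inv _ _ (sg a k)).
  exact: (@chart_open _ _ _ _ _ c).
by move=> r [p cp pr] /=; rewrite -pr -fg.
Qed.

Lemma smooth_sum (I : Type) (s : seq I) (F : I -> P -> R) :
  (forall i, smooth C (F i)) -> smooth C (fun p => \sum_(i <- s) F i p).
Proof.
move=> sF; rewrite (_ : (fun p => _) = \sum_(i <- s) F i).
  elim/big_ind : _ => //; first exact: smooth_cst.
  exact: smooth_add.
by apply/funext => p; rewrite fct_sumE.
Qed.

Lemma smooth_sub f g : smooth C f -> smooth C g -> smooth C (fun p => f p - g p).
Proof.
move=> sf sg; have := smooth_add sf (smooth_scale (-1) sg).
by congr smooth; apply/funext => p; rewrite /GRing.add /= scaleN1r.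
Qed.

End smooth_functions.

(** * Finite lists of functions and common points *)

Section weil_points.
Context {R : realType} {A : falgType R} {I : {vspace A}} {zA : {lrmorphism A -> R^o}}.
Hypothesis hA : local_algebra I zA.
Context {V : vectType R} {M : Type} {E : affine V M} {P : Type}.
Variables (C : set (chart E P)).
Implicit Types (u v : weil A C).

Lemma weil_ext u v : (forall f, u f = v f) -> u = v.
Proof.
case: u v => [u um] [v vm] /= uv.
have E' : u = v.
  case: u v uv {um vm} => [u uc] [v vc] /= /funext uv; subst v.
  congr GRing.Linear.Pack.
  case: uc vc => [[u1] [u2]] [[v1] [v2]].
  by congr GRing.Linear.Class; congr (_ _); exact: Prop_irrelevance.
by subst v; congr Weil; exact: Prop_irrelevance.
Qed.

Lemma weilM u f g : u (f * g) = u f * u g.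
Proof. by have [_ ->] := weil_morph u. Qed.

Lemma weil1 u : u 1 = 1.
Proof. by have [->] := weil_morph u. Qed.

Lemma weil_cst u k (sk : smooth C (cst k)) : u (mksmooth sk) = k%:A.
Proof.
rewrite (_ : mksmooth sk = k *: (1 : smoothfun C)) ?linearZ ?weil1 //.
by apply: smoothfun_eq => p; rewrite /= -[LHS]mulr1.
Qed.

(** A function without zeros has a smooth inverse, so its image is a unit and cannot lie in the
    kernel of zA. *)
Lemma weil_kernel_zero u (f : smoothfun C) : zA (u f) = 0 -> exists p, f p = 0.
Proof.
move=> uf; apply: contrapT => nf.
have f0 p : f p != 0 by apply/eqP => fp; apply: nf; exists p.
pose g := mksmooth (smooth_inv (smooth_smval f) f0).
have fg : f * g = 1.
  by apply: smoothfun_eq => p; rewrite -[LHS]/(f p * (f p)^-1) divff.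
have := congr1 (fun h => zA (u h)) fg.
by rewrite weilM weil1 rmorphM /= uf mul0r rmorph1 => /esym/eqP; rewrite oner_eq0.
Qed.

(** The sum of the squares (f - zA (u f))^2 is in the kernel, hence has a zero, at which every
    summand vanishes. *)
Lemma weil_common_point u (s : seq (smoothfun C)) :
  exists p, all (fun f : smoothfun C => f p == zA (u f)) s.
Proof.
pose h (f : smoothfun C) : R := zA (u f).
pose k (f : smoothfun C) := f - h f *: (1 : smoothfun C).
have hk f : zA (u (k f)) = 0.
  rewrite /k linearB linearZ weil1 rmorphB /= linearZ rmorph1 /= /GRing.scale /= mulr1.
  exact: subrr.
pose G := \sum_(f <- s) k f * k f.
have [|p] := @weil_kernel_zero u G.
  rewrite /G linear_sum raddf_sum /= big1 // => f _.
  by rewrite weilM rmorphM /= hk mul0r.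
have -> : G p = \sum_(f <- s) (f p - h f) ^+ 2.
  rewrite /G; elim: s {G} => [|f s IH]; first by rewrite !big_nil.
  rewrite !big_cons -IH -[LHS]/((f p - h f * 1) * (f p - h f * 1) + _).
  by rewrite mulr1 -expr2.
move=> /eqP; rewrite psumr_eq0 => [|f _]; last exact: sqr_ge0.
move=> Gp; exists p; apply/allP => f fs; have := allP Gp f fs.
by rewrite /= sqrf_eq0 subr_eq0.
Qed.

End weil_points.

(** * Homomorphisms over a point are Taylor evaluations *)

Section weil_taylor.
Context {R : realType} {A : falgType R} {I : {vspace A}} {zA : {lrmorphism A -> R^o}}.
Hypothesis hA : local_algebra I zA.
Variable N : nat.
Hypotheses (N1 : (1 < N)%N) (IN : (I ^+ N)%VS = 0%VS).
Context {V : vectType R} {M : Type} {E : affine V M} {P : Type}.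
Variables (C : set (chart E P)) (a0 : M).
Hypotheses (hC : smooth_atlas C) (hT : hausdorff_space (mspace C)).
Local Notation n := (\dim {:V}).
Local Notation PC := (mspace C).
Local Notation phi := (chart_coord a0).
Local Notation loc := (loc a0).
Implicit Types (u v : weil A C) (c : chart E P) (p q : P) (a : 'I_n -> A).

(** Even more is shown: q lies in each neighbourhood of p, since a bump at p supported there takes
    the same value at p and at q. *)
Lemma weil_base_unique u p q : weil_base zA u p -> weil_base zA u q -> p = q.
Proof.
move=> up uq; apply: (hT (p := p) (q := q)) => O1 O2 pO1 qO2.
have [b [K [sb b01 cK KO [b1 b0]]]] := smooth_bump a0 hC hT pO1.
exists q; split; last exact: nbhs_singleton qO2.
apply: KO; apply: contrapT => /b0 bq.
have := up (mksmooth sb); rewrite (uq (mksmooth sb)) /= bq (nbhs_singleton b1).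
by move/eqP; rewrite eq_sym oner_eq0.
Qed.

(** A bump b at p supported where f = g satisfies (f - g) b = 0, and u b is a unit because b p =
    1. *)
Lemma weil_germ u p (f g : smoothfun C) : weil_base zA u p ->
  (\forall q \near (p : PC), f q = g q) -> u f = u g.
Proof.
move=> up fg; have [b [K [sb _ _ KO [b1 b0]]]] := smooth_bump a0 hC hT fg.
have fgb : (f - g) * mksmooth sb = 0.
  apply: smoothfun_eq => q; rewrite -[LHS]/((f q - g q) * b q) -[RHS]/(0 : R).
  have [/KO /= ->|/b0 ->] := pselect (K q); first by rewrite subrr mul0r.
  by rewrite mulr0.
have : zA (u (mksmooth sb)) != 0.
  by rewrite up /= (nbhs_singleton b1) oner_eq0.
move=> /(local_unit hA)[x xb]; apply/eqP; rewrite -subr_eq0 -linearB; apply/eqP.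
rewrite -[LHS]mulr1 -xb (local_mulrC hA x) mulrA -weilM fgb linear0.
by rewrite mul0r.
Qed.

Lemma tay_near a c p (f : P -> R) F : C c -> cdom c p ->
  (\forall q \near (p : PC), f q = F (phi c q)) ->
  tay a N (loc c f) (phi c p) = tay a N F (phi c p).
Proof.
move=> Cc cp /(phi_nbhs a0 Cc cp); rewrite nbhsE => -[W [oW Wp] WO].
apply: (tay_eq a N oW Wp) => r /WO[q [fq cq] <-].
by rewrite locE.
Qed.

Lemma tay_weil a c p : C c -> cdom c p -> (forall i, a i \in I) ->
  exists u : weil A C, forall f, u f = tay a N (loc c f) (phi c p).
Proof.
move=> Cc cp aI; pose u (f : smoothfun C) := tay a N (loc c f) (phi c p).
have oD : open (phi c @` cdom c) by exact: phi_dom_open.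
have Dp : (phi c @` cdom c) (phi c p) by exists p.
have Cl (f : smoothfun C) : Cinfty (phi c @` cdom c) (loc c f).
  exact: (iffLR (smoothP C a0 f) (smooth_smval f)).
have u_lin : linear u.
  move=> k f g; rewrite /u -(tay_scale _ _ _ oD Dp) // -(tay_add _ _ oD Dp) //.
    by apply: (tay_eq _ _ oD Dp) => _ [q cq <-]; rewrite -[RHS]/(k * loc c f _ + loc c g _) !locE.
  by move=> j; apply: (Ck_mul oD (Ck_cst j k oD)); exact: Cl.
pose lin := GRing.isLinear.Build R (smoothfun C) A _ u u_lin.
pose U : {linear smoothfun C -> A} := HB.pack u lin.
have u_mor : monoid_morphism U.
  split=> [|f g]; rewrite /U /= /u.
    rewrite -[RHS]scale1r -(@tay_cst _ _ _ a N 1 (phi c p)) ?(ltnW N1) //.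
    by apply: (tay_eq _ _ oD Dp) => _ [q cq <-]; rewrite locE.
  rewrite -(tay_mul (local_mulrC hA) aI IN oD Dp) //.
  by apply: (tay_eq _ _ oD Dp) => _ [q cq <-]; rewrite -[RHS]/(loc c f _ * loc c g _) !locE.
by exists (Weil u_mor).
Qed.

Lemma tay_weil_base a c p u : C c -> cdom c p -> (forall i, a i \in I) ->
  (forall f, u f = tay a N (loc c f) (phi c p)) -> weil_base zA u p.
Proof.
move=> Cc cp aI uE f; rewrite uE tay_base ?locE ?(ltnW N1) //.
by move=> i; apply/eqP; rewrite -(local_zA_eq0 hA).
Qed.

Lemma chart_coordinate c p i : C c -> cdom c p -> exists X : smoothfun C,
  \forall q \near (p : PC), X q = phi c q 0 i - phi c p 0 i.
Proof.
move=> Cc cp; have oD : open (phi c @` cdom c) by exact: phi_dom_open.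
have CX : Cinfty (phi c @` cdom c) (fun r => r 0 i - phi c p 0 i).
  by move=> k; apply: (Ck_add oD (Cinfty_coord i oD k) (Ck_cst k _ oD)).
have [f sf fX] := germ_extension hC hT Cc cp CX.
by exists (mksmooth sf).
Qed.

Lemma weil_coord_mem u p c i (X : smoothfun C) : weil_base zA u p -> C c -> cdom c p ->
  (\forall q \near (p : PC), X q = phi c q 0 i - phi c p 0 i) -> u X \in I.
Proof.
move=> up Cc cp /nbhs_singleton Xp.
by rewrite (local_zA_eq0 hA) up Xp subrr.
Qed.

(** Let v be the Taylor evaluation with the same a_i. Both agree modulo I, and writing f = f p + sum
    X_i G_i near p gives u f - v f = sum a_i (u G_i - v G_i), which gains one power of I at each
    round. *)
Lemma weil_tay u p c (X : 'I_n -> smoothfun C) : weil_base zA u p -> C c -> cdom c p ->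
  (forall i, \forall q \near (p : PC), X i q = phi c q 0 i - phi c p 0 i) ->
  forall f, u f = tay (fun i => u (X i)) N (loc c f) (phi c p).
Proof.
move=> up Cc cp Xn; pose a i := u (X i).
have aI i : a i \in I by exact: weil_coord_mem (Xn i).
have [v vE] := tay_weil Cc cp aI.
have vp : weil_base zA v p := tay_weil_base Cc cp aI vE.
have vX i : v (X i) = a i.
  rewrite vE (tay_near (F := fun r => r 0 i - phi c p 0 i) a Cc cp) //.
  exact: tay_coord.
suff uvI k f : u f - v f \in (I ^+ k.+1)%VS.
  move=> f; rewrite -vE; apply/eqP; rewrite -subr_eq0 -memv0 -IN.
  by case: N N1 => // N' _; exact: uvI.
elim: k f => [|k IH] f.
  by rewrite expv1 (local_zA_eq0 hA) rmorphB /= up vp subrr.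
have [g sg gE] := hadamard_manifold a0 hC hT Cc cp (smooth_smval f).
pose G i := mksmooth (sg i).
pose H : smoothfun C := mksmooth (smooth_cst (C := C) (f p)) + \sum_i X i * G i.
have fH : \forall q \near (p : PC), f q = H q.
  have Xn' : \forall q \near (p : PC), forall i, X i q = phi c q 0 i - phi c p 0 i.
    exact: (@filter_forall _ _ _ (nbhs (p : PC))).
  apply: (@filterS _ (nbhs (p : PC)) _ _ _ _ (filterI gE Xn')) => q [-> Xq].
  rewrite /H -[RHS]/(f p + smval (\sum_i X i * G i) q); congr (_ + _).
  rewrite (_ : smval _ = \sum_i (smval (X i) * smval (G i))).
    by rewrite fct_sumE; apply: eq_bigr => i _; rewrite -Xq.
  by elim/big_ind2 : _ => // x y z t; rewrite -[smval (y + t)]/(smval y + smval t) => -> ->.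
rewrite (weil_germ up fH) (weil_germ vp fH) /H (linearD (weil_fun u)) (linearD (weil_fun v)).
rewrite !weil_cst opprD addrACA subrr add0r !linear_sum /= -big_split /=; apply: memv_suml => i _.
by rewrite !weilM vX -/(a i) -mulrBr expvSl; apply: memv_mul.
Qed.

End weil_taylor.

(** A chart maps continuously and injectively into a Hausdorff space, so separation can fail only
    for points without a common chart. *)
Lemma chart_separated {R : realType} {V : vectType R} {M : Type} {E : affine V M}
    {P : Type} (C : set (chart E P)) (a0 : M) (hC : smooth_atlas C) c (p q : P) :
  C c -> cdom c p -> cdom c q ->
  cluster (nbhs (p : mspace C)) (q : mspace C) -> p = q.
Proof.
move=> Cc cp cq pq; apply: (phi_inj (a0 := a0) cp cq).
apply: (@norm_hausdorff R 'rV[R]_(\dim {:V})) => X Y Xp Yq.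
have [x [[cx Xx] [_ Yx]]] := pq _ _ (nbhs_phi hC Cc cp Xp) (nbhs_phi hC Cc cq Yq).
by exists (chart_coord a0 c x).
Qed.

(** * The affine space AM *)

Section model.
Context {R : realType} {V : vectType R} {M : Type} (E : affine V M).
Local Notation n := (\dim {:V}).

Lemma model_smooth_atlas : smooth_atlas (model_atlas E).
Proof.
split=> [p|c d -> ->]; first by exists (id_chart E).
rewrite /chart_compatible /= setTI image_id; split.
  by move=> a; rewrite preimage_setT; exact: openT.
exists id => // b l; apply: smooth_on_scalar.
by move=> a; rewrite preimage_setT; exact: openT.
Qed.

Lemma model_hausdorff : hausdorff_space (mspace (model_atlas E)).
Proof.
have [a0] := aff_inhabited E; move=> p q.
exact: (chart_separated a0 model_smooth_atlas (c := id_chart E)).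
Qed.

Lemma model_coordE a0 i (x y : M) : model_coord E (coord (vbasis {:V}) i) x y =
  chart_coord a0 (id_chart E) y 0 i - chart_coord a0 (id_chart E) x 0 i.
Proof.
rewrite /chart_coord !aff_coordE /= (aff_sub_trans E y a0 x) linearD /=; congr (_ + _).
apply/eqP; rewrite -addr_eq0 -linearD /= addrC -aff_sub_trans aff_subxx.
by rewrite linear0.
Qed.

Context {A : falgType R} {I : {vspace A}} {zA : {lrmorphism A -> R^o}}.
Hypothesis hA : local_algebra I zA.
Local Notation AM := (weil A (model_atlas E)).
Local Notation IAV := (tensor (subvs_of I) V).
Implicit Types (u : AM) (x y : M) (t : IAV).

(** On M no cardinality condition enters: the finitely many affine coordinates separate points, so
    the common point of any f with them is always the same x. *)
Lemma model_weil_base u : exists x, weil_base zA u x.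
Proof.
have [a0] := aff_inhabited E.
pose X i := model_coord E (coord (vbasis {:V}) i) a0.
pose x := aff_frame E a0 (\row_i zA (u (X i))); exists x => f.
have [y /= /andP[/eqP fy /allP Xy]] :=
  weil_common_point (zA := zA) u (f :: [seq X i | i : 'I_n]).
suff <- : y = x by rewrite fy.
rewrite -[LHS](aff_coordK E a0); congr (aff_frame E a0 _).
apply/rowP => i; rewrite aff_coordE mxE.
by have /eqP <- := Xy (X i) (codom_f X i).
Qed.

Definition tensor_coord t (i : 'I_n) : A :=
  vsval (t (linfun (coord (vbasis {:V}) i : V -> R^o))).

Lemma tensor_coord_mem t i : tensor_coord t i \in I.
Proof. exact: subvsP. Qed.

Lemma tensor_coord_inj t t' : tensor_coord t =1 tensor_coord t' -> t = t'.
Proof.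
move=> tt'; rewrite (tens_decomp t) (tens_decomp t'); apply: eq_bigr => i _.
by congr (tens _ _); apply: val_inj; exact: tt'.
Qed.

(** Contracting with a linear form l yields u applied to the sum of the l(e_j) x^j, that is to y |->
    l (y - x), where the basis no longer appears. *)
Lemma weil_tensorE (e : n.-tuple V) u x i : basis_of {:V} e ->
  tensor_coord (weil_tensor I e u x) i =
  vsval (vsproj I (u (model_coord E (coord (vbasis {:V}) i) x))).
Proof.
move=> eb; rewrite /tensor_coord /weil_tensor sum_lfunE; congr vsval.
under eq_bigr => j _ do rewrite tensE lfunE /= -!linearZ /=.
rewrite -!linear_sum /=; congr (vsproj I (u _)).
apply: smoothfun_eq => y.
rewrite (_ : smval (\sum_j _) y =
    \sum_(j < n) coord (vbasis {:V}) i e`_j * coord e j (aff_sub E y x)); last first.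
  elim/big_ind2 : _ => // a b c d.
  by rewrite -[smval (b + d) y]/(smval b y + smval d y) => <- <-.
rewrite -[RHS]/(coord (vbasis {:V}) i (aff_sub E y x)).
rewrite [in RHS](coord_basis eb (memvf (aff_sub E y x))) linear_sum.
by apply: eq_bigr => j _; rewrite linearZ /= mulrC.
Qed.

Lemma weil_tensor_basis (e : n.-tuple V) u x : basis_of {:V} e ->
  weil_tensor I e u x = weil_tensor I (vbasis {:V}) u x.
Proof.
move=> eb; apply: tensor_coord_inj => i; rewrite !weil_tensorE //.
exact: vbasisP.
Qed.

Lemma weil_tensor_coord u x i : weil_base zA u x ->
  tensor_coord (weil_tensor I (vbasis {:V}) u x) i =
  u (model_coord E (coord (vbasis {:V}) i) x).
Proof.
move=> ux; rewrite weil_tensorE ?vbasisP // vsprojK //.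
by rewrite (local_zA_eq0 hA) ux /= aff_subxx linear0.
Qed.

Lemma model_weil_tay N a0 u x : (1 < N)%N -> (I ^+ N)%VS = 0%VS ->
  weil_base zA u x -> forall f, u f =
  tay (tensor_coord (weil_tensor I (vbasis {:V}) u x)) N (f \o aff_frame E a0)
      (aff_coord E a0 x).
Proof.
move=> N1 IN ux f.
have Xn i : \forall y \near (x : mspace (model_atlas E)),
    model_coord E (coord (vbasis {:V}) i) x y =
    chart_coord a0 (id_chart E) y 0 i - chart_coord a0 (id_chart E) x 0 i.
  by near=> y; exact: model_coordE.
rewrite (weil_tay hA N1 IN model_smooth_atlas model_hausdorff ux
  (erefl : model_atlas E (id_chart E)) (Logic.I : cdom (id_chart E) x) Xn).
rewrite (_ : (fun i => _) = tensor_coord (weil_tensor I (vbasis {:V}) u x)).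
  apply: (tay_eq _ _ openT) => // r _ /=.
  by rewrite -{1}(aff_frameK E a0 r) -[aff_coord _ _ _]/(chart_coord a0 (id_chart E) _) locE.
by apply/funext => i; rewrite weil_tensor_coord.
Unshelve. all: by end_near.
Qed.

Lemma model_weil_exists x t : exists u,
  weil_base zA u x /\ weil_tensor I (vbasis {:V}) u x = t.
Proof.
have [a0] := aff_inhabited E.
have [N0 IN0] := local_nilpotent hA.
(* The exponent is raised by 2 only to have it exceed 1, so that linear terms survive truncation. *)
have IN : (I ^+ N0.+2)%VS = 0%VS.
  by rewrite -addn2 expvD IN0 prod0v.
have mx : cdom (id_chart E) x by [].
have mC : model_atlas E (id_chart E) by [].
have [u uE] := tay_weil hA (isT : (1 < N0.+2)%N) IN a0 mC mx (tensor_coord_mem t).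
have ux := tay_weil_base hA (isT : (1 < N0.+2)%N) mC mx (tensor_coord_mem t) uE.
exists u; split=> //; apply: tensor_coord_inj => i.
rewrite weil_tensor_coord // uE.
rewrite (tay_near (F := fun r => r 0 i - chart_coord a0 (id_chart E) x 0 i) _ _ mC mx).
  exact: tay_coord.
by near=> y; exact: model_coordE.
Unshelve. all: by end_near.
Qed.

Theorem weil_affine_exists : exists AE : affine (V * IAV)%type AM, weil_affine zA AE.
Proof.
have [x0] := aff_inhabited E.
have [base baseP] := choice model_weil_base.
have etaE (xt : M * IAV) : exists u : AM,
    weil_base zA u xt.1 /\ weil_tensor I (vbasis {:V}) u xt.1 = xt.2.
  exact: model_weil_exists.
have [eta etaP] := choice etaE.
have base_eq u x : weil_base zA u x -> base u = x.
  move=> ux; exact: (weil_base_unique x0 model_smooth_atlas model_hausdorff (baseP u) ux).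
pose theta u := (base u, weil_tensor I (vbasis {:V}) u (base u)).
have etaK : cancel eta theta.
  move=> [x t]; have [ux ut] := etaP (x, t).
  by rewrite /theta (base_eq _ _ ux) ut.
(* By the Taylor formula u is determined by its base point and its tensor. *)
have thetaK : cancel theta eta.
  have [N0 IN0] := local_nilpotent hA.
  have IN : (I ^+ N0.+2)%VS = 0%VS by rewrite -addn2 expvD IN0 prod0v.
  move=> u; apply: weil_ext => f; have [ux ut] := etaP (theta u).
  rewrite (model_weil_tay x0 (isT : (1 < N0.+2)%N) IN ux) ut.
  by rewrite [RHS](model_weil_tay x0 (isT : (1 < N0.+2)%N) IN (baseP u)).
pose add u w := eta (aff_add E (theta u).1 w.1, (theta u).2 + w.2).
pose sub u v := (aff_sub E (theta u).1 (theta v).1, (theta u).2 - (theta v).2).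
have addE u w : theta (add u w) = (aff_add E (theta u).1 w.1, (theta u).2 + w.2).
  by rewrite /add etaK.
have AE_add0 u : add u 0 = u.
  by rewrite /add aff_add0 addr0 thetaK.
have AE_addA u v w : add (add u v) w = add u (v + w).
  by apply: (can_inj thetaK); rewrite !addE /= aff_addA addrA.
have AE_subK u v : add u (sub v u) = v.
  apply: (can_inj thetaK); rewrite addE /= aff_subK.
  by congr pair; exact: subrKC.
have AE_addK u v : sub (add u v) u = v.
  by rewrite /sub addE /= aff_addK (addrC _ v.2) addrK; case: v.
have inh : inhabited AM by constructor; exact: (eta (x0, 0)).
exists (Affine inh AE_add0 AE_addA AE_subK AE_addK); exists theta; split.
- by exists eta.
- exact: baseP.
- by move=> e eb u; rewrite [RHS]weil_tensor_basis.
- exact: addE.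
Qed.

End model.

(** * Base points of homomorphisms *)

(** If Q failed on K, the sets X with Q (K minus X) would form a proper filter, and local validity
    of Q would contradict its cluster point in K. *)
Lemma compact_induction (T : topologicalType) (Q : set T -> Prop) (K : set T) :
  Q set0 -> (forall S S', Q S -> Q S' -> Q (S `|` S')) ->
  (forall S S', S `<=` S' -> Q S' -> Q S) ->
  (forall x, K x -> exists2 U, nbhs x U & Q U) -> compact K -> Q K.
Proof.
move=> Q0 QU QS Qloc cK; apply: contrapT => nQK.
pose F : set_system T := [set X | Q (K `\` X)].
have FF : ProperFilter F.
  split; first by rewrite /F /= setD0.
  split=> [|X Y FX FY|X Y XY FX].
  - by rewrite /F /= setDT.
  - by rewrite /F /= setDIr; exact: QU.
  - by apply: QS FX => x [Kx nYx]; split=> // Xx; apply: nYx; exact: XY.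
have [|x [Kx clx]] := cK F FF; first by rewrite /F /= setDv.
have [U Ux QUU] := Qloc x Kx.
have FU : F (~` U).
  by apply: QS QUU => y [_ /contrapT].
by have [y [nUy Uy]] := clx _ _ FU Ux.
Qed.

Lemma compact_finite_subcover (T : topologicalType) (K : set T) (F : set (set T)) :
  compact K -> F `<=` open -> K `<=` \bigcup_(O in F) O ->
  exists F', [/\ finite_set F', F' `<=` F & K `<=` \bigcup_(O in F') O].
Proof.
move=> cK oF KF.
pose Q S := exists F', [/\ finite_set F', F' `<=` F & S `<=` \bigcup_(O in F') O].
apply: (@compact_induction _ Q K) cK => //.
- by exists set0; split=> //; exact: finite_set0.
- move=> S S' [X [fX XF SX]] [Y [fY YF SY]]; exists (X `|` Y); split.
  + by rewrite finite_setU.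
  + by move=> O [/XF|/YF].
  + by move=> x [/SX|/SY] [ O XO Ox]; exists O => //; [left|right].
- by move=> S S' SS' [X [fX XF SX]]; exists X; split=> //; exact: subset_trans SX.
- move=> x /KF[ O FO Ox]; exists O; first by apply: open_nbhs_nbhs; split=> //; exact: oF.
  by exists [set O]; split=> //; [move=> _ ->|move=> y Oy; exists O].
Qed.

Lemma locally_finite_compact (T : topologicalType) (G : set (set T)) (K : set T) :
  locally_finite G -> compact K -> finite_set (G `&` [set O | O `&` K !=set0]).
Proof.
move=> lfG.
apply: (@compact_induction _ (fun S => finite_set (G `&` [set O | O `&` S !=set0]))).
- by apply: (@sub_finite_set _ _ set0) => // O [_ [x []]].
- move=> S S' fS fS'.
  have fU : finite_set ((G `&` [set O | O `&` S !=set0]) `|`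
      (G `&` [set O | O `&` S' !=set0])) by rewrite finite_setU.
  apply: (sub_finite_set _ fU) => O [GO [x [Ox [Sx|S'x]]]]; [left|right]; split=> //;
    by exists x.
- move=> S S' SS'; apply: sub_finite_set => O [GO [x [Ox /SS' S'x]]].
  by split=> //; exists x.
- by move=> x _; exact: lfG.
Qed.

(** * Chain classes of a locally finite cover by relatively compact open sets *)

Section chains.
Context {T : topologicalType} (G : set (set T)).
Hypotheses (oG : G `<=` open) (covG : \bigcup_(O in G) O = setT)
  (kG : forall O, G O -> exists2 K, compact K & O `<=` K) (lfG : locally_finite G).
Implicit Types (p q x y : T) (k : nat).

(** The star of S with respect to the cover G. *)
Definition chain_step (S : set T) := \bigcup_(O in G `&` [set O | O `&` S !=set0]) O.

Definition chain k p : set T := iter k chain_step [set p].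

Definition chain_class p := \bigcup_k chain k p.

Lemma chain_covered x : exists2 O, G O & O x.
Proof. by have : setT x by []; rewrite -covG => -[ O GO Ox]; exists O. Qed.

Lemma chain_step_open S : open (chain_step S).
Proof. by apply: bigcup_open => O [/oG]. Qed.

Lemma chain_stepW S S' : S `<=` S' -> chain_step S `<=` chain_step S'.
Proof.
move=> SS' x [ O [GO [y [Oy /SS' S'y]]] Ox]; exists O => //; split=> //.
by exists y.
Qed.

Lemma closure_chain_step S : closure S `<=` chain_step S.
Proof.
move=> x Sx; have [ O GO Ox] := chain_covered x.
have [y [Sy Oy]] := Sx O (open_nbhs_nbhs (conj (oG GO) Ox)).
by exists O => //; split=> //; exists y.
Qed.

Lemma chain_le j k p : (j <= k)%N -> chain j p `<=` chain k p.
Proof.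
move=> /subnK <-; elim: (k - j)%N => [//|d IH]; rewrite addSn.
by apply: (subset_trans IH) => x Sx; apply/closure_chain_step/subset_closure.
Qed.

(** By local finiteness a compact set meets only finitely many members of G, and each of them lies
    in a compact set. *)
Lemma chain_compact k p : exists2 K, compact K & chain k p `<=` K.
Proof.
elim: k => [|k [K cK kK]]; first by exists [set p] => //; exact: compact_set1.
have fin := locally_finite_compact lfG cK.
pose F := G `&` [set O | O `&` K !=set0].
have /choice[L LP] : forall O, exists L, G O -> compact L /\ O `<=` L.
  move=> O; have [GO|nGO] := pselect (G O); last by exists set0.
  by have [L cL OL] := kG GO; exists L.
exists (\bigcup_(O in F) L O).
  rewrite -(@bigsetU_fset_set _ _ F L fin); rewrite big_seq_cond.
  apply: bigsetU_compact => O; rewrite andbT in_fset_set // inE => -[GO _].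
  by have [] := LP O GO.
apply: (subset_trans (chain_stepW kK)) => x [ O FO Ox]; exists O => //.
by have [_] := LP O FO.1; exact.
Qed.

Lemma chain_class_refl p : chain_class p p.
Proof. by exists 0%N. Qed.

(** A positive index is wanted because [chain 0 p] is a single point, whereas the later chains are
    open. *)
Lemma chain_classE p x : chain_class p x -> exists k, chain k.+1 p x.
Proof. by move=> [k _ kx]; exists k; apply: chain_le kx. Qed.

Lemma chain_class_step p O x y : chain_class p x -> G O -> O x -> O y ->
  chain_class p y.
Proof.
move=> [k _ kx] GO Ox Oy; exists k.+1 => //; exists O => //; split=> //.
by exists x.
Qed.

Lemma chain_class_trans p x y : chain_class p x -> chain_class x y -> chain_class p y.
Proof.
move=> px [k _]; elim: k y => [|k IH] y; first by move=> ->.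
by move=> [ O [GO [z [Oz /IH pz]]] Oy]; exact: chain_class_step pz GO Oz Oy.
Qed.

Lemma chain_class_sym p x : chain_class p x -> chain_class x p.
Proof.
move=> [k _]; elim: k x => [|k IH] x; first by move=> ->; exact: chain_class_refl.
move=> [ O [GO [z [Oz /IH zp]]] Ox]; apply: chain_class_trans zp.
exact: chain_class_step (chain_class_refl x) GO Ox Oz.
Qed.

Lemma chain_class_eq p x : chain_class p x -> chain_class x = chain_class p.
Proof.
move=> px; apply/seteqP; split=> y; first exact: chain_class_trans.
by apply: chain_class_trans; exact: chain_class_sym.
Qed.

Lemma chain_class_open p : open (chain_class p).
Proof.
rewrite (_ : chain_class p = \bigcup_k chain k.+1 p).
  by apply: bigcup_open => k _; exact: chain_step_open.
apply/seteqP; split=> x; last by move=> [k _ kx]; exists k.+1.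
by move=> /chain_classE[k kx]; exists k.
Qed.

End chains.

(** * Existence of base points *)

Section base_points.
Context {R : realType} {V : vectType R} {M : Type} {E : affine V M} {P : Type}.
Variables (C : set (chart E P)) (a0 : M).
Hypotheses (hC : smooth_atlas C) (hP : paracompact (mspace C)).
Local Notation n := (\dim {:V}).
Local Notation PC := (mspace C).
Local Notation phi := (chart_coord a0).
Implicit Types (p q : P) (f : P -> R).

Let hT : hausdorff_space PC. Proof. by case: hP. Qed.

Lemma chart_compact_cover : exists G : set (set PC), [/\ G `<=` open,
  \bigcup_(O in G) O = setT,
  forall O, G O -> exists K c, [/\ compact K, O `<=` K, C c & K `<=` cdom c] &
  locally_finite G].
Proof.
pose F : set (set PC) := [set O | open O /\
  exists K c, [/\ compact (K : set PC), O `<=` K, C c & K `<=` cdom c]].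
have [||G [Go Gc GF Glf]] := hP.2 F; first by move=> O [].
  apply/seteqP; split=> // p _; have [c Cc cp] := hC.1 p.
  have [e e0 eD] := chart_ball a0 Cc cp (filterT : nbhs (p : PC) setT).
  have [cK _] := chart_ball_sub Cc eD.
  exists [set q | cdom c q /\ `|phi c q - phi c p| < e]; last first.
    by split=> //; rewrite subrr normr0.
  split; last first.
    exists [set q | cdom c q /\ `|phi c q - phi c p| <= e], c; split=> //.
      by move=> q [cq /ltW].
    by move=> q [].
  apply: (@phi_preimage_open _ _ _ _ _ C a0 hC c _ (ball (phi c p) e) Cc).
    exact: (@ball_open _ 'rV[R]_n).
  by rewrite -ball_normE; apply/seteqP; split=> q /= [cq]; rewrite distrC.
exists G; split=> // O /GF[ O' [_ [K [c [cK O'K Cc Kc]]]] OO'].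
by exists K, c; split=> //; exact: subset_trans O'K.
Qed.

(** Built from functions 1 - b with b a bump; they are multiplied, since a product vanishes on the
    union of the zero sets and stays 1 off O. *)
Lemma smooth_cutoff (K O : set PC) : compact K -> open O -> K `<=` O ->
  exists f, [/\ smooth C f, forall q, 0 <= f q, forall q, K q -> f q = 0 &
    forall q, ~ O q -> f q = 1].
Proof.
move=> cK oO KO; pose Q (S : set PC) := exists f, [/\ smooth C f,
  forall q, 0 <= f q, forall q, S q -> f q = 0 & forall q, ~ O q -> f q = 1].
apply: (@compact_induction _ Q K) cK.
- by exists (cst 1); split=> //; exact: smooth_cst.
- move=> S S' [f [sf f0 fS fO]] [g [sg g0 gS' gO]]; exists (f * g); split.
  + exact: smooth_mul.
  + by move=> q; rewrite mulr_ge0.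
  + move=> q; rewrite -[(f * g) q]/(f q * g q).
    by case=> [/fS ->|/gS' ->]; rewrite ?mul0r ?mulr0.
  + by move=> q nO; rewrite -[LHS]/(f q * g q) fO // gO // mulr1.
- move=> S S' SS' [f [sf f0 fS fO]]; exists f; split=> // q /SS'.
  exact: fS.
- move=> p /KO Op.
  have [b [K' [sb b01 _ K'O [b1 b0]]]] :=
    smooth_bump a0 hC hT (open_nbhs_nbhs (conj oO Op)).
  exists [set q | b q = 1] => //; exists (fun q => 1 - b q); split.
  + exact: (smooth_sub (smooth_cst (C := C) 1) sb).
  + by move=> q; rewrite subr_ge0; have /andP[] := b01 q.
  + by move=> q /= ->; rewrite subrr.
  + by move=> q nO; rewrite b0 ?subr0 // => /K'O.
Qed.

Context {A : falgType R} (zA : {lrmorphism A -> R^o}).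
Hypothesis hcard : nonmeasurable P.

Section exhaustion.
Variable G : set (set PC).
Hypotheses (oG : G `<=` open) (covG : \bigcup_(O in G) O = setT)
  (kG : forall O, G O -> exists2 K, compact K & O `<=` K) (lfG : locally_finite G).
Local Notation Q := (chain_class G).

(** f is the sum of cutoffs psi_k that are 0 on the k-th chain and 1 off the next one. Off the k-th
    chain the first k summands are all 1; outside the class of z, f is set to 0. *)
Lemma exhaustion_function (z : PC) : exists2 f, smooth C f &
  forall k q, Q z q -> ~ chain G k z q -> k%:R <= f q.
Proof.
have psiE k : exists f, [/\ smooth C f, forall q, 0 <= f q,
    forall q, chain G k z q -> f q = 0 & forall q, ~ chain G k.+1 z q -> f q = 1].
  have [K cK kK] := chain_compact kG lfG k z.
  have cl : compact (closure (chain G k z)).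
    have clK : closed (K : set PC) := compact_closed hT cK.
    apply: (subclosed_compact (@closed_closure _ _) cK).
    by rewrite (iffLR (closure_id K) clK); exact: closure_subset.
  have [f [sf f0 fk fS]] := smooth_cutoff cl (chain_step_open oG (chain G k z))
    (@closure_chain_step _ _ oG covG _).
  by exists f; split=> // q kq; apply: fk; exact: subset_closure.
have [psi psiP] := choice psiE.
pose S m q := \sum_(k < m) psi k q.
have psi_ge0 k q : 0 <= psi k q by have [_ + _ _] := psiP k; exact.
have S_le j m q : (j <= m)%N -> S j q <= S m q.
  move=> /subnK <-; rewrite addnC /S big_split_ord /= lerDl.
  by apply: sumr_ge0 => i _.
(* On the m-th chain all cutoffs of index at least m vanish, so the infinite sum is locally a finite
   one. *)
have S_stable m m' q : (m <= m')%N -> chain G m z q -> S m' q = S m q.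
  move=> /subnK <- mq; rewrite addnC /S big_split_ord /= [X in _ + X]big1 ?addr0 //.
  move=> i _; have [_ _ + _] := psiP (m + i)%N; apply.
  by apply: (chain_le oG covG _ mq); exact: leq_addr.
have fE q : exists y : R, (forall m, chain G m z q -> y = S m q) /\ (~ Q z q -> y = 0).
  have [[m _ mq]|nq] := pselect (Q z q); last first.
    by exists 0; split=> // m mq; case: nq; exists m.
  exists (S m q); split=> [m' m'q|nq]; last by case: nq; exists m.
  have [mm'|/ltnW m'm] := leqP m m'; first by rewrite (S_stable _ _ _ mm' mq).
  by rewrite (S_stable _ _ _ m'm m'q).
have [f fP] := choice fE; exists f.
  apply: (smooth_glue (a0 := a0)) => p.
  have [/(chain_classE oG covG)[k kp]|np] := pselect (Q z p).
    exists (chain G k.+1 z), (S k.+1); split=> //.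
    - exact: chain_step_open.
    - apply: smooth_near_smooth; apply: (smooth_sum (C := C)) => i.
      by have [] := psiP i.
    - by move=> q kq; have [+ _] := fP q; exact.
  exists (Q p), (cst 0); split.
  - exact: chain_class_open.
  - exact: chain_class_refl.
  - by apply: smooth_near_smooth; exact: smooth_cst.
  - move=> q pq; have [_ ->] := fP q => // zq; apply: np.
    exact: chain_class_trans zq (chain_class_sym pq).
move=> k q [m _ mq] nk; have [/(_ m mq) -> _] := fP q.
have km : (k <= m)%N.
  by rewrite leqNgt; apply/negP => /ltnW mk; apply: nk; exact: (chain_le oG covG mk).
apply: (le_trans _ (S_le _ _ q km)).
rewrite -[k%:R]mulr_natl mulr1 /S -[X in X%:R]card_ord -sumr_const.
apply: ler_sum => i _; have [_ _ _ ->] := psiP i => // iq; apply: nk.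
by apply: (chain_le oG covG _ iq); exact: ltn_ord.
Qed.

(** The choice function is applied to the set [Q p] and not to p, so that equal classes share a
    representative. *)
Lemma chain_class_rep : exists rep : P -> P,
  (forall p, Q p (rep p)) /\ forall p q, Q p q -> rep q = rep p.
Proof.
have [p0|noP] := pselect (exists p : P, True); last first.
  by exists id; split=> p; case: noP; exists p.
have chE (S : set PC) : exists p : PC, S !=set0 -> S p.
  have [[p Sp]|nS] := pselect (S !=set0); first by exists p.
  by case: p0 => p _; exists p.
have [ch chP] := choice chE.
exists (fun p => ch (Q p)); split.
  by move=> p; apply: chP; exists p; exact: chain_class_refl.
by move=> p q pq; rewrite (chain_class_eq pq).
Qed.

Lemma class_function_smooth (rep : P -> P) f : (forall p q, Q p q -> rep q = rep p) ->
  smooth C (f \o rep).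
Proof.
move=> repE; apply: (smooth_glue (a0 := a0)) => p.
exists (Q p), (cst (f (rep p))); split.
- exact: chain_class_open.
- exact: chain_class_refl.
- by apply: smooth_near_smooth; exact: smooth_cst.
- by move=> q pq /=; rewrite (repE p q).
Qed.

(* The sets X such that u maps the indicator of the union of the classes
   represented in X to 1 modulo I form a countably complete ultrafilter. *)
Lemma weil_class_concentrated (u : weil A C) (rep : P -> P) :
  (forall p q, Q p q -> rep q = rep p) ->
  exists p0, forall e : smoothfun C,
    (forall q, e q = if `[< rep q = p0 >] then 1 else 0) -> zA (u e) = 1.
Proof.
move=> repE.
pose ind (X : set P) p : R := if `[< X p >] then 1 else 0.
have ind1 X p : ind X p = 1 -> X p.
  rewrite /ind; case: asboolP => // _ /eqP.
  by rewrite eq_sym oner_eq0.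
have ind1P (X : set P) p : X p -> ind X p = 1 by move=> Xp; rewrite /ind asboolT.
pose e X : smoothfun C := mksmooth (class_function_smooth (ind X) repE).
pose F : set_system P := [set X | zA (u (e X)) = 1].
(* Each filter law is read off at one common point of the indicators involved, where their values
   are those of zA after u. *)
have FI X Y : F X -> F Y -> F (X `&` Y).
  move=> FX FY; have [p /= /and4P[/eqP Xp /eqP Yp /eqP XYp _]] :=
    weil_common_point (zA := zA) u [:: e X; e Y; e (X `&` Y)].
  apply: (etrans (esym XYp)); apply: ind1P.
  by split; apply: ind1; [exact: etrans Xp FX|exact: etrans Yp FY].
have FT : F setT.
  have [p /= /andP[/eqP Tp _]] := weil_common_point (zA := zA) u [:: e setT].
  by apply: (etrans (esym Tp)); exact: ind1P.
have FS X Y : X `<=` Y -> F X -> F Y.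
  move=> XY FX; have [p /= /and3P[/eqP Xp /eqP Yp _]] :=
    weil_common_point (zA := zA) u [:: e X; e Y].
  by apply: (etrans (esym Yp)); apply: ind1P; apply: XY; apply: ind1;
  exact: etrans Xp FX.
have F0 : ~ F set0.
  move=> F0; have [p /= /andP[/eqP p0 _]] :=
    weil_common_point (zA := zA) u [:: e set0].
  exact: (ind1 _ _ (etrans p0 F0)).
have FC X : F X \/ F (~` X).
  have [p /= /and3P[/eqP Xp /eqP nXp _]] :=
    weil_common_point (zA := zA) u [:: e X; e (~` X)].
  have [Xrp|nXrp] := pselect (X (rep p)); [left|right].
    by apply: (etrans (esym Xp)); exact: ind1P.
  by apply: (etrans (esym nXp)); exact: ind1P.
have FF : ProperFilter F by split=> //; split.
have FU : UltraFilter F.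
  apply: Build_UltraFilter => // H HF FH; apply/seteqP; split=> X; last exact: FH.
  move=> HX; have [//|/FH HnX] := FC X.
  by case: (@filter_not_empty _ H HF); rewrite -(setICr X); exact: filterI.
have [S FSn|p0 Fp0] := hcard FU; last first.
  exists p0 => e' e'E; apply: etrans Fp0; congr (zA (u _)).
  by apply: smoothfun_eq => q; rewrite e'E.
apply: contrapT => FnS.
have FY : F (~` \bigcap_k S k) by case: (FC (\bigcap_k S k)).
(* [idx p] names a set of the sequence that misses p. Composed with [rep] it is locally constant,
   hence a smooth function to which u applies. *)
have idxE p : exists k, (~` \bigcap_k S k) p -> ~ S k p.
  have [H|nH] := pselect (exists k, ~ S k p); first by case: H => k nk; exists k.
  exists 0%N => np; exfalso; apply: np => k _.
  by apply: contrapT => nk; apply: nH; exists k.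
have [idx idxP] := choice idxE.
pose f : smoothfun C := mksmooth (class_function_smooth (fun p => (idx p)%:R : R) repE).
pose N := Num.truncn (zA (u f)).
have FSN : F (\bigcap_(k < N.+1) S k).
  elim: (N.+1) => [|m IH]; first by rewrite bigcap_mkord big_ord0.
  rewrite bigcap_mkord big_ord_recr /= -bigcap_mkord; exact: FI.
(* At the common point [idx (rep p)] equals zA (u f), hence N. So [rep p] lies outside [S N], yet in
   the intersection of S 0, ..., S N. *)
have [p /= /and4P[/eqP fp /eqP Yp /eqP SNp _]] := weil_common_point (zA := zA) u
  [:: f; e (~` \bigcap_k S k); e (\bigcap_(k < N.+1) S k)].
apply: (idxP _ (ind1 _ _ (etrans Yp FY))).
apply: (ind1 _ _ (etrans SNp FSN)) => /=.
by rewrite ltnS /N -fp /= natrK.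
Qed.

End exhaustion.

(** With e and f in the list, a common point is confined to a compact set K. If no point were a base
    point, squares of kernel elements would add up to a kernel element positive on K, which has no
    common point with e and f. *)
Theorem weil_base_exists (u : weil A C) : exists p, weil_base zA u p.
Proof.
have [G [ oG covG kcG lfG]] := chart_compact_cover.
have kG O : G O -> exists2 K, compact K & O `<=` K.
  by move=> /kcG[K [c [cK OK _ _]]]; exists K.
have [rep [repQ repE]] := chain_class_rep G.
have [p0 up0] := weil_class_concentrated oG covG u repE.
pose e : smoothfun C := mksmooth (class_function_smooth oG covG
  (fun p => if `[< p = p0 >] then 1 else 0 : R) repE).
have ue : zA (u e) = 1 by exact: up0.
have [z /= /andP[/eqP ez _]] := weil_common_point (zA := zA) u [:: e].
have e1 q : e q = 1 -> rep q = p0.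
  rewrite /e /=; case: asboolP => // _ /eqP.
  by rewrite eq_sym oner_eq0.
have eQ q : e q = 1 -> chain_class G z q.
  move=> eq1; have rzq : rep z = rep q by rewrite (e1 z (etrans ez ue)) (e1 q eq1).
  apply: chain_class_trans (repQ z) _; rewrite rzq.
  by apply: chain_class_sym; exact: repQ.
have [f sf fP] := exhaustion_function oG covG kG lfG z.
(* N exceeds zA (u f), so f takes this value at no point of the class off the N-th chain. *)
pose N := (Num.truncn (zA (u (mksmooth sf)))).+1.
have [K cK NK] := chain_compact kG lfG N z.
apply: contrapT => nb.
(* Nonnegativity everywhere keeps this property stable under unions, by addition. *)
pose T (S : set PC) := exists g : smoothfun C,
  [/\ zA (u g) = 0, forall q, 0 <= g q & forall q, S q -> 0 < g q].
have : T K.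
  apply: (@compact_induction _ T K) cK.
  - by exists 0; split=> //; rewrite linear0 rmorph0.
  - move=> S S' [g [ug g0 gS]] [g' [ug' g'0 g'S']]; exists (g + g'); split.
    + by rewrite linearD rmorphD /= ug ug' addr0.
    + by move=> q; exact: addr_ge0 (g0 q) (g'0 q).
    + move=> q; rewrite -[smval (g + g') q]/(g q + g' q).
      by case=> [/gS|/g'S'] ?; [exact: ltr_wpDr|exact: ltr_wpDl].
  - by move=> S S' SS' [g [ug g0 gS]]; exists g; split=> // q /SS'; exact: gS.
  - move=> q _; have /existsNP[g /eqP gq] : ~ weil_base zA u q.
      by move=> uq; apply: nb; exists q.
    pose k : smoothfun C := g - (zA (u g) : R) *: (1 : smoothfun C).
    have kE r : k r = g r - zA (u g) by rewrite -[LHS]/(g r - zA (u g) * 1) mulr1.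
    have kq : k q != 0 by rewrite kE subr_eq0 eq_sym.
    have uk : zA (u k) = 0.
      rewrite /k linearB linearZ weil1 rmorphB /= linearZ rmorph1 /=.
      by rewrite /GRing.scale /= mulr1; exact: subrr.
    have ck : {for (q : PC), continuous (k : PC -> R)} by exact: (smooth_continuous a0 hC (smooth_smval k)).
    exists [set r | k r != 0].
      have := open_nbhs_nbhs (conj (@open_neq _ 0) kq).
      exact: ck.
    exists (k * k); split.
    + by rewrite weilM rmorphM /= uk mul0r.
    + by move=> r; change (0 <= k r * k r); rewrite -expr2 sqr_ge0.
    + move=> r kr; change (0 < k r * k r); rewrite -expr2.
      by rewrite exprn_even_gt0.
move=> [g [ug _ gK]].
have [q /= /and4P[/eqP fq /eqP eq1 /eqP gq _]] :=
  weil_common_point (zA := zA) u [:: mksmooth sf; e; g].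
have zq : chain_class G z q by apply: eQ; exact: etrans eq1 ue.
have [Nq|/(fP N q zq)] := pselect (chain G N z q).
  by have := gK q (NK q Nq); rewrite gq ug ltxx.
rewrite fq leNgt => /negP; apply.
by rewrite /N; exact: truncnS_gt.
Qed.

End base_points.

Lemma scalar_of_linear {R : realType} {U : lmodType R} (f : U -> R) :
  linear (f : U -> R^o) -> exists l : {scalar U}, forall x, l x = f x.
Proof.
move=> f_lin; pose lin := GRing.isLinear.Build R U R^o _ f f_lin.
by pose F : {linear U -> R^o} := HB.pack f lin; exists F.
Qed.

(** * Charts of AP and their transition maps *)

Section weil_model_frames.
Context {R : realType} {A : falgType R} {I : {vspace A}} {zA : {lrmorphism A -> R^o}}.
Hypothesis hA : local_algebra I zA.
Variable N : nat.
Hypotheses (N1 : (1 < N)%N) (IN : (I ^+ N)%VS = 0%VS).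
Context {V : vectType R} {M : Type} {E : affine V M}.
Local Notation AM := (weil A (model_atlas E)).
Local Notation IAV := (tensor (subvs_of I) V).
Variables (AE : affine (V * IAV)%type AM) (theta : AM -> M * IAV).
Hypotheses (theta_base : forall u, weil_base zA u (theta u).1)
  (theta_tensor : forall u, (theta u).2 = weil_tensor I (vbasis {:V}) u (theta u).1)
  (theta_add : forall u w, theta (aff_add AE u w) =
    (aff_add E (theta u).1 w.1, (theta u).2 + w.2)).
Variables (a0 : M) (b0 : AM).
Local Notation n := (\dim {:V}).
Local Notation m := (\dim {: (V * IAV)%type}).
Local Notation fr := (aff_frame AE b0).

Definition weil_point (s : 'rV[R]_m) : 'rV[R]_n := aff_coord E a0 (theta (fr s)).1.

Definition weil_dir (s : 'rV[R]_m) : 'I_n -> A := tensor_coord (theta (fr s)).2.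

Lemma theta_sub u v : aff_sub AE u v =
  (aff_sub E (theta u).1 (theta v).1, (theta u).2 - (theta v).2).
Proof.
have := theta_add v (aff_sub AE u v); rewrite aff_subK => ->.
by rewrite /= aff_addK addrC addKr -surjective_pairing.
Qed.

Lemma model_weil_theta (u : AM) f : u f =
  tay (tensor_coord (theta u).2) N (f \o aff_frame E a0) (aff_coord E a0 (theta u).1).
Proof.
rewrite theta_tensor; exact: (model_weil_tay hA a0 N1 IN (theta_base u)).
Qed.

(** The base point depends on the frame coordinates by an affine map, because theta respects the
    affine structures. *)
Lemma weil_point_Cinfty W i : Cinfty W (fun s => weil_point s 0 i).
Proof.
have [l lE] : exists l : {scalar (V * IAV)%type}, forall w, l w = coord (vbasis {:V}) i w.1.
  by apply: scalar_of_linear => k w w'; rewrite linearP.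
move=> k; apply: (@Ck_subset _ _ _ setT) => //.
have := Ck_add openT (Cinfty_frame_scalar AE l b0 b0 setT k)
  (Ck_cst k (coord (vbasis {:V}) i (aff_sub E (theta b0).1 a0)) openT).
apply: Ck_ext; [exact: openT|move=> s _].
rewrite /weil_point aff_coordE [in RHS](aff_sub_trans E _ (theta b0).1 a0).
rewrite [RHS]linearD /=.
by rewrite -[LHS]/(l (aff_sub AE (fr s) b0) + _) lE theta_sub.
Qed.

Lemma weil_point_continuous : continuous weil_point.
Proof.
move=> s; apply: rV_continuous => j.
by apply: (Ck_cont (@weil_point_Cinfty setT j 0%N)).
Qed.

Lemma weil_tensor_Cinfty (l : IAV -> R) W : linear (l : IAV -> R^o) ->
  Cinfty W (fun s => l (theta (fr s)).2).
Proof.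
move=> l_lin; have [l' l'E] : exists l' : {scalar (V * IAV)%type}, forall w, l' w = l w.2.
  by apply: scalar_of_linear => k w w'; exact: l_lin.
have lD t t' : l (t + t') = l t + l t'.
  by have := l_lin 1 t t'; rewrite !scale1r.
move=> k; apply: (@Ck_subset _ _ _ setT) => //.
have := Ck_add openT (Cinfty_frame_scalar AE l' b0 b0 setT k)
  (Ck_cst k (l (theta b0).2) openT).
apply: Ck_ext; [exact: openT|move=> s _].
by rewrite -[LHS]/(l' (aff_sub AE (fr s) b0) + l _) l'E theta_sub /= -lD subrK.
Qed.

Lemma weil_point_comp W (F : 'rV[R]_n -> R) : open W -> Cinfty W F ->
  Cinfty (weil_point @^-1` W) (F \o weil_point).
Proof.
move=> oW CF k; apply: (Ck_comp _ oW _ _ (CF k)) => //.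
  by apply: open_comp => // s _; exact: weil_point_continuous.
by move=> j; exact: weil_point_Cinfty.
Qed.

(** The induction is over all linear forms l: expanding a_i in a basis b_h of A gives l (a_i x) =
    sum coord_h(a_i) l (b_h x), where coord_h(a_i) is affine in s and l (b_h * _) is again
    linear. *)
Lemma tayS_Cinfty W k (l : A -> R) F : open W -> linear (l : A -> R^o) ->
  Cinfty W F ->
  Cinfty (weil_point @^-1` W) (fun s => l (tayS (weil_dir s) k F (weil_point s))).
Proof.
move=> oW; have oW' : open (weil_point @^-1` W).
  by apply: open_comp => // s _; exact: weil_point_continuous.
elim: k l F => [|k IH] l F l_lin CF j.
  have [l' l'E] := scalar_of_linear l_lin.
  apply: (Ck_ext oW' _ (Ck_mul oW' (weil_point_comp oW CF j) (Ck_cst j (l 1) oW'))) => s _.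
  by rewrite /= -!l'E linearZ.
have [l' l'E] := scalar_of_linear l_lin.
pose b := vbasis {:A}.
have -> : (fun s => l (tayS (weil_dir s) k.+1 F (weil_point s))) =
  (fun s => k.+1%:R^-1 * \sum_i \sum_(h < \dim {:A})
     (coord b h (weil_dir s i) *
      l (b`_h * tayS (weil_dir s) k ('D_(delta_mx 0 i) F) (weil_point s)))).
  apply/funext => s; rewrite tayS_succ -l'E linearZ /= linear_sum; congr (_ * _).
  apply: eq_bigr => i _; rewrite {1}(coord_vbasis (memvf (weil_dir s i))) mulr_suml.
  by rewrite linear_sum; apply: eq_bigr => h _; rewrite -scalerAl linearZ /= l'E.
apply: (Ck_mul oW' (Ck_cst j _ oW')); apply: Ck_sum => // i _.
apply: Ck_sum => // h _; apply: (Ck_mul oW').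
  apply: (@weil_tensor_Cinfty (fun t => coord b h (tensor_coord t i))) => c t t'.
  by rewrite /tensor_coord add_lfunE scale_lfunE vsval_is_linear linearP.
apply: (IH (fun x => l (b`_h * x))).
  by move=> c x y; rewrite mulrDr -scalerAr; exact: l_lin.
by move=> j'; have [_ [_ D]] := CF j'.+1; exact: D.
Qed.

Lemma tay_Cinfty W (l : A -> R) F : open W -> linear (l : A -> R^o) -> Cinfty W F ->
  Cinfty (weil_point @^-1` W) (fun s => l (tay (weil_dir s) N F (weil_point s))).
Proof.
move=> oW l_lin CF j; have [l' l'E] := scalar_of_linear l_lin.
have -> : (fun s => l (tay (weil_dir s) N F (weil_point s))) =
    fun s => \sum_(k < N) l (tayS (weil_dir s) k F (weil_point s)).
  by apply/funext => s; rewrite -l'E linear_sum; apply: eq_bigr => k _; rewrite l'E.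
apply: Ck_sum => [|k _]; last exact: tayS_Cinfty.
by apply: open_comp => // s _; exact: weil_point_continuous.
Qed.

Lemma theta_fst_open (O : set M) : aff_open E O ->
  aff_open AE [set u | O (theta u).1].
Proof.
move=> oO; apply/(aff_openP AE b0).
rewrite (_ : _ @^-1` _ = weil_point @^-1` (aff_frame E a0 @^-1` O)).
  by apply: open_comp => [s _|]; [exact: weil_point_continuous|exact: oO].
by apply/seteqP; split=> s /=; rewrite /weil_point aff_coordK.
Qed.

End weil_model_frames.

(** * Existence, uniqueness and images of the charts Ac *)

Section prolonged_charts.
Context {R : realType} {A : falgType R} {I : {vspace A}} {zA : {lrmorphism A -> R^o}}.
Hypothesis hA : local_algebra I zA.
Variable N : nat.
Hypotheses (N1 : (1 < N)%N) (IN : (I ^+ N)%VS = 0%VS).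
Context {V : vectType R} {M : Type} {E : affine V M}.
Local Notation AM := (weil A (model_atlas E)).
Local Notation IAV := (tensor (subvs_of I) V).
Variables (AE : affine (V * IAV)%type AM) (theta : AM -> M * IAV).
Hypotheses (theta_bij : bijective theta)
  (theta_base : forall u, weil_base zA u (theta u).1)
  (theta_tensor : forall u, (theta u).2 = weil_tensor I (vbasis {:V}) u (theta u).1)
  (theta_add : forall u w, theta (aff_add AE u w) =
    (aff_add E (theta u).1 w.1, (theta u).2 + w.2)).
Variables (a0 : M) (b0 : AM).
Context {P : Type}.
Variable C : set (chart E P).
Hypotheses (hC : smooth_atlas C) (hT : hausdorff_space (mspace C)).
Local Notation n := (\dim {:V}).
Local Notation AP := (weil A C).
Local Notation PC := (mspace C).
Local Notation phi := (chart_coord a0).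
Local Notation loc := (loc a0).
Local Notation idc := (id_chart E).
Implicit Types (u v : AP) (w : AM) (c : chart E P) (d : chart AE AP) (p q : P)
  (a : 'I_n -> A).

(* The points u of AP and w of AM correspond to each other in the chart Ac:
   they have the same Taylor expansion, in the coordinates of c. *)
Definition taylor_related c u w p a :=
  [/\ cdom c p, forall i, a i \in I,
      forall f, u f = tay a N (loc c f) (phi c p) &
      forall g, w g = tay a N (loc idc g) (phi c p)].

Lemma related_bases c u w p a : C c -> taylor_related c u w p a ->
  weil_base zA u p /\ weil_base zA w (cmap c p).
Proof.
move=> Cc [cp aI uE wE]; split; first exact: (tay_weil_base hA N1 Cc cp aI uE).
exact: (tay_weil_base hA N1 (erefl : model_atlas E idc) Logic.I aI wE).
Qed.

Lemma model_base_theta w x : weil_base zA w x -> (theta w).1 = x.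
Proof.
move=> wx.
exact: (weil_base_unique a0 (model_smooth_atlas E) (@model_hausdorff _ _ _ E)
  (theta_base w) wx).
Qed.

Lemma related_theta c u w p a : C c -> taylor_related c u w p a ->
  (theta w).1 = cmap c p /\ tensor_coord (theta w).2 =1 a.
Proof.
move=> Cc cuw; have [_ wp] := related_bases Cc cuw.
have tw := model_base_theta wp; split=> // i; case: cuw => cp aI uE wE.
rewrite theta_tensor tw (weil_tensor_coord hA) // wE.
rewrite -[phi c p]/(phi idc (cmap c p)).
rewrite (tay_near (F := fun r => r 0 i - phi idc (cmap c p) 0 i) _ _
  (erefl : model_atlas E idc)) //; first exact: tay_coord.
by near=> y; exact: model_coordE.
Unshelve. all: by end_near.
Qed.

Lemma theta_ext w w' : (theta w).1 = (theta w').1 ->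
  tensor_coord (theta w).2 =1 tensor_coord (theta w').2 -> w = w'.
Proof.
move=> w1 w2; apply: (bij_inj theta_bij).
rewrite [LHS]surjective_pairing [RHS]surjective_pairing w1; congr pair.
exact: tensor_coord_inj.
Qed.

Lemma model_taylor w : forall g, w g =
  tay (tensor_coord (theta w).2) N (loc idc g) (phi idc (theta w).1).
Proof.
move=> g; rewrite (model_weil_theta hA N1 IN theta_base theta_tensor a0).
apply: (tay_eq _ _ openT) => // r _ /=.
by rewrite -[in RHS](aff_frameK E a0 r) -[aff_coord _ _ _]/(phi idc _) locE.
Qed.

Lemma related_exists c u p : C c -> cdom c p -> weil_base zA u p ->
  exists w a, taylor_related c u w p a.
Proof.
move=> Cc cp up.
have /choice[X XE] i := chart_coordinate a0 hC hT i Cc cp.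
have uE := weil_tay hA N1 IN hC hT up Cc cp XE.
have aI i : u (X i) \in I by exact: (weil_coord_mem hA up Cc cp (XE i)).
have [w wE] := tay_weil hA N1 IN a0 (erefl : model_atlas E idc)
  (Logic.I : cdom idc (cmap c p)) aI.
by exists w, (fun i => u (X i)); split.
Qed.

Lemma related_surj c w p : C c -> cdom c p -> (theta w).1 = cmap c p ->
  exists u, taylor_related c u w p (tensor_coord (theta w).2).
Proof.
move=> Cc cp wp; have aI := tensor_coord_mem (theta w).2.
have [u uE] := tay_weil hA N1 IN a0 Cc cp aI.
exists u; split=> // g; rewrite -[phi c p]/(phi idc (cmap c p)) -wp.
exact: model_taylor.
Qed.

Lemma related_inj c u v w p q a b : C c -> taylor_related c u w p a ->
  taylor_related c v w q b -> u = v.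
Proof.
move=> Cc cuw cvw; have [wp wa] := related_theta Cc cuw.
have [wq wb] := related_theta Cc cvw.
case: cuw cvw => cp aI uE _ [cq bI vE _].
have pq : p = q by apply: (chart_inj cp cq); rewrite -wp -wq.
have ab : a = b by apply/funext => i; rewrite -wa -wb.
by apply: weil_ext => f; rewrite uE vE pq ab.
Qed.

Lemma related_germ c u w p a (g : smoothfun (model_atlas E)) (f : smoothfun C) :
  C c -> taylor_related c u w p a ->
  (\forall q \near (p : PC), f q = g (cmap c q)) -> w g = u f.
Proof.
move=> Cc [cp aI uE wE] fg; rewrite uE wE.
rewrite (tay_near (F := loc idc g) _ _ Cc cp) //.
by apply: filterS fg => q ->; rewrite -[phi c q]/(phi idc (cmap c q)) locE.
Qed.

(** The base point is unique, and a_i is recovered as u X for a function X with the germ of the i-th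
    centred coordinate. *)
Lemma related_fun c u w w' p q a b : C c -> taylor_related c u w p a ->
  taylor_related c u w' q b -> w = w'.
Proof.
move=> Cc cuw cuw'; have [up _] := related_bases Cc cuw.
have [uq _] := related_bases Cc cuw'.
have pq := weil_base_unique a0 hC hT up uq; subst q.
have [wp wa] := related_theta Cc cuw; have [w'p w'b] := related_theta Cc cuw'.
apply: theta_ext; first by rewrite wp.
move=> i; rewrite wa w'b; case: cuw => cp _ uE _; case: cuw' => _ _ uE' _.
have [X XE] := chart_coordinate a0 hC hT i Cc cp.
have Xt (e : 'I_n -> A) : tay e N (loc c X) (phi c p) = e i.
  by rewrite (tay_near (F := fun r => r 0 i - phi c p 0 i) _ _ Cc cp) // tay_coord.
by rewrite -[LHS]Xt -[RHS]Xt -uE -uE'.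
Qed.

Lemma prolongation_exists c : C c -> exists d, prolongs zA c d.
Proof.
move=> Cc.
have dE u : exists w, forall p, cdom c p -> weil_base zA u p ->
    exists a, taylor_related c u w p a.
  have [[p cp up]|nu] := pselect (exists2 p, cdom c p & weil_base zA u p); last first.
    (* Outside the domain of Ac any value will do. *)
    by exists b0 => p cp up; case: nu; exists p.
  have [w [a cuw]] := related_exists Cc cp up; exists w => q cq uq.
  by rewrite -(weil_base_unique a0 hC hT up uq); exists a.
have [D DP] := choice dE.
pose dom := [set u : AP | exists2 p, cdom c p & weil_base zA u p].
have D_inj u v : dom u -> dom v -> D u = D v -> u = v.
  move=> [p cp up] [q cq vq] uv; have [a cuw] := DP u p cp up.
  have [b cvw] := DP v q cq vq; rewrite -uv in cvw.
  exact: related_inj cuw cvw.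
have D_open : aff_open AE (D @` dom).
  rewrite (_ : _ @` _ = [set w | (cmap c @` cdom c) (theta w).1]).
    exact: (theta_fst_open theta_add a0 b0 (@chart_open _ _ _ _ _ c)).
  apply/seteqP; split=> [_ [u [p cp up] <-]|w [p cp pw]].
    have [a cuw] := DP u p cp up; exists p => //.
    by have [-> _] := related_theta Cc cuw.
  have [u cuw] := related_surj Cc cp (esym pw).
  have [up _] := related_bases Cc cuw.
  exists u; first by exists p.
  have [b cuD] := DP u p cp up.
  exact: related_fun cuD cuw.
exists (Chart D_inj D_open); split=> // u p g f cp up fg.
have [a cuw] := DP u p cp up; exact: related_germ cuw fg.
Qed.

(** [weil_atlas] contains every d with [prolongs zA c d], so the Taylor form has to be derived from
    this property alone; each g after c has a global function with its germ. *)
Lemma prolongation_related c d u : C c -> prolongs zA c d -> cdom d u ->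
  exists p a, taylor_related c u (cmap d u) p a.
Proof.
move=> Cc [dd dg]; rewrite dd => -[p cp up].
have [w [a [_ aI uE wE]]] := related_exists Cc cp up.
exists p, a; split=> // g.
have Cg : Cinfty (phi c @` cdom c) (loc idc g).
  move=> k; apply: (@Ck_subset _ _ _ (phi idc @` cdom idc)).
    by move=> _ [q cq <-]; exists (cmap c q).
  exact: (iffLR (smoothP (model_atlas E) a0 g) (smooth_smval g) idc erefl k).
have [f sf fE] := germ_extension hC hT Cc cp Cg.
rewrite (dg u p g (mksmooth sf) cp up).
  by rewrite uE (tay_near (F := loc idc g) _ _ Cc cp).
apply: filterS fE => q /= ->.
by rewrite -[phi c q]/(phi idc (cmap c q)) locE.
Qed.

Lemma prolongation_theta c d u p : C c -> prolongs zA c d -> cdom c p ->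
  weil_base zA u p -> (theta (cmap d u)).1 = cmap c p.
Proof.
move=> Cc cd cp up; have du : cdom d u by rewrite cd.1; exists p.
have [q [a cuw]] := prolongation_related Cc cd du.
have [uq _] := related_bases Cc cuw; have [-> _] := related_theta Cc cuw.
by rewrite (weil_base_unique a0 hC hT up uq).
Qed.

Lemma prolongation_image c d (O : set P) : C c -> prolongs zA c d ->
  cmap d @` ([set u | exists2 p, O p & weil_base zA u p] `&` cdom d) =
  [set w | (cmap c @` (O `&` cdom c)) (theta w).1].
Proof.
move=> Cc cd; apply/seteqP; split=> [_ [u [[p Op up] du] <-]|w [p [Op cp] pw]].
  move: (du); rewrite cd.1 => -[q cq uq].
  have pq := weil_base_unique a0 hC hT up uq; subst q.
  by exists p => //; rewrite (prolongation_theta Cc cd cq uq).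
have [u cuw] := related_surj Cc cp (esym pw).
have [up _] := related_bases Cc cuw.
have du : cdom d u by rewrite cd.1; exists p.
exists u; first by split=> //; exists p.
have [q [b cuD]] := prolongation_related Cc cd du.
exact: related_fun cuD cuw.
Qed.

End prolonged_charts.

(** * Transition maps of the charts Ac *)

Section weil_manifold.
Context {R : realType} {A : falgType R} {I : {vspace A}} {zA : {lrmorphism A -> R^o}}.
Hypothesis hA : local_algebra I zA.
Variable N : nat.
Hypotheses (N1 : (1 < N)%N) (IN : (I ^+ N)%VS = 0%VS).
Context {V : vectType R} {M : Type} {E : affine V M}.
Local Notation AM := (weil A (model_atlas E)).
Local Notation IAV := (tensor (subvs_of I) V).
Variables (AE : affine (V * IAV)%type AM) (theta : AM -> M * IAV).
Hypotheses (theta_bij : bijective theta)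
  (theta_base : forall u, weil_base zA u (theta u).1)
  (theta_tensor : forall u, (theta u).2 = weil_tensor I (vbasis {:V}) u (theta u).1)
  (theta_add : forall u w, theta (aff_add AE u w) =
    (aff_add E (theta u).1 w.1, (theta u).2 + w.2)).
Variables (a0 : M) (b0 : AM).
Context {P : Type}.
Variable C : set (chart E P).
Hypotheses (hC : smooth_atlas C) (hT : hausdorff_space (mspace C)).
Local Notation n := (\dim {:V}).
Local Notation AP := (weil A C).
Local Notation PC := (mspace C).
Local Notation phi := (chart_coord a0).
Implicit Types (u v : AP) (w : AM) (c : chart E P) (d : chart AE AP) (p q : P)
  (a : 'I_n -> A).

Local Notation fr := (aff_frame AE b0).
Local Notation wpt := (weil_point AE theta a0 b0).
Hypothesis weil_base_ex : forall u, exists p, weil_base zA u p.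

Lemma weil_model_tensor (x : 'I_n -> A) : (forall i, x i \in I) ->
  tensor_coord (\sum_(j < n) tens (vsproj I (x j)) (vbasis {:V})`_j) =1 x.
Proof.
move=> xI i; rewrite /tensor_coord sum_lfunE.
under eq_bigr do rewrite tensE lfunE /=.
rewrite (bigD1 i) //= big1 ?addr0 => [|j ji].
  by rewrite coord_free ?(basis_free (vbasisP _)) // eqxx scale1r vsprojK.
rewrite coord_free ?(basis_free (vbasisP _)) //.
case: eqP => [ij|_]; last by rewrite scale0r.
by rewrite ij eqxx in ji.
Qed.

(** If g is the transition map of c1 and c2, the one of d1 and d2 sends (x, a) to g x together with
    the nilpotent part of the Taylor expansion of g at x in the direction a. *)
Lemma prolongation_compatible c1 c2 d1 d2 : C c1 -> C c2 ->
  prolongs zA c1 d1 -> prolongs zA c2 d2 -> chart_compatible d1 d2.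
Proof.
move=> C1 C2 p1 p2; rewrite /chart_compatible.
set W := _ @` _.
have WE : W = [set w | (cmap c1 @` (cdom c1 `&` cdom c2)) (theta w).1].
  rewrite -[in RHS](setIC (cdom c2)).
  rewrite -(prolongation_image hA N1 IN theta_bij theta_base theta_tensor a0
    hC hT (cdom c2) C1 p1).
  by rewrite /W setIC p2.1.
have [oW0 [g sg gE]] := hC.2 c1 c2 C1 C2.
set W0 := _ @` _ in oW0 sg WE.
have oW : aff_open AE W by rewrite WE; exact: (theta_fst_open theta_add a0 b0).
split=> //.
pose fg j (r : 'rV[R]_n) := coord (vbasis {:V}) j (aff_sub E (g (aff_frame E a0 r)) a0).
pose W' := aff_frame E a0 @^-1` W0.
have oW' : open W' by exact: oW0.
have Cfg j : Cinfty W' (fg j) by exact: sg a0 (coord (vbasis {:V}) j) a0.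
(* Removing the constant term leaves an element of I, the j-th fibre coordinate of the image. *)
pose tx w j := tay (tensor_coord (theta w).2) N (fg j) (aff_coord E a0 (theta w).1)
  - (fg j (aff_coord E a0 (theta w).1))%:A.
pose t w : IAV := \sum_(j < n) tens (vsproj I (tx w j)) (vbasis {:V})`_j.
have [eta etaK thetaK] := theta_bij.
pose G w := eta (g (theta w).1, t w).
have txI w j : tx w j \in I.
  rewrite (local_zA_eq0 hA) /tx rmorphB /= tay_base ?(ltnW N1) //.
    by rewrite linearZ rmorph1 /= /GRing.scale /= mulr1; exact/eqP/subrr.
  by move=> i; apply/eqP; rewrite -(local_zA_eq0 hA) tensor_coord_mem.
exists G; last first.
  move=> u u1 u2.
  have [p [a1 r1]] := prolongation_related hA N1 IN a0 hC hT C1 p1 u1.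
  have [q [a2 r2]] := prolongation_related hA N1 IN a0 hC hT C2 p2 u2.
  have [up _] := related_bases hA N1 C1 r1.
  have [uq _] := related_bases hA N1 C2 r2.
  have pq := weil_base_unique a0 hC hT up uq; subst q.
  have [w1p w1a] := related_theta hA N1 theta_base theta_tensor C1 r1.
  have [w2p w2a] := related_theta hA N1 theta_base theta_tensor C2 r2.
  case: r1 r2 => [cp1 aI1 uE1 _] [cp2 aI2 uE2 _].
  have gp : g (cmap c1 p) = cmap c2 p by rewrite gE.
  apply: (theta_ext theta_bij); first by rewrite w2p /G thetaK /= w1p.
  move=> j; rewrite w2a /G thetaK /= /t weil_model_tensor //.
  have [X XE] := chart_coordinate a0 hC hT j C2 cp2.
  have -> : a2 j = u X.
    rewrite uE2 (tay_near (F := fun r => r 0 j - phi c2 p 0 j) _ _ C2 cp2) //.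
    by rewrite tay_coord.
  have W'p : W' (phi c1 p) by exists p => //; rewrite /phi aff_coordK.
  have near1 : \forall q \near (p : PC), X q = (fg j - cst (fg j (phi c1 p))) (phi c1 q).
    have o1 := open_nbhs_nbhs (conj (cdom_open a0 hC C1) cp1).
    have o2 := open_nbhs_nbhs (conj (cdom_open a0 hC C2) cp2).
    apply: (@filterS _ (nbhs (p : PC)) _ _ _ _ (filterI XE (filterI o1 o2))) => q [-> [q1 q2]].
    rewrite -[RHS]/(fg j (phi c1 q) - fg j (phi c1 p)) /fg /phi !aff_coordK.
    by rewrite !aff_coordE !gE.
  rewrite uE1 (tay_near _ _ C1 cp1 near1) /tx w1p -/(phi c1 p).
  have -> : tensor_coord (theta (cmap d1 u)).2 = a1 by apply/funext.
  rewrite (tay_add a1 N oW' W'p (Cfg j) (G := - cst _)).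
    by rewrite (_ : - cst _ = cst (- fg j (phi c1 p))) // tay_cst ?(ltnW N1) // scaleNr.
  move=> k; exact: (Ck_cst k (- fg j (phi c1 p)) oW').
move=> b l.
(* Smoothness is tested by scalar forms on V times the tensor space; such a form splits into one on
   each factor. *)
have [l1 l1E] : exists l1 : {scalar V}, forall x, l1 x = l (x, 0).
  apply: scalar_of_linear => k x x'; rewrite -linearP; congr (l _).
  by congr pair; rewrite /= scaler0 addr0.
have [l2 l2E] : exists l2 : {scalar IAV}, forall s, l2 s = l (0, s).
  apply: scalar_of_linear => k s s'; rewrite -linearP; congr (l _).
  by congr pair; rewrite /= scaler0 addr0.
refine (iffRL (@smooth_onP _ _ _ AE b0 _ _ oW) _) => k.
have frW : aff_frame AE b0 @^-1` W = wpt @^-1` W'.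
  by rewrite WE; apply/seteqP; split=> s; rewrite /W' /= /weil_point aff_coordK.
have oWW : open (wpt @^-1` W') by rewrite -frW; exact: (oW b0).
rewrite frW.
pose lam j (x : A) : R := l2 (tens (vsproj I x) (vbasis {:V})`_j).
have lam_lin j : linear (lam j : A -> R^o).
  by move=> c x y; rewrite /lam linearP tens_linearl linearP.
pose F1 := (fun y => l1 (aff_sub E (g y) (theta b).1)) \o aff_frame E a0.
have CF1 : Cinfty W' F1 by exact: (sg (theta b).1 l1 a0).
have -> : (fun w => l (aff_sub AE (G w) b)) \o aff_frame AE b0 =
    (F1 \o wpt + \sum_(j < n) ((fun s => lam j (tay (weil_dir AE theta b0 s) N (fg j) (wpt s)))
      - (fg j \o wpt) * cst (lam j 1))) + cst (- l2 (theta b).2).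
  apply/funext => s; rewrite -[LHS]/(l (aff_sub AE (G (fr s)) b)).
  rewrite (theta_sub theta_add) /G thetaK /=.
  rewrite (_ : (_, _) = (aff_sub E (g (theta (fr s)).1) (theta b).1, 0) +
    (0, t (fr s) - (theta b).2)); last by congr pair; rewrite /= ?addr0 ?add0r.
  rewrite linearD -l1E -l2E linearB addrA.
  rewrite -[RHS]/(F1 (wpt s) + (\sum_(j < n) _) s - l2 (theta b).2).
  congr (_ + _ - _); first by rewrite /F1 /= /weil_point aff_coordK.
  rewrite fct_sumE /t linear_sum; apply: eq_bigr => j _.
  rewrite -[LHS]/(lam j (tx (fr s) j)) /tx.
  have [lj ljE] := scalar_of_linear (lam_lin j).
  rewrite -[RHS]/(lam j _ - (fg j (wpt s)) * lam j 1) -!ljE linearB linearZ.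
  by [].
apply: (Ck_add oWW _ (Ck_cst k _ oWW)); apply: (Ck_add oWW).
  exact: (weil_point_comp theta_add a0 b0 oW' CF1).
elim/big_ind : _ => [|f f' Cf Cf'|j _].
- exact: (Ck_cst k 0 oWW).
- exact: Ck_add.
apply: (Ck_add oWW); first exact: (tay_Cinfty N theta_add a0 b0 oW' (lam_lin j) (Cfg j)).
apply: (Ck_opp oWW); apply: (Ck_mul oWW _ (Ck_cst k _ oWW)).
exact: (weil_point_comp theta_add a0 b0 oW' (Cfg j)).
Qed.

Lemma weil_smooth_atlas : smooth_atlas (weil_atlas zA AE C).
Proof.
split=> [u|d1 d2 [c1 C1 p1] [c2 C2 p2]]; last exact: (prolongation_compatible C1 C2 p1 p2).
have [p up] := weil_base_ex u; have [c Cc cp] := hC.1 p.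
have [d cd] := prolongation_exists hA N1 IN theta_bij theta_base theta_tensor
  theta_add a0 b0 hC hT Cc.
exists d; first by exists c.
by rewrite cd.1; exists p.
Qed.

End weil_manifold.

(** * Topology of AP *)

(* Over each O of the locally finite cover G the space X is cut into the open
   shells k - 1 < nu < k + 1, each of which lies in a compact set and so meets
   finitely many members of a given open cover F that suffice to cover it. *)
Lemma proper_bundle_refinement {R : realType} (X T : topologicalType) (pr : X -> T)
    (G : set (set T)) : hausdorff_space T -> continuous pr ->
  G `<=` open -> \bigcup_(O in G) O = setT -> locally_finite G ->
  (forall O, G O -> exists K U (nu : X -> R), [/\ compact K, O `<=` K, K `<=` U,
    forall x, 0 <= nu x & (forall x, U (pr x) -> {for x, continuous nu}) /\
    forall k : nat, compact [set x | K (pr x) /\ nu x <= k%:R]]) ->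
  forall F : set (set X), F `<=` open -> \bigcup_(O in F) O = setT ->
  exists G' : set (set X), [/\ G' `<=` open, \bigcup_(O in G') O = setT,
    forall O, G' O -> exists2 O', F O' & O `<=` O' & locally_finite G'].
Proof.
move=> hT cpr oG covG lfG HG F oF covF.
(* K, U and nu are made functions of O one after the other, with arbitrary values off G. *)
have /choice[K KP] : forall O, exists K : set T, G O -> exists U (nu : X -> R),
    [/\ compact K, O `<=` K, K `<=` U, forall x, 0 <= nu x &
    (forall x, U (pr x) -> {for x, continuous nu}) /\
    forall k : nat, compact [set x | K (pr x) /\ nu x <= k%:R]].
  move=> O; have [GO|nGO] := pselect (G O); last by exists set0.
  by have [K H] := HG O GO; exists K.
have /choice[U UP] : forall O, exists U : set T, G O -> exists nu : X -> R,
    [/\ compact (K O), O `<=` K O, K O `<=` U, forall x, 0 <= nu x &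
    (forall x, U (pr x) -> {for x, continuous nu}) /\
    forall k : nat, compact [set x | K O (pr x) /\ nu x <= k%:R]].
  move=> O; have [GO|nGO] := pselect (G O); last by exists set0.
  by have [U H] := KP O GO; exists U.
have /choice[nu nuP] : forall O, exists nu : X -> R, G O ->
    [/\ compact (K O), O `<=` K O, K O `<=` U O, forall x, 0 <= nu x &
    (forall x, U O (pr x) -> {for x, continuous nu}) /\
    forall k : nat, compact [set x | K O (pr x) /\ nu x <= k%:R]].
  move=> O; have [GO|nGO] := pselect (G O); last by exists (fun=> 0).
  by have [nu H] := UP O GO; exists nu.
(* The shells have width 2, so that they are open and still cover everything with integer
   centres. *)
pose S O k : set X := [set x | O (pr x) /\ k%:R - 1 < nu O x < k%:R + 1].
have oS O k : G O -> open (S O k).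
  move=> GO; have [_ OK KU _ [cnu _]] := nuP O GO.
  rewrite openE => x [ Ox /andP[k1 k2]].
  have cx : {for x, continuous (nu O)} by apply/cnu/KU/OK.
  have n1 : nbhs x (pr @^-1` O) by apply: cpr; apply: open_nbhs_nbhs; split=> //; exact: oG.
  have n2 : \forall y \near x, k%:R - 1 < nu O y.
    exact: (@cvgr_gt _ _ (nbhs x) _ (nu O) _ cx).
  have n3 : \forall y \near x, nu O y < k%:R + 1.
    exact: (@cvgr_lt _ _ (nbhs x) _ (nu O) _ cx).
  apply: (@filterS _ (nbhs x) _ _ _ _ (filterI n1 (filterI n2 n3))) => y [ Oy [ky yk]].
  by split=> //; rewrite ky.
have /choice[FF FFP] : forall Ok : set T * nat, exists F' : set (set X), G Ok.1 ->
    [/\ finite_set F', F' `<=` F & S Ok.1 Ok.2 `<=` \bigcup_(O in F') O].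
  move=> [ O k] /=; have [GO|nGO] := pselect (G O); last by exists set0.
  have [_ OK _ _ [_ cnu]] := nuP O GO.
  (* The shell around k satisfies nu < k + 1, so it lies in the compact set of level k + 1. *)
  have [|F' [fF' F'F cov]] := compact_finite_subcover (cnu k.+1) oF.
    by move=> x _; rewrite covF.
  exists F'; split=> //; apply: subset_trans cov => x [ Ox /andP[_ xk]].
  by split; [exact: OK|rewrite -natr1 ltW].
pose G' : set (set X) := [set Y | exists O k F0,
  [/\ G O, FF (O, k) F0 & Y = F0 `&` S O k]].
exists G'; split.
- move=> _ [ O [k [F0 [GO FF0 ->]]]]; have [_ F'F _] := FFP (O, k) GO.
  by apply: openI; [exact/oF/F'F|exact: oS].
- apply/seteqP; split=> // x _.
  have : setT (pr x) by []. rewrite -covG => -[ O GO Ox].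
  have [_ _ _ nu0 _] := nuP O GO.
  pose k := Num.truncn (nu O x).
  have Sx : S O k x.
    have /andP[k1 k2] : k%:R <= nu O x < k.+1%:R by exact: truncn_itv.
    split=> //; rewrite natr1 k2 andbT.
    by apply: lt_le_trans k1; rewrite ltrBlDr ltrDl.
  have [_ _ cov] := FFP (O, k) GO; have [F0 FF0 F0x] := cov x Sx.
  by exists (F0 `&` S O k) => //; exists O, k, F0.
- move=> _ [ O [k [F0 [GO FF0 ->]]]]; have [_ F'F _] := FFP (O, k) GO.
  by exists F0; [exact: F'F|exact: subIsetl].
move=> x; have [N0 N0x finN0] := lfG (pr x).
(* Near x only shells of bounded index over O occur: by continuity of nu if [pr x] is in U O, and
   otherwise because the complement of K O is a neighbourhood of [pr x]. *)
have loc O : exists NB : set X * nat, G O -> nbhs x NB.1 /\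
    forall k y, S O k y -> NB.1 y -> (k <= NB.2)%N.
  have [GO|nGO] := pselect (G O); last by exists (set0, 0%N).
  have [cK OK KU nu0 [cnu _]] := nuP O GO.
  have [Ux|nUx] := pselect (U O (pr x)).
    have nx : \forall y \near x, nu O y < nu O x + 1.
      by apply: (@cvgr_lt _ _ (nbhs x) _ (nu O) _ (cnu x Ux)); rewrite ltrDl.
    (* From k - 1 < nu y < nu x + 1 and nu x < truncn (nu x) + 1 one gets k < truncn (nu x) + 3. *)
    exists ([set y | nu O y < nu O x + 1], (Num.truncn (nu O x)).+3) => _.
    split=> //= k y [_ /andP[ky _]] /= yx.
    have xt : nu O x < (Num.truncn (nu O x)).+1%:R by exact: truncnS_gt.
    rewrite -(ler_nat R) -natr1; apply/ltW.
    rewrite ltrBlDr in ky; apply: (lt_trans ky); rewrite ltrD2r.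
    by apply: (lt_trans yx); rewrite -[X in _ < X]natr1 ltrD2r.
  exists (pr @^-1` (~` K O), 0%N) => _; split.
    apply: cpr; apply: open_nbhs_nbhs; split.
      by apply: closed_openC; exact: compact_closed.
    by move=> /KU.
  by move=> k y [/OK Ky _] /=.
have [NB NBP] := choice loc.
set GN := G `&` _ in finN0.
have /finite_fsetP[D DE] := finN0.
exists (pr @^-1` N0 `&` \bigcap_(O in GN) (NB O).1).
  apply: filterI; first exact: cpr.
  rewrite DE; apply: filter_bigI => O OD.
  have [GO _] : GN O by rewrite DE.
  by have [] := NBP O GO.
apply: (@sub_finite_set _ _ (\bigcup_(O in GN) \bigcup_(k in `I_(NB O).2.+1)
    ((fun F0 => F0 `&` S O k) @` FF (O, k)))).
  move=> Y [[ O [k [F0 [GO FF0 ->]]]] [y [[F0y Sy] [N0y Ny]]]].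
  have GNO : GN O by split=> //; exists (pr y); split=> //; case: Sy.
  exists O => //; exists k; last by exists F0.
  by have [_ H] := NBP O GO; rewrite /= ltnS; apply: H Sy (Ny O GNO).
apply: bigcup_finite => // O [GO _]; apply: bigcup_finite; first exact: finite_II.
by move=> k _; apply: finite_image; have [] := FFP (O, k) GO.
Qed.

(** * Separation and paracompactness of AP *)

Section weil_topology.
Context {R : realType} {A : falgType R} {I : {vspace A}} {zA : {lrmorphism A -> R^o}}.
Hypothesis hA : local_algebra I zA.
Variable N : nat.
Hypotheses (N1 : (1 < N)%N) (IN : (I ^+ N)%VS = 0%VS).
Context {V : vectType R} {M : Type} {E : affine V M}.
Local Notation AM := (weil A (model_atlas E)).
Local Notation IAV := (tensor (subvs_of I) V).
Variables (AE : affine (V * IAV)%type AM) (theta : AM -> M * IAV).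
Hypotheses (theta_bij : bijective theta)
  (theta_base : forall u, weil_base zA u (theta u).1)
  (theta_tensor : forall u, (theta u).2 = weil_tensor I (vbasis {:V}) u (theta u).1)
  (theta_add : forall u w, theta (aff_add AE u w) =
    (aff_add E (theta u).1 w.1, (theta u).2 + w.2)).
Variables (a0 : M) (b0 : AM).
Context {P : Type}.
Variable C : set (chart E P).
Hypotheses (hC : smooth_atlas C) (hP : paracompact (mspace C)).
Local Notation n := (\dim {:V}).
Local Notation AP := (weil A C).
Local Notation PC := (mspace C).
Local Notation phi := (chart_coord a0).
Implicit Types (u v : AP) (w : AM) (c : chart E P) (d : chart AE AP) (p q : P)
  (a : 'I_n -> A).

Local Notation m := (\dim {: (V * IAV)%type}).
Local Notation WA := (weil_atlas zA AE C).
Local Notation WP := (mspace WA).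
Local Notation wpt := (weil_point AE theta a0 b0).
Hypothesis hW : smooth_atlas WA.
Variable pr : AP -> P.
Hypothesis prP : forall u, weil_base zA u (pr u).

Let hT : hausdorff_space PC. Proof. by case: hP. Qed.

Lemma weil_base_eq u p : weil_base zA u p -> pr u = p.
Proof. exact: (weil_base_unique a0 hC hT (prP u)). Qed.

Lemma weil_base_preimage_open (O : set PC) : open O -> open ([set u | O (pr u)] : set WP).
Proof.
move=> oO; rewrite open_mspace => d [c Cc cd].
have -> : [set u | O (pr u)] = [set u | exists2 p, O p & weil_base zA u p].
  apply/seteqP; split=> u /=; first by exists (pr u).
  by move=> [p Op /weil_base_eq ->].
rewrite (prolongation_image hA N1 IN theta_bij theta_base theta_tensor a0 hC hT O Cc cd).
exact: (theta_fst_open theta_add a0 b0 (oO c Cc)).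
Qed.

Lemma weil_base_continuous : continuous (pr : WP -> PC).
Proof.
move=> u Y; rewrite nbhsE => -[ O [ oO Ou] OY].
apply: (@filterS _ (nbhs (u : WP)) _ [set v | O (pr v)]); first by move=> v /OY.
by apply: open_nbhs_nbhs; split=> //; exact: weil_base_preimage_open.
Qed.

Lemma prolongation_dom c d u : prolongs zA c d -> cdom d u <-> cdom c (pr u).
Proof.
move=> cd; rewrite cd.1; split=> [[p cp up]|cp]; last by exists (pr u).
by rewrite (weil_base_eq up).
Qed.

(** Points over different base points are separated through the continuous projection; points over
    the same one lie in a common chart. *)
Lemma weil_hausdorff : hausdorff_space WP.
Proof.
move=> u v uv.
have puv : pr u = pr v.
  apply: hT => X Y Xu Yv.
  have [w [Xw Yw]] := uv _ _ (weil_base_continuous Xu) (weil_base_continuous Yv).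
  by exists (pr w).
have [d Wd du] := hW.1 u; have [c Cc cd] := Wd.
have dv : cdom d v by apply/(prolongation_dom _ cd); rewrite -puv; exact/(prolongation_dom _ cd).
exact: (chart_separated b0 hW Wd du dv).
Qed.

Lemma weil_chart_continuous d u : WA d -> cdom d u ->
  {for (u : WP), continuous (chart_coord b0 d : WP -> 'rV[R]_m)}.
Proof.
move=> Wd du B Bu; have := nbhs_phi hW Wd du Bu.
by apply: filterS => v [].
Qed.

(** In coordinates this is a closed ball cut with the closed preimage of the compact image of K. As
    K lies in the domain of c, the intersection stays inside the image of d. *)
Lemma weil_compact c d (K : set PC) (k : nat) : C c -> prolongs zA c d ->
  compact K -> K `<=` cdom c ->
  compact ([set u | K (pr u) /\ `|chart_coord b0 d u| <= k%:R] : set WP).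
Proof.
move=> Cc cd cK Kc; have Wd : WA d by exists c.
have cphi p : cdom c p -> {for (p : PC), continuous (phi c : PC -> 'rV[R]_n)}.
  move=> cp B Bp; have := nbhs_phi hC Cc cp Bp.
  by apply: filterS => q [].
have cphiK : compact (phi c @` K).
  apply: continuous_compact cK; apply: continuous_in_subspaceT => p /set_mem/Kc.
  exact: cphi.
have clphiK := compact_closed (@norm_hausdorff R 'rV[R]_n) cphiK.
pose B : set 'rV[R]_m := [set s | `|s - 0| <= k%:R] `&` (wpt @^-1` (phi c @` K)).
have [clb cb] := closed_ball_rV (0 : 'rV[R]_m) k%:R.
have cB : compact B.
  apply: subclosed_compact cb _; last by move=> s [].
  apply: closedI => //; apply: closed_comp clphiK => s _.
  exact: (weil_point_continuous theta_add).
have BD : B `<=` chart_coord b0 d @` cdom d.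
  move=> s [_ [p Kp ps]].
  have : [set w | (cmap c @` (setT `&` cdom c)) (theta w).1] (aff_frame AE b0 s).
    exists p; first by split=> //; exact: Kc.
    by apply: (can_inj (aff_coordK E a0)); exact: ps.
  rewrite -(prolongation_image hA N1 IN theta_bij theta_base theta_tensor a0
    hC hT setT Cc cd) => -[u [_ du] us].
  by exists u => //; rewrite /chart_coord us aff_frameK.
have := phi_compact Wd BD cB; congr compact.
apply/seteqP; split=> [u [du [uk [p Kp pu]]]|u [Ku uk]].
  rewrite /= subr0 in uk; split=> //.
  have cu := (iffLR (prolongation_dom _ cd) du).
  move: pu; rewrite /weil_point /chart_coord aff_coordK.
  rewrite (prolongation_theta hA N1 IN theta_base theta_tensor a0 hC hT Cc cd cu (prP u)).
  by move=> /(phi_inj (Kc _ Kp) cu) <-.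
have cu := Kc _ Ku; split; first exact/(prolongation_dom _ cd).
split; first by rewrite /= subr0.
exists (pr u) => //; rewrite /weil_point /chart_coord aff_coordK.
by rewrite (prolongation_theta hA N1 IN theta_base theta_tensor a0 hC hT Cc cd cu (prP u)).
Qed.

Lemma weil_paracompact : paracompact WP.
Proof.
split; first exact: weil_hausdorff.
have [G [ oG covG kcG lfG]] := chart_compact_cover a0 hC hP.
apply: (@proper_bundle_refinement R WP PC pr G hT weil_base_continuous oG covG lfG).
move=> O /kcG[K [c [cK OK Cc Kc]]].
have [d cd] := prolongation_exists hA N1 IN theta_bij theta_base theta_tensor
  theta_add a0 b0 hC hT Cc.
have Wd : WA d by exists c.
(* The norm of the full chart coordinate is used; its base part does no harm, being bounded over the
   compact K. *)
exists K, (cdom c), (fun u => `|chart_coord b0 d u|); split=> //; split.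
  move=> u cu; have du : cdom d u by exact/(prolongation_dom _ cd).
  apply: (@continuous_comp _ _ _ (chart_coord b0 d : WP -> _) (fun s : 'rV[R]_m => `|s|)).
    exact: weil_chart_continuous.
  exact: norm_continuous.
by move=> k; exact: weil_compact cd cK Kc.
Qed.

End weil_topology.

Theorem proposition11 (R : realType) (A : falgType R) (I : {vspace A})
  (zA : {lrmorphism A -> R^o}) (hA : local_algebra I zA)
  (V : vectType R) (M : Type) (E : affine V M)
  (P : Type) (C : set (chart E P)) (hP : manifold C) (hcard : nonmeasurable P) :
  exists AE : affine (V * tensor (subvs_of I) V)%type (weil A (model_atlas E)),
    [/\ weil_affine zA AE,
        forall c, C c -> exists d : chart AE (weil A C), prolongs zA c d &
        manifold (weil_atlas zA AE C)].
Proof.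
have [AE AEP] := weil_affine_exists E hA.
have [theta [theta_bij theta_base theta_tensor theta_add]] := AEP.
have {}theta_tensor := theta_tensor _ (vbasisP fullv).
have [N0 IN0] := local_nilpotent hA.
have IN : (I ^+ N0.+2)%VS = 0%VS by rewrite -addn2 expvD IN0 prod0v.
have N1 : (1 < N0.+2)%N by [].
have [a0] := aff_inhabited E; have [b0] := aff_inhabited AE.
have [hC hPC] := hP; have hT := hPC.1.
have [pr prP] := choice (weil_base_exists a0 hC hPC zA hcard).
have hW : smooth_atlas (weil_atlas zA AE C).
  apply: (weil_smooth_atlas hA N1 IN theta_bij theta_base theta_tensor theta_add
    a0 b0 hC hT) => u.
  by exists (pr u).
exists AE; split=> // [c Cc|].
  exact: (prolongation_exists hA N1 IN theta_bij theta_base theta_tensor theta_add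
    a0 b0 hC hT Cc).
split=> //.
exact: (weil_paracompact hA N1 IN theta_bij theta_base theta_tensor theta_add
  a0 b0 hC hPC hW prP).
Qed.
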